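(* The simply connected complete model of an EPS space consists, up to homothety, of $\mathbb{R}^4$ with the metric $$g=dt^2+e^{-t}d\xi^2+e^{t}(d\eta^2+d\zeta^2)$$ in the coordinates $t,\xi,\eta,\zeta$; that is, $(\mathbb{R}^4,g)$ is complete, and the Riemannian universal covering of every EPS space is homothetic to $(\mathbb{R}^4,g)$. The full isometry group of $(\mathbb{R}^4,g)$ is five-dimensional, acts on $\mathbb{R}^4$ transitively, and has the identity component $G$ formed by the mappings $$\mathbb{R}^4=\mathbb{R}^2\times\mathbb{C}\ni(t,\xi,\eta+i\zeta)\mapsto(t+2c,\ e^{c}\xi+p,\ e^{-c}w(\eta+i\zeta)+q)$$ depending on the parameters $c,p\in\mathbb{R}$ and $w,q\in\mathbb{C}$ with $|w|=1$.
   Context: An EPS space is a Riemannian four-manifold $(M,g_M)$, where $M$ is a connected Lie group carrying left-invariant $g_M$-orthonormal vector fields $u_1,\dots,u_4$ which trivialize $TM$ and have the Lie brackets $$[u_1,u_2]=au_2,\quad[u_1,u_3]=-au_3-bu_4,\quad[u_1,u_4]=bu_3-au_4,\quad[u_2,u_3]=[u_2,u_4]=[u_3,u_4]=0,$$ with real constants $a\ne0$ and $b$. Two Riemannian manifolds are homothetic if some diffeomorphism between them pulls one metric back to a positive constant multiple of the other. *)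

(* Defs.v *)
From HB Require Import structures.
From mathcomp Require Import all_boot all_order all_algebra.
From mathcomp Require Import complex.
From mathcomp Require Import ring.
From mathcomp Require Import all_classical all_reals all_analysis.

Set Implicit Arguments.
Unset Strict Implicit.
Unset Printing Implicit Defensive.

Import Order.TTheory GRing.Theory Num.Theory.
Import numFieldNormedType.Exports.

Local Open Scope classical_set_scope.
Local Open Scope ring_scope.

(* Vectors are row vectors: a linear map acts by [v *m A], a bilinear form with
   Gram matrix [g] takes the value [(v *m g *m w^T) 0 0], and the differential
   of a map in coordinates is [jacobian]. *)

Section SmoothMaps.
Variables (R : realType) (V W : normedModType R).

(* Only used for open D. *)
Fixpoint Ck_on (k : nat) (D : set V) (f : V -> W) : Prop :=
  match k with
  | 0 => forall x, D x -> {for x, continuous f}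
  | k'.+1 => (forall x, D x -> differentiable f x) /\
             (forall v : V, Ck_on k' D ('D_v f))
  end.

Definition smooth_on (D : set V) (f : V -> W) : Prop := forall k, Ck_on k D f.

End SmoothMaps.

Section Manifolds.
Variable R : realType.

(* [chart_fun] and [chart_inv] are total functions, meaningful on [chart_dom]
   and on its image only. *)
Record chart (n : nat) (M : topologicalType) := Chart {
  chart_dom : set M;
  chart_fun : M -> 'rV[R]_n;
  chart_inv : 'rV[R]_n -> M;
  chart_dom_open : open chart_dom;
  chart_img_open : open (chart_fun @` chart_dom);
  chart_funK : forall p, chart_dom p -> chart_inv (chart_fun p) = p;
  chart_fun_continuous :
    forall p, chart_dom p -> {for p, continuous chart_fun};
  chart_inv_continuous :
    forall x, (chart_fun @` chart_dom) x -> {for x, continuous chart_inv} }.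

(* [mf_chart p] is a chosen chart around [p]; it is used to represent tangent
   vectors at [p] by their components in that chart. *)
Record manifold (n : nat) := Manifold {
  mf_space :> topologicalType;
  mf_hausdorff : hausdorff_space mf_space;
  mf_second_countable : @second_countable mf_space;
  mf_atlas : set (chart n mf_space);
  mf_chart : mf_space -> chart n mf_space;
  mf_chart_atlas : forall p, mf_atlas (mf_chart p);
  mf_chart_dom : forall p, chart_dom (mf_chart p) p;
  mf_transition : forall c d, mf_atlas c -> mf_atlas d ->
    smooth_on (chart_fun c @` (chart_dom c `&` chart_dom d))
              (chart_fun d \o chart_inv c) }.

Arguments mf_atlas {n} M : rename.

Definition smooth_map (m n : nat) (M : manifold m) (N : manifold n)
    (F : M -> N) : Prop :=
  continuous F /\
  forall c d, mf_atlas M c -> mf_atlas N d ->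
    smooth_on (chart_fun c @` (chart_dom c `&` F @^-1` chart_dom d))
              (chart_fun d \o F \o chart_inv c).

Definition diffeomorphism (n : nat) (M N : manifold n) (F : M -> N) : Prop :=
  exists G : N -> M,
    [/\ cancel F G, cancel G F, smooth_map F & smooth_map G].

Definition differential (m n : nat) (M : manifold m) (N : manifold n)
    (F : M -> N) (p : M) : 'M[R]_(m, n) :=
  jacobian (chart_fun (mf_chart (F p)) \o F \o chart_inv (mf_chart p))
           (chart_fun (mf_chart p) p).

(* [X p] lists the components of X at p with respect to [mf_chart p]. *)
Definition vector_field (n : nat) (M : manifold n) := M -> 'rV[R]_n.

(* The components of X in the chart c, as functions of the coordinates. *)
Definition local_field (n : nat) (M : manifold n) (X : vector_field M)
    (c : chart n M) (x : 'rV[R]_n) : 'rV[R]_n :=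
  let p := chart_inv c x in
  X p *m jacobian (chart_fun c \o chart_inv (mf_chart p))
                  (chart_fun (mf_chart p) p).

Definition smooth_field (n : nat) (M : manifold n) (X : vector_field M) : Prop :=
  forall c, mf_atlas M c ->
    smooth_on (chart_fun c @` chart_dom c) (local_field X c).

(* [X, Y]^j = X^i d_i Y^j - Y^i d_i X^j *)
Definition lie_bracket (n : nat) (M : manifold n) (X Y : vector_field M) :
    vector_field M :=
  fun p =>
    let c := mf_chart p in
    let x := chart_fun c p in
    'D_(local_field X c x) (local_field Y c) x
      - 'D_(local_field Y c x) (local_field X c) x.

Record lie_group_structure (n : nat) (M : manifold n) := LieGroupStructure {
  lg_mul : M -> M -> M;
  lg_one : M;
  lg_inv : M -> M;
  lg_mulA : associative lg_mul;
  lg_mul1 : left_id lg_one lg_mul;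
  lg_mulV : left_inverse lg_one lg_inv lg_mul;
  lg_mul_continuous : continuous (fun pq : M * M => lg_mul pq.1 pq.2);
  lg_mul_smooth : forall c d e, mf_atlas M c -> mf_atlas M d -> mf_atlas M e ->
    smooth_on
      [set xy | exists p q, [/\ chart_dom c p, chart_dom d q,
         chart_dom e (lg_mul p q) & xy = (chart_fun c p, chart_fun d q)]]
      (fun xy : 'rV[R]_n * 'rV[R]_n =>
         chart_fun e (lg_mul (chart_inv c xy.1) (chart_inv d xy.2)));
  lg_inv_smooth : smooth_map lg_inv }.

Definition left_invariant (n : nat) (M : manifold n)
    (S : lie_group_structure M) (X : vector_field M) : Prop :=
  forall h p, X p *m differential (lg_mul S h) p = X (lg_mul S h p).

Record riemannian (n : nat) := Riemannian {
  rm_manifold :> manifold n;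
  rm_metric : rm_manifold -> 'M[R]_n;
  rm_sym : forall p, (rm_metric p)^T = rm_metric p;
  rm_pos : forall p (v : 'rV[R]_n), v != 0 -> 0 < (v *m rm_metric p *m v^T) 0 0;
  rm_smooth : forall c, mf_atlas rm_manifold c ->
    smooth_on (chart_fun c @` chart_dom c)
      (fun x => let p := chart_inv c x in
        let J := jacobian (chart_fun (mf_chart p) \o chart_inv c) x in
        J *m rm_metric p *m J^T) }.

Definition pullback_metric (m n : nat) (M : riemannian m) (N : riemannian n)
    (F : M -> N) (p : M) : 'M[R]_m :=
  let J := differential F p in J *m rm_metric (F p) *m J^T.

Definition homothetic (n : nat) (M N : riemannian n) : Prop :=
  exists F : M -> N, diffeomorphism F /\
    exists k : R, 0 < k /\
      forall p, pullback_metric F p = k *: rm_metric p.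

Definition isometries (n : nat) (M : riemannian n) : set (M -> M) :=
  [set F | diffeomorphism F /\ forall p, pullback_metric F p = rm_metric p].

Arguments isometries {n} M : rename.

(* Curves are parametrized by [0, 1] and extended to the whole real line. *)
Definition smooth_curve (n : nat) (M : manifold n) (gam : R -> M) : Prop :=
  continuous gam /\
  forall c, mf_atlas M c ->
    smooth_on (gam @^-1` chart_dom c) (chart_fun c \o gam).

Definition speed (n : nat) (M : riemannian n) (gam : R -> M) (s : R) : R :=
  let v := 'D_1 (chart_fun (mf_chart (gam s)) \o gam) s in
  Num.sqrt ((v *m rm_metric (gam s) *m v^T) 0 0).

Definition curve_length (n : nat) (M : riemannian n) (gam : R -> M) : R :=
  \int[lebesgue_measure]_(s in `[0, 1]) speed gam s.

(* A piecewise smooth curve from p to q is the list of its smooth pieces. *)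
Fixpoint piecewise_curve (n : nat) (M : manifold n) (p q : M)
    (s : seq (R -> M)) : Prop :=
  match s with
  | [::] => p = q
  | gam :: s' =>
      [/\ smooth_curve gam, gam 0 = p & piecewise_curve (gam 1) q s']
  end.

(* Of interest for connected M only, where the infimum is over a nonempty
   set. *)
Definition riemannian_distance (n : nat) (M : riemannian n) (p q : M) : R :=
  inf [set \sum_(gam <- s) curve_length gam | s in piecewise_curve p q].

Definition complete_riemannian (n : nat) (M : riemannian n) : Prop :=
  forall u : nat -> M,
    (forall e : R, 0 < e -> exists K, forall i j, (K <= i)%N -> (K <= j)%N ->
       riemannian_distance (u i) (u j) < e) ->
    exists p, riemannian_distance (u i) p @[i --> \oo] --> (0 : R).

Definition simply_connected (T : topologicalType) : Prop :=
  (forall p q : T, exists f : R -> T,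
     [/\ {within `[0, 1]%classic, continuous f}, f 0 = p & f 1 = q]) /\
  (forall f : R -> T, {within `[0, 1]%classic, continuous f} -> f 0 = f 1 ->
     exists H : R * R -> T,
       [/\ {within `[0, 1]%classic `*` `[0, 1]%classic, continuous H},
           forall s, 0 <= s <= 1 -> H (0, s) = f s,
           forall s, 0 <= s <= 1 -> H (1, s) = f 0 &
           forall r, 0 <= r <= 1 -> H (r, 0) = f 0 /\ H (r, 1) = f 0]).

Definition covering_map (T U : topologicalType) (pi : T -> U) : Prop :=
  [/\ continuous pi,
      forall q, exists p, pi p = q &
      forall q, exists O : set U, [/\ open O, O q &
        exists sheets : set (set T),
          [/\ forall A B, sheets A -> sheets B -> A `&` B !=set0 -> A = B,
              \bigcup_(A in sheets) A = pi @^-1` O &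
              forall A, sheets A ->
                [/\ open A, set_inj A pi, pi @` A = O &
                    forall B, open B -> B `<=` A -> open (pi @` B)]]]].

Definition riemannian_universal_covering (n : nat) (N M : riemannian n)
    (pi : N -> M) : Prop :=
  [/\ simply_connected N, covering_map pi, smooth_map pi &
      forall p, pullback_metric pi p = rm_metric p].

(* u 0, u 1, u 2, u 3 stand for u_1, u_2, u_3, u_4. *)
Definition EPS_space (M : riemannian 4) : Prop :=
  exists (S : lie_group_structure M) (a b : R) (u : 'I_4 -> vector_field M),
  [/\ connected [set: M],
      a != 0,
      (forall i, smooth_field (u i) /\ left_invariant S (u i)),
      (forall p, (\matrix_i u i p) \in unitmx) &
      (forall p i j, (u i p *m rm_metric p *m (u j p)^T) 0 0 = (i == j)%:R)] /\
  forall p,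
  [/\ lie_bracket (u 0) (u 1) p = a *: u 1 p,
      lie_bracket (u 0) (u 2) p = - a *: u 2 p - b *: u 3 p,
      lie_bracket (u 0) (u 3) p = b *: u 2 p - a *: u 3 p &
      [/\ lie_bracket (u 1) (u 2) p = 0, lie_bracket (u 1) (u 3) p = 0 &
          lie_bracket (u 2) (u 3) p = 0]].

(* The isometry group carries the compact-open topology; its dimension is that
   of a Lie group isomorphic to it as a topological group. *)
Definition isometry_group_dim (n : nat) (M : riemannian n) (k : nat) : Prop :=
  exists (L : manifold k) (S : lie_group_structure L) (Phi : L -> M -> M),
    [/\ injective Phi,
        range Phi = isometries M,
        forall x y, Phi (lg_mul S x y) = Phi x \o Phi y &
        forall A : set L, open A <->
          exists2 O : set {compact-open, M -> M}, open O & A = Phi @^-1` O].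

Definition isometry_identity_component (n : nat) (M : riemannian n) :
    set (M -> M) :=
  connected_component (isometries M : set {compact-open, M -> M}) id.

End Manifolds.

Arguments mf_atlas {R n} M : rename.
Arguments isometries {R n} M : rename.
Arguments isometry_identity_component {R n} M.

Section EuclideanManifold.
Variables (R : realType) (n : nat).

Lemma Ck_on_id (V : normedModType R) k (D : set V) : Ck_on k D id.
Proof.
have Ccst j (w : V) : Ck_on j D (cst w).
  elim: j w => [|j IH] w /=; first by move=> x _; exact: cvg_cst.
  split=> [x _|v]; first exact: differentiable_cst.
  have -> : 'D_v (cst w : V -> V) = cst 0.
    by apply/funext => x; rewrite derive_cst.
  exact: IH.
case: k => [|k] /=; first by move=> x _; exact: cvg_id.
split=> [x _|v]; first exact: ex_diff.
have -> : 'D_v (id : V -> V) = cst v by apply/funext => x; rewrite derive_id.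
exact: Ccst.
Qed.

Lemma jacobian_id (x : 'rV[R]_n) : jacobian id x = 1%:M.
Proof.
apply/row_matrixP => i; rewrite !rowE mulmx1.
by rewrite -deriveEjacobian ?derive_id//; exact: ex_diff.
Qed.

Lemma rV_second_countable : @second_countable 'rV[R]_n.
Proof.
pose B := [set ball (map_mx ratr qr.1 : 'rV[R]_n) (ratr qr.2) |
           qr in [set qr : 'rV[rat]_n * rat | 0 < qr.2]].
exists B; first exact: (sub_countable (card_image_le _ _) (countableP _)).
split=> [_ [[q r] /= r0 <-]|x A].
  by apply: ball_open; rewrite ltr0q.
move=> /nbhs_ballP[e /= e0 xeA].
have [r] : exists r : rat, ratr r \in `]0, e / 2[%R.
  by apply: rat_in_itvoo; rewrite divr_gt0.
rewrite in_itv/= ltr0q => /andP[r0 re].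
have /choice[q qP] (i : 'I_n) :
    exists q : rat, ratr q \in `]x 0 i, x 0 i + ratr r[%R.
  by apply: rat_in_itvoo; rewrite ltrDl ltr0q.
have xq : ball (map_mx ratr (\row_i q i) : 'rV[R]_n) (ratr r) x.
  split; first by rewrite ltr0q.
  move=> i j; rewrite ord1 !mxE; have := qP j.
  rewrite in_itv/= => /andP[qj1 qj2].
  by rewrite /ball/= ger0_norm ?subr_ge0 1?ltW// ltrBlDl.
exists (ball (map_mx ratr (\row_i q i) : 'rV[R]_n) (ratr r)).
  by split=> //; exists (\row_i q i, r).
move=> y qy; apply: xeA; apply: (@le_ball _ _ _ (ratr r + ratr r)).
  by rewrite (splitr e) lerD ?ltW.
exact: ball_triangle (ball_sym xq) qy.
Qed.

Lemma id_chart_img_open : open ((id : 'rV[R]_n -> 'rV[R]_n) @` setT).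
Proof. by rewrite image_id; exact: openT. Qed.

Definition id_chart : chart R n ('rV[R]_n : topologicalType) :=
  @Chart R n ('rV[R]_n : topologicalType) setT id id openT id_chart_img_open
    (fun _ _ => erefl) (fun _ _ => cvg_id) (fun _ _ => cvg_id).

Lemma id_chart_transition (c d : chart R n ('rV[R]_n : topologicalType)) :
  [set id_chart] c -> [set id_chart] d ->
  smooth_on (chart_fun c @` (chart_dom c `&` chart_dom d))
            (chart_fun d \o chart_inv c).
Proof. by move=> -> -> k; exact: Ck_on_id. Qed.

Definition euclidean_manifold : manifold R n :=
  @Manifold R n ('rV[R]_n : topologicalType) (@norm_hausdorff _ _)
    rV_second_countable [set id_chart] (fun=> id_chart) (fun=> erefl)
    (fun _ => I) id_chart_transition.

End EuclideanManifold.

Section Model.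
Variable R : realType.

Definition row4 (a b c d : R) : 'rV[R]_4 := \row_(i < 4) [:: a; b; c; d]`_i.

(* The coordinates of x are t = x 0 0, xi = x 0 1, eta = x 0 2 and
   zeta = x 0 3. *)
Definition model_metric (x : euclidean_manifold R 4) : 'M[R]_4 :=
  let t := (x : 'rV[R]_4) 0 0 in
  diag_mx (row4 1 (expR (- t)) (expR t) (expR t)).

Lemma model_metric_sym x : (model_metric x)^T = model_metric x.
Proof. exact: tr_diag_mx. Qed.

Lemma model_metric_pos x (v : 'rV[R]_4) :
  v != 0 -> 0 < (v *m model_metric x *m v^T) 0 0.
Proof.
move=> v0.
pose d := row4 1 (expR (- (x : 'rV[R]_4) 0 0)) (expR ((x : 'rV[R]_4) 0 0))
  (expR ((x : 'rV[R]_4) 0 0)).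
have d_gt0 i : 0 < d 0 i.
  by rewrite mxE; case: i => -[|[|[|[|]]]] //= _; rewrite expR_gt0.
have -> : (v *m model_metric x *m v^T) 0 0 = \sum_i v 0 i ^+ 2 * d 0 i.
  by rewrite mxE; apply: eq_bigr => i _; rewrite mul_mx_diag !mxE; ring.
have [i vi0] : exists i, v 0 i != 0 by apply/rV0Pn.
rewrite (bigD1 i)//= ltr_wpDr//.
  by apply: sumr_ge0 => j _; rewrite mulr_ge0 ?sqr_ge0// ltW.
by rewrite mulr_gt0// exprn_even_gt0.
Qed.

Lemma is_diff_exp_coord (s : R) (x : 'rV[R]_4) :
  is_diff x (fun y : 'rV[R]_4 => expR (s * y 0 0))
            (fun v => s * v 0 0 * expR (s * x 0 0)).
Proof.
pose f (y : 'rV[R]_4) : R := s * y 0 0.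
have f_lin : linear f by move=> k u v; rewrite /f !mxE /GRing.scale/=; ring.
pose fM := GRing.isLinear.Build _ _ _ _ _ f_lin.
pose fL : {linear 'rV[R]_4 -> R} := HB.pack f fM.
have f_cont : continuous fL.
  move=> y; apply: (@continuousM _ _ (fun=> s) (fun z : 'rV[R]_4 => z 0 0)).
    exact: cst_continuous.
  exact: coord_continuous.
have df : is_diff x f f.
  have d : differentiable fL x by exact: linear_differentiable.
  have e : 'd fL x = fL :> (_ -> _) by exact: diff_lin.
  exact: (@DiffDef _ _ _ _ _ f f d e).
have dexp : is_diff (f x) (expR : R -> R) (fun h => h *: expR (f x)).
  have d : differentiable (expR : R -> R) (f x).
    exact/derivable1_diffP/derivable_expR.
  apply: DiffDef => //; rewrite diff1E//; apply/funext => h.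
  rewrite derive1E; congr (_ *: _); exact: derive_val.
exact: is_diff_comp df dexp.
Qed.

Lemma Ck_on_exp2 k (D : set 'rV[R]_4) (A B C : 'M[R]_4) :
  Ck_on k D (fun x : 'rV[R]_4 =>
    A + expR (-1 * x 0 0) *: B + expR (1 * x 0 0) *: C).
Proof.
have dE (s : R) (E : 'M[R]_4) (x : 'rV[R]_4) :
    is_diff x (fun y : 'rV[R]_4 => expR (s * y 0 0) *: E)
              (fun v => (s * v 0 0 * expR (s * x 0 0)) *: E).
  have [d1 d2] := is_diff_exp_coord s x.
  by apply: DiffDef; [exact: differentiableZl|rewrite diffZl// d2].
have dF (A' B' C' : 'M[R]_4) (x : 'rV[R]_4) :
    is_diff x
      (fun y => A' + expR (-1 * y 0 0) *: B' + expR (1 * y 0 0) *: C')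
      (fun v => 0 + (-1 * v 0 0 * expR (-1 * x 0 0)) *: B'
                  + (1 * v 0 0 * expR (1 * x 0 0)) *: C').
  have [d1 d2] := is_diffD (is_diffD (is_diff_cst A' x) (dE (-1) B' x))
    (dE 1 C' x).
  by apply: DiffDef; [exact: d1|exact: d2].
elim: k A B C => [|k IH] A B C /=.
  by move=> x _; apply: differentiable_continuous; have [] := dF A B C x.
split=> [x _|v]; first by have [] := dF A B C x.
rewrite (_ : 'D_v _ = (fun x : 'rV[R]_4 => 0
    + expR (-1 * x 0 0) *: ((-1 * v 0 0) *: B)
    + expR (1 * x 0 0) *: ((1 * v 0 0) *: C))); first exact: IH.
apply/funext => x; have [d1 d2] := dF A B C x.
by rewrite deriveE// d2 !scalerA ![expR _ * _]mulrC.
Qed.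

Lemma model_metric_smooth (c : chart R 4 (euclidean_manifold R 4)) :
  mf_atlas (euclidean_manifold R 4) c ->
  smooth_on (chart_fun c @` chart_dom c)
    (fun x => let p := chart_inv c x in
      let J := jacobian (chart_fun (mf_chart p) \o chart_inv c) x in
      J *m model_metric p *m J^T).
Proof.
move=> -> k /=.
rewrite (_ : (fun x => _) = (fun x : 'rV[R]_4 =>
    diag_mx (row4 1 0 0 0) + expR (-1 * x 0 0) *: diag_mx (row4 0 1 0 0)
      + expR (1 * x 0 0) *: diag_mx (row4 0 0 1 1))); first exact: Ck_on_exp2.
apply/funext => x; rewrite mulN1r mul1r.
rewrite [jacobian _ _]jacobian_id mul1mx trmx1 mulmx1 -!linearZ -!linearD/=.
congr diag_mx; apply/rowP => -[[|[|[|[|//]]]] i]; rewrite !mxE /=; ring.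
Qed.

Definition model : riemannian R 4 :=
  @Riemannian R 4 (euclidean_manifold R 4) model_metric
    model_metric_sym model_metric_pos model_metric_smooth.

Definition model_map (c p : R) (w q : R[i]) (x : 'rV[R]_4) : 'rV[R]_4 :=
  let z := (expR (- c))%:C%C * w * (x 0 2 +i* x 0 3)%C + q in
  row4 (x 0 0 + 2 * c) (expR c * x 0 1 + p) (complex.Re z) (complex.Im z).

Definition model_group : set (model -> model) :=
  [set F | exists (c p : R) (w q : R[i]), `|w| = 1 /\ F = model_map c p w q].

End Model.

Arguments model_group R : clear implicits.

(* Main.v *)
(* Let b' = b / (2a), let u be the frame of an EPS space and theta its dual
   coframe.  The bracket relations make 2a theta_1 closed, so that near the unit
   it is dt for a function t; then e^(t/2) theta_2 is closed too, and so are
   e^(-t/2) theta_3 and e^(-t/2) theta_4 after the rotation by the angle b't.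
   Their primitives, scaled by 2a, are the other coordinates.  By left invariance
   and uniqueness of such primitives, these coordinates form a local isomorphism
   onto R x R^3, where s in R acts on R^3 = R x C by multiplication with e^(s/2)
   and with e^(-s/2 - i b's).  The inverse of that local isomorphism extends
   along one-parameter subgroups to a homomorphism from R x R^3 to the connected
   group M; it is a covering and, for the model metric, a local homothety.  Any
   other universal covering factors through it by a lift.

   The model is complete because |t(p) - t(q)| <= d(p, q), and the metric is
   comparable to the Euclidean one where t is bounded.

   Let F be an isometry of the model and T = t o F.  Then |dT| = 1, and the Koszul
   formula for the second derivatives of F gives Hess T = P / 2, where P is the
   pullback of the t-derivative of g.  Hence the Laplacian of T is 1/2 and
   |Hess T|^2 = 3/4, so that Bochner's formula gives Ric(grad T, grad T) = - 3/4.
   This is the least eigenvalue of Ric and is attained only along d/dt, whence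
   T = t + const.  Comparing the pullbacks of g and of its t-derivative, F carries
   one constant metric to another and is affine; it is thus a map of the listed
   form, up to the reflection of xi and complex conjugation of eta + i zeta.
   These maps are parametrized by a subset of R^8 whose circle factor has the
   charts tan (phi / 2), and the compact-open topology is read off from the values
   of F at the origin and at the unit vectors. *)

Require Import Defs.
From HB Require Import structures.
From mathcomp Require Import all_boot all_order all_algebra.
From mathcomp Require Import complex ring lra.
From mathcomp Require Import all_classical all_reals all_analysis.

Set Implicit Arguments.
Unset Strict Implicit.
Unset Printing Implicit Defensive.

Import Order.TTheory GRing.Theory Num.Theory.
Import numFieldNormedType.Exports.

Local Open Scope classical_set_scope.
Local Open Scope ring_scope.

(** * Smooth maps between normed spaces *)

(** No flow or exponential map is used. All integration happens in the Poincaré lemma near the unit;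
    the passage to the whole group is algebraic, by repeated squaring on the abelian factors R and
    R^3 and a commutation rule that glues them. The constant b disappears from the model because
    rotations of C preserve the metric, and a enters only through the factor 1 / (2a)^2 of the
    homothety. Smoothness never comes from a smooth inverse: a continuous f is smooth as soon as h o
    f is smooth for some smooth h of invertible Jacobian. This principle serves both the developing
    map and the lifts between coverings. For isometries, the curvature tensor is replaced by scalar
    identities: |dT|^2 = 1 is differentiated twice and the equation for the Laplacian once. The
    eigenvalues of Ric are -3/4 along d/dt, 1/4 along d/dxi and -1/4 on the plane of eta and zeta,
    so the excess over the least one is a positive definite form in the components of grad T other
    than that along d/dt. *)

Section Differentiability.
Variables (R : realType) (V W : normedModType R).
Implicit Types (f g : V -> W) (x : V).

(** Uniqueness of the differential: an epsilon estimate with any continuous linear L already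
    identifies it. *)
Lemma is_diff_littleo f (L : {linear V -> W}) x : continuous L ->
  (forall e, 0 < e ->
     \forall h \near 0, `|f (h + x) - f x - L h| <= e * `|h|) ->
  is_diff x f L.
Proof.
move=> Lc fL.
have H : f \o shift x = cst (f x) + L +o_ (0 : V) id.
  apply/eqaddoP => e e0; near=> h => /=.
  rewrite opprD addrA; near: h; exact: fL.
have dE : 'd f x = L :> (V -> W) by exact: diff_unique.
apply: DiffDef => //; apply/diff_locallyP; rewrite dE; split=> //.
Unshelve. all: by end_near. Qed.

Lemma diff_littleo f x : differentiable f x ->
  forall e, 0 < e ->
    \forall h \near 0, `|f (h + x) - f x - 'd f x h| <= e * `|h|.
Proof.
move=> /diff_locally /eqaddoP fo e e0.
by have := fo e e0; apply: filterS => h /=; rewrite opprD addrA.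
Qed.

Lemma near_eq_is_diff f g x :
  {near x, f =1 g} -> differentiable f x -> is_diff x g ('d f x).
Proof.
move=> fg df; apply: is_diff_littleo; first exact: diff_continuous.
move=> e e0; have := diff_littleo df e0.
rewrite -(nbhs_singleton fg).
have : \forall h \near 0, f (h + x) = g (h + x).
  by move: fg; rewrite (near_shift 0 x) subr0; apply: filterS => h /=.
by apply: filterS2 => h ->.
Qed.

Lemma near_eq_differentiable f g x :
  {near x, f =1 g} -> differentiable f x -> differentiable g x.
Proof. by move=> fg df; have [] := near_eq_is_diff fg df. Qed.

End Differentiability.

Section CkOn.
Variable R : realType.
Implicit Types (V W : normedModType R).

Lemma derive_congr V W (D : set V) (f g : V -> W) v : open D ->
  {in D, f =1 g} -> {in D, 'D_v f =1 'D_v g}.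
Proof.
move=> oD fg x; rewrite inE => Dx; apply: near_eq_derive.
near=> y; apply: fg; rewrite inE; near: y; exact: open_nbhs_nbhs.
Unshelve. all: by end_near. Qed.

Lemma Ck_on_congr V W k (D : set V) (f g : V -> W) : open D ->
  {in D, f =1 g} -> Ck_on k D f -> Ck_on k D g.
Proof.
move=> oD; elim: k f g => [|k IH] f g fg /=.
  move=> fc x Dx; have := fc _ Dx.
  rewrite /prop_for /continuous_at -fg ?inE//; apply: cvg_trans; apply: near_eq_cvg.
  near=> y; apply: fg; rewrite inE; near: y; exact: open_nbhs_nbhs.
move=> [df ck]; split=> [x Dx|v].
  apply: near_eq_differentiable (df _ Dx).
  near=> y; apply: fg; rewrite inE; near: y; exact: open_nbhs_nbhs.
by apply: IH (ck v); exact: derive_congr.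
Unshelve. all: by end_near. Qed.

Lemma Ck_on_sub V W k (D D' : set V) (f : V -> W) :
  D' `<=` D -> Ck_on k D f -> Ck_on k D' f.
Proof.
move=> DD; elim: k f => [|k IH] f /= => [fc x /DD/fc//|[df ck]].
by split=> [x /DD/df//|v]; apply: IH.
Qed.

Lemma Ck_on_local V W k (D : set V) (f : V -> W) :
  (forall x, D x -> exists2 D', D' x & Ck_on k D' f) -> Ck_on k D f.
Proof.
elim: k f => [|k IH] f /= fD; first by move=> x /fD[D' ? ]; exact.
split=> [x /fD[D' D'x [+ _]]|v]; first exact.
by apply: IH => x /fD[D' D'x [_ c]]; exists D'.
Qed.

Lemma Ck_on_continuous V W k (D : set V) (f : V -> W) : Ck_on k D f ->
  forall x, D x -> {for x, continuous f}.
Proof. by case: k => // k [df _] x /df/differentiable_continuous. Qed.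

Lemma Ck_onS V W k (D : set V) (f : V -> W) : Ck_on k.+1 D f -> Ck_on k D f.
Proof.
elim: k f => [|k IH] f; first by move=> [df _] x /df/differentiable_continuous.
by move=> [df ck]; split=> // v; exact/IH.
Qed.

Lemma smooth_on_differentiable V W (D : set V) (f : V -> W) x :
  smooth_on D f -> D x -> differentiable f x.
Proof. by move=> /(_ 1%N)[+ _]; exact. Qed.

Lemma Ck_on_cst V W k (D : set V) (w : W) : Ck_on k D (fun=> w).
Proof.
elim: k w => [|k IH] w /=; first by move=> x _; exact: cvg_cst.
split=> [x _|v]; first exact: differentiable_cst.
by rewrite (_ : 'D_v _ = fun=> 0)//; apply/funext => x; rewrite derive_cst.
Qed.

Lemma Ck_on_linear_comp V W (U : normedModType R) k (D : set V) (f : V -> W)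
    (L : {linear W -> U}) : continuous L -> open D -> Ck_on k D f ->
  Ck_on k D (fun x => L (f x)).
Proof.
move=> Lc oD; elim: k f => [|k IH] f /=.
  by move=> fc x Dx; apply: continuous_comp; [exact: fc|exact: Lc].
move=> [df ck].
have dL y : differentiable L y by exact: linear_differentiable.
split=> [x Dx|v]; first by apply: differentiable_comp => //; exact: df.
apply: Ck_on_congr (IH _ (ck v)) => // x; rewrite inE => Dx.
rewrite !deriveE; [|exact: differentiable_comp (df _ Dx) _|exact: df].
by rewrite (diff_comp (df _ Dx) (dL _)) diff_lin.
Qed.

Lemma Ck_on_comp_affine V W (U : normedModType R) k (D : set V) (f : V -> W)
    (L : {linear U -> V}) (a : V) : continuous L -> open D -> Ck_on k D f ->
  Ck_on k ((fun x => a + L x) @^-1` D) (fun x => f (a + L x)).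
Proof.
move=> Lc oD; pose g x : V := a + L x.
have gc : continuous g.
  by move=> x; apply: continuousD; [exact: cst_continuous|exact: Lc].
have og : open (g @^-1` D) by apply: open_comp.
have dg x : is_diff x g L.
  have dL : is_diff x L L by apply: DiffDef; [exact: linear_differentiable|exact: diff_lin].
  have := @is_diffD _ _ _ (cst a) L 0 L x (is_diff_cst a x) dL.
  by rewrite add0r.
elim: k f => [|k IH] f /=.
  by move=> fc x Dx; apply: continuous_comp; [exact: gc|exact: fc].
move=> [df ck]; split=> [x Dx|v].
  by apply: differentiable_comp; [have [] := dg x|exact: df].
apply: Ck_on_congr (IH _ (ck (L v))) => // x; rewrite inE => Dx.
have [dgx dgE] := dg x.
rewrite !deriveE; [|exact: (differentiable_comp dgx (df _ Dx))|exact: df].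
by rewrite (diff_comp dgx (df _ Dx))/= dgE.
Qed.

Lemma Ck_onD V W k (D : set V) (f g : V -> W) : open D ->
  Ck_on k D f -> Ck_on k D g -> Ck_on k D (fun x => f x + g x).
Proof.
move=> oD; elim: k f g => [|k IH] f g /=.
  by move=> fc gc x Dx; apply: continuousD; [exact: fc|exact: gc].
move=> [df cf] [dg cg]; split=> [x Dx|v].
  by apply: differentiableD; [exact: df|exact: dg].
apply: Ck_on_congr (IH _ _ (cf v) (cg v)) => // x; rewrite inE => Dx.
by rewrite deriveD//; apply: diff_derivable; [exact: df|exact: dg].
Qed.

Lemma Ck_on_sum V W k (D : set V) (I : Type) (r : seq I) (f : I -> V -> W) :
  open D -> (forall i, Ck_on k D (f i)) ->
  Ck_on k D (fun x => \sum_(i <- r) f i x).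
Proof.
move=> oD ck; elim: r => [|i r IH].
  by under [fun _ => _]funext do rewrite big_nil; exact: Ck_on_cst.
by under [fun _ => _]funext do rewrite big_cons; exact: Ck_onD.
Qed.

(** Scaling is a continuous bilinear map of the pair (f, g), and its differential is the product
    rule. *)
Lemma derive_scale V W (f : V -> R) (g : V -> W) x v : differentiable f x ->
  differentiable g x ->
  differentiable (fun x => f x *: g x) x /\
  'D_v (fun x => f x *: g x) x = 'D_v f x *: g x + f x *: 'D_v g x.
Proof.
move=> df dg.
have bl : bilinear_for (GRing.Scale.Law.clone _ _ ( *:%R ) _)
    (GRing.Scale.Law.clone _ _ ( *:%R ) _) (@GRing.scale R W).
  by split=> [u a z1 z2|u a z1 z2] /=; rewrite ?scalerDl ?scalerDr !scalerA// mulrC.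
pose bM := bilinear_isBilinear.Build R R W W _ _ (@GRing.scale R W) bl.
pose b : {bilinear R -> W -> W} := HB.pack (@GRing.scale R W) bM.
have bc : continuous (fun p : R * W => b p.1 p.2) by exact: scale_continuous.
have dp : is_diff x (fun y => (f y, g y)) (fun h => ('d f x h, 'd g x h)).
  have Hf := differentiableP df; have Hg := differentiableP dg.
  exact: is_diff_pair.
have db := differentiable_bilin (f x, g x) bc.
have [dp1 dp2] := dp.
have -> : (fun x => f x *: g x) = (fun p : R * W => b p.1 p.2) \o (fun y => (f y, g y)) by [].
split; first exact: (differentiable_comp dp1 db).
rewrite deriveE; last exact: (differentiable_comp dp1 db).
have -> : 'd ((fun p : R * W => b p.1 p.2) \o (fun y => (f y, g y))) x v =
    'd (fun p : R * W => b p.1 p.2) (f x, g x) ('d (fun y => (f y, g y)) x v).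
  by rewrite diff_comp.
by rewrite (diff_bilin (f x, g x) bc) dp2 /= !deriveE// addrC.
Qed.

Lemma Ck_onZ V W k (D : set V) (f : V -> R) (g : V -> W) : open D ->
  Ck_on k D f -> Ck_on k D g -> Ck_on k D (fun x => f x *: g x).
Proof.
move=> oD; elim: k f g => [|k IH] f g.
  by move=> fc gc x Dx; apply: continuousZ; [exact: fc|exact: gc].
move=> Cf Cg; have [df cf] := Cf; have [dg cg] := Cg.
split=> [x Dx|v].
  by have [] := derive_scale 0 (df _ Dx) (dg _ Dx).
have h := Ck_onD oD (IH _ _ (cf v) (Ck_onS Cg)) (IH _ _ (Ck_onS Cf) (cg v)).
apply: Ck_on_congr h => // x; rewrite inE => Dx.
by have [_ ->] := derive_scale v (df _ Dx) (dg _ Dx).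
Qed.

Lemma Ck_onM V k (D : set V) (f g : V -> R) : open D ->
  Ck_on k D f -> Ck_on k D g -> Ck_on k D (fun x => f x * g x).
Proof. exact: (@Ck_onZ V R^o). Qed.

Lemma Ck_onN V W k (D : set V) (f : V -> W) : open D ->
  Ck_on k D f -> Ck_on k D (fun x => - f x).
Proof.
move=> oD cf; have := Ck_onZ oD (Ck_on_cst k D (-1 : R)) cf.
by under [fun _ => _]funext do rewrite scaleN1r.
Qed.

Lemma Ck_onB V W k (D : set V) (f g : V -> W) : open D ->
  Ck_on k D f -> Ck_on k D g -> Ck_on k D (fun x => f x - g x).
Proof. by move=> oD cf cg; apply: Ck_onD => //; exact: Ck_onN. Qed.

Lemma Ck_on_prod V k (D : set V) (I : Type) (r : seq I) (f : I -> V -> R) :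
  open D -> (forall i, Ck_on k D (f i)) ->
  Ck_on k D (fun x => \prod_(i <- r) f i x).
Proof.
move=> oD ck; elim: r => [|i r IH].
  by under [fun _ => _]funext do rewrite big_nil; exact: Ck_on_cst.
by under [fun _ => _]funext do rewrite big_cons; exact: Ck_onM.
Qed.

(** Induction step for a real function h with derivative dh: the derivative of h o f along v is dh o
    f times that of f, so one more degree for h o f costs only the smoothness of dh o f. For the
    exponential, sine, cosine and inverse, dh o f is again built from such functions. *)
Lemma Ck_on_comp1 V k (D : set V) (f : V -> R) (h dh : R -> R) (X : set R) :
  open D -> (forall x, D x -> X (f x)) ->
  (forall r, X r -> is_derive r 1 h (dh r)) ->
  (Ck_on k D f -> Ck_on k D (fun x => dh (f x))) ->
  Ck_on k.+1 D f -> Ck_on k.+1 D (fun x => h (f x)).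
Proof.
move=> oD fX hd cdh Cf; have [df cf] := Cf.
have dhr r : X r -> differentiable h r.
  by move=> /hd[+ _] => /derivable1_diffP.
split=> [x Dx|v].
  by apply: (@differentiable_comp _ _ _ _ f h); [exact: df|exact/dhr/fX].
apply: Ck_on_congr (Ck_onM oD (cdh (Ck_onS Cf)) (cf v)) => // x; rewrite inE => Dx.
have Dhr := dhr _ (fX _ Dx).
rewrite [RHS]deriveE; last exact: (differentiable_comp (df _ Dx) Dhr).
rewrite diff_comp//; last exact: df.
rewrite diff1E//= -deriveE; last exact: df.
by rewrite derive1E; have [_ ->] := hd _ (fX _ Dx); rewrite mulrC.
Qed.

Lemma Ck_on_exp V k (D : set V) (f : V -> R) : open D ->
  Ck_on k D f -> Ck_on k D (fun x => expR (f x)).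
Proof.
move=> oD; elim: k => [|k IH].
  by move=> fc x Dx; apply: continuous_comp; [exact: fc|exact: continuous_expR].
apply: (@Ck_on_comp1 _ _ _ _ _ expR setT) => // r _.
Qed.

(** Each of the two functions is, up to sign, the derivative of the other, so they climb the
    induction together. *)
Lemma Ck_on_cos_sin V k (D : set V) (f : V -> R) : open D -> Ck_on k D f ->
  Ck_on k D (fun x => cos (f x)) /\ Ck_on k D (fun x => sin (f x)).
Proof.
move=> oD; elim: k => [|k IH] fc.
  by split=> x Dx; apply: continuous_comp; [exact: fc|exact: continuous_cos|
    exact: fc|exact: continuous_sin].
have [cc cs] := IH (Ck_onS fc).
split.
  apply: (@Ck_on_comp1 _ _ _ _ _ (fun x => - sin x) setT) => // _.
  exact: Ck_onN.
by apply: (@Ck_on_comp1 _ _ _ _ _ cos setT).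
Qed.

Lemma Ck_onV V k (D : set V) (f : V -> R) : open D ->
  (forall x, D x -> f x != 0) ->
  Ck_on k D f -> Ck_on k D (fun x => (f x)^-1).
Proof.
move=> oD f0; elim: k => [|k IH].
  by move=> fc x Dx; apply: continuousV; [exact: f0|exact: fc].
apply: (@Ck_on_comp1 _ _ _ _ _ (fun r => - (r ^- 2)) [set r | r != 0]) => //.
  move=> r /= r0; apply: DeriveDef; first exact: derivableV.
  by rewrite deriveV// derive_id [LHS]mulr1.
move=> /IH c; have := Ck_onN oD (Ck_onM oD c c).
by under [fun _ => - _]funext do rewrite -expr2 exprVn.
Qed.

Lemma differentiable_mx V m n (f : V -> 'M[R]_(m, n)) x :
  (forall i j, differentiable (fun y => f y i j) x) -> differentiable f x.
Proof.
move=> df.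
have -> : f = \sum_i \sum_j (fun y => f y i j *: delta_mx i j).
  apply/funext => y; rewrite {1}[f y]matrix_sum_delta fct_sumE.
  by apply: eq_bigr => i _; rewrite fct_sumE.
by do 2 (apply: differentiable_sum => ?); exact: differentiableZl.
Qed.

Lemma differentiable_entry V m n (f : V -> 'M[R]_(m, n)) x i j :
  differentiable f x -> differentiable (fun y => f y i j) x.
Proof.
by move=> df; exact: (differentiable_comp df (differentiable_coord _ _ _)).
Qed.

Lemma derive_entry V m n (f : V -> 'M[R]_(m, n)) x v i j :
  differentiable f x -> ('D_v f x) i j = 'D_v (fun y => f y i j) x.
Proof. by move=> df; rewrite derive_mx ?mxE//; exact: diff_derivable. Qed.

Lemma Ck_on_entry V m n k (D : set V) (f : V -> 'M[R]_(m, n)) i j : open D ->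
  Ck_on k D f -> Ck_on k D (fun x => f x i j).
Proof.
move=> oD cf.
pose g (A : 'M[R]_(m, n)) := A i j.
have glin : linear g by move=> a u v; rewrite /g !mxE.
pose gM := GRing.isLinear.Build _ _ _ _ _ glin.
pose gL : {linear 'M[R]_(m, n) -> R} := HB.pack g gM.
by apply: (@Ck_on_linear_comp _ _ _ _ _ _ gL) => //; exact: coord_continuous.
Qed.

Lemma Ck_on_mx V m n k (D : set V) (f : V -> 'M[R]_(m, n)) : open D ->
  (forall i j, Ck_on k D (fun x => f x i j)) -> Ck_on k D f.
Proof.
move=> oD cf.
rewrite (_ : f = fun x => \sum_i \sum_j f x i j *: delta_mx i j); last first.
  by apply/funext => x; exact: matrix_sum_delta.
do 2 (apply: Ck_on_sum => // ?); apply: Ck_onZ => //; exact: Ck_on_cst.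
Qed.

Lemma Ck_on_coord k (D : set 'rV[R]_k) n i j : open D ->
  Ck_on n D (fun x => x i j).
Proof. by move=> oD; apply: Ck_on_entry => //; exact: Ck_on_id. Qed.

Lemma Ck_on_mulmx V m n p k (D : set V) (f : V -> 'M[R]_(m, n))
    (g : V -> 'M[R]_(n, p)) : open D ->
  Ck_on k D f -> Ck_on k D g -> Ck_on k D (fun x => f x *m g x).
Proof.
move=> oD cf cg; apply: Ck_on_mx => // i j.
under [fun _ => _]funext do rewrite mxE.
by apply: Ck_on_sum => // l; apply: Ck_onM => //; exact: Ck_on_entry.
Qed.

Lemma Ck_on_det V n k (D : set V) (f : V -> 'M[R]_n) : open D ->
  Ck_on k D f -> Ck_on k D (fun x => \det (f x)).
Proof.
move=> oD cf; rewrite /determinant; apply: Ck_on_sum => // s.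
apply: Ck_onM => //; first exact: Ck_on_cst.
by apply: Ck_on_prod => // i; exact: Ck_on_entry.
Qed.

(** By Cramer's rule the inverse is the adjugate over the determinant, hence rational in the
    entries. *)
Lemma Ck_on_invmx V n k (D : set V) (f : V -> 'M[R]_n) : open D ->
  (forall x, D x -> f x \in unitmx) ->
  Ck_on k D f -> Ck_on k D (fun x => invmx (f x)).
Proof.
move=> oD fu cf.
apply: (@Ck_on_congr _ _ _ _ (fun x => (\det (f x))^-1 *: \adj (f x))) => //.
  by move=> x; rewrite inE => /fu fxu; rewrite /invmx fxu.
apply: Ck_onZ => //.
  apply: Ck_onV => //; last exact: Ck_on_det.
  by move=> x /fu; rewrite unitmxE unitfE.
apply: Ck_on_mx => // i j.
under [fun _ => _]funext do rewrite mxE /cofactor.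
apply: Ck_onM => //; first exact: Ck_on_cst.
apply: Ck_on_det => //; apply: Ck_on_mx => // a b.
under [fun _ => _]funext do rewrite !mxE.
exact: Ck_on_entry.
Qed.

Lemma derive_comp V n W (f : 'rV[R]_n -> W) (g : V -> 'rV[R]_n) x v :
  differentiable g x -> differentiable f (g x) ->
  'D_v (f \o g) x = 'D_('D_v g x) f (g x).
Proof.
move=> dg df; rewrite !deriveE//; last exact: differentiable_comp.
by rewrite diff_comp.
Qed.

Lemma derive_row_sum n W (f : 'rV[R]_n -> W) x (v : 'rV[R]_n) :
  differentiable f x -> 'D_v f x = \sum_i v 0 i *: 'D_('e_i) f x.
Proof.
move=> df; rewrite deriveE// {1}[v]row_sum_delta linear_sum.
by apply: eq_bigr => i _; rewrite linearZ deriveE.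
Qed.

(** The chain rule expands the derivative of the composite in the partial derivatives of f, to which
    the induction applies; this is why the middle space consists of row vectors. *)
Lemma Ck_on_comp V n W k (D : set V) (D' : set 'rV[R]_n) (f : 'rV[R]_n -> W)
    (g : V -> 'rV[R]_n) : open D -> open D' -> (forall x, D x -> D' (g x)) ->
  Ck_on k D' f -> Ck_on k D g -> Ck_on k D (f \o g).
Proof.
move=> oD oD' gD; elim: k f g gD => [|k IH] f g gD.
  by move=> fc gc x Dx; apply: continuous_comp; [exact: gc|exact/fc/gD].
move=> [df cf] Cg; have [dg cg] := Cg.
split=> [x Dx|v]; first by apply: differentiable_comp; [exact: dg|exact/df/gD].
apply: (@Ck_on_congr _ _ _ _
  (fun x => \sum_i ('D_v g x) 0 i *: ('D_('e_i) f \o g) x)) => //.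
  move=> x; rewrite inE => Dx; rewrite derive_comp; [|exact: dg|exact/df/gD].
  by rewrite derive_row_sum//; exact/df/gD.
apply: Ck_on_sum => // i; apply: Ck_onZ => //; first exact: (Ck_on_entry 0 i oD (cg v)).
exact: (IH _ _ gD (cf _) (Ck_onS Cg)).
Qed.

End CkOn.

(** * Jacobians of maps between spaces of row vectors *)

Section FiniteDimension.
Variable R : realType.

Lemma normr_entry m n (A : 'M[R]_(m, n)) i j : `|A i j| <= `|A|.
Proof.
rewrite [leRHS]/Num.Def.normr/= mx_normrE.
exact: (le_bigmax _ _ (i, j)).
Qed.

Lemma normr_mx_le m n (A : 'M[R]_(m, n)) (e : R) : 0 <= e ->
  (forall i j, `|A i j| <= e) -> `|A| <= e.
Proof.
move=> e0 Ae; rewrite [leLHS]/Num.Def.normr/= mx_normrE.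
by apply/bigmax_leP; split=> // -[i j] _; exact: Ae.
Qed.

Lemma linear_rV_continuous n (W : normedModType R) (L : {linear 'rV[R]_n -> W}) :
  continuous L.
Proof.
move=> x; rewrite (_ : L = (fun v => \sum_i v 0 i *: L 'e_i) :> (_ -> _)).
  have : differentiable (\sum_i (fun v : 'rV[R]_n => v 0 i *: L 'e_i)) x.
    by apply: differentiable_sum => i; apply: differentiableZl;
      exact: differentiable_coord.
  by rewrite fct_sumE => /differentiable_continuous.
apply/funext => v; rewrite {1}[v]row_sum_delta linear_sum.
by apply: eq_bigr => i _; rewrite linearZ.
Qed.

Lemma jacobian_entry m n (f : 'rV[R]_m -> 'rV[R]_n) x i j :
  differentiable f x -> jacobian f x i j = 'D_('e_i) (fun y => f y 0 j) x.
Proof.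
move=> df; rewrite -derive_entry// deriveEjacobian//.
by rewrite -rowE [RHS]mxE.
Qed.

Lemma Ck_on_jacobian m n k (D : set 'rV[R]_m) (f : 'rV[R]_m -> 'rV[R]_n) :
  open D -> Ck_on k.+1 D f -> Ck_on k D (jacobian f).
Proof.
move=> oD [df cf]; apply: Ck_on_mx => // i j.
apply: Ck_on_congr (Ck_on_entry 0 j oD (cf 'e_i)) => // x; rewrite inE => Dx.
by rewrite derive_entry ?jacobian_entry//; exact: df.
Qed.

Lemma jacobian_comp m n p (f : 'rV[R]_m -> 'rV[R]_n) (g : 'rV[R]_n -> 'rV[R]_p)
    x : differentiable f x -> differentiable g (f x) ->
  jacobian (g \o f) x = jacobian f x *m jacobian g (f x).
Proof.
move=> df dg; apply/row_matrixP => i; rewrite !rowE mulmxA.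
have e : 'D_('e_i) (g \o f) x = 'D_('D_('e_i) f x) g (f x) by exact: derive_comp.
rewrite -(deriveEjacobian _ (differentiable_comp df dg)) e.
by rewrite -(deriveEjacobian _ df) -(deriveEjacobian _ dg).
Qed.

Lemma near_eq_jacobian m n (f g : 'rV[R]_m -> 'rV[R]_n) x :
  {near x, f =1 g} -> differentiable f x -> jacobian f x = jacobian g x.
Proof.
move=> fg df; have dg := near_eq_differentiable fg df; apply/matrixP => i j.
apply: (etrans (jacobian_entry i j df)); apply/esym.
apply: (etrans (jacobian_entry i j dg)); apply/esym/near_eq_derive.
by apply: filterS fg => y ->.
Qed.

End FiniteDimension.

(** * Mean values and the symmetry of second derivatives *)

Section MeanValue.
Variables (R : realType) (V : normedModType R).
Implicit Types (f : V -> R).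

Lemma is_derive_line (W : normedModType R) (f : V -> W) (x v : V) (s : R) :
  derivable f (x + s *: v) v ->
  is_derive s 1 (fun r => f (x + r *: v)) ('D_v f (x + s *: v)).
Proof.
move=> df; have E : (fun h : R => h^-1 *: (f (x + (h *: (1 : R) + s) *: v) - f (x + s *: v)))
    = (fun h => h^-1 *: (f (h *: v + (x + s *: v)) - f (x + s *: v))).
  apply/funext => h; congr (_ *: (f _ - _)).
  by rewrite [h *: _]mulr1 scalerDl addrCA.
by apply: DeriveDef; rewrite /derivable /derive /= E.
Qed.

Lemma MVT_line f (x v : V) :
  (forall s : R, 0 <= s <= 1 -> derivable f (x + s *: v) v) ->
  exists2 s : R, 0 < s < 1 & f (x + v) - f x = 'D_v f (x + s *: v).
Proof.
move=> df.
have dF (s : R) : 0 <= s <= 1 ->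
    is_derive s 1 (fun r => f (x + r *: v)) ('D_v f (x + s *: v)).
  by move=> s01; apply/is_derive_line/df.
have [||s s01 E] := @MVT R (fun r => f (x + r *: v))
    (fun s => 'D_v f (x + s *: v)) 0 1 ltr01.
- move=> s; rewrite in_itv/= => /andP[s0 s1]; apply: dF.
  by rewrite !ltW.
- apply: derivable_within_continuous => s; rewrite in_itv/= => s01.
  by have [] := dF _ s01.
exists s; first by rewrite in_itv/= in s01.
by move: E; rewrite scale1r scale0r addr0 subr0 mulr1.
Qed.

Lemma segment_ball (x y z : V) (e : R) (s : R) : ball z e x -> ball z e y ->
  0 <= s <= 1 -> ball z e (x + s *: (y - x)).
Proof.
rewrite -ball_normE /= => zx zy /andP[s0 s1].
have -> : z - (x + s *: (y - x)) = (1 - s) *: (z - x) + s *: (z - y).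
  have -> : y - x = (z - x) - (z - y) by rewrite opprB [RHS]addrC addrA subrK.
  rewrite scalerBr scalerBl scale1r opprD opprB addrA -[RHS]addrA.
  by congr (_ + _); rewrite addrC.
have [->|sn0] := eqVneq s 0.
  by rewrite subr0 scale1r scale0r addr0.
apply: le_lt_trans (ler_normD _ _) _; rewrite !normrZ.
rewrite (ger0_norm s0) ger0_norm ?subr_ge0//.
have sp : 0 < s by rewrite lt_neqAle eq_sym sn0.
have -> : e = (1 - s) * e + s * e by rewrite -mulrDl subrK mul1r.
apply: ler_ltD; last by rewrite ltr_pM2l.
by rewrite ler_wpM2l ?subr_ge0// ltW.
Qed.

Lemma derive_eq0_ball_cst f (z : V) (e : R) :
  (forall x, ball z e x -> forall v, is_derive x v f 0) ->
  forall x y, ball z e x -> ball z e y -> f x = f y.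
Proof.
move=> df x y zx zy.
have [s s01|s s01] := @MVT_line f x (y - x).
  by have [] := df _ (segment_ball zx zy s01) (y - x).
have {}s01 : 0 <= s <= 1 by case/andP: s01 => ? ?; rewrite !ltW.
have [_ ->] := df _ (segment_ball zx zy s01) (y - x).
by rewrite addrCA subrr addr0 => /eqP; rewrite subr_eq0 => /eqP.
Qed.

(** The second difference over the parallelogram spanned by v and w is a first difference along v of
    x |-> f (x + w) - f x; one mean value in the direction v and one in the direction w turn it into
    a mixed derivative. *)
Lemma schwarz_mean f (z : V) (e : R) (v w : V) : Ck_on 2 (ball z e) f -> 0 < e ->
  `|v| + `|w| < e ->
  exists s t : R, [/\ 0 < s < 1, 0 < t < 1 &
    f (z + v + w) - f (z + v) - f (z + w) + f z =
    'D_w ('D_v f) (z + s *: v + t *: w)].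
Proof.
move=> [df cf] e0 vwe.
have inb (s t : R) : 0 <= s <= 1 -> 0 <= t <= 1 -> ball z e (z + s *: v + t *: w).
  move=> /andP[s0 s1] /andP[t0 t1]; rewrite -ball_normE /=.
  rewrite -addrA opprD addrA subrr add0r normrN.
  apply: le_lt_trans (ler_normD _ _) _; rewrite !normrZ !ger0_norm//.
  apply: le_lt_trans vwe; apply: lerD; exact: ler_piMl.
have i01 : 0 <= (1 : R) <= 1 by rewrite ler01 lexx.
have i00 : 0 <= (0 : R) <= 1 by rewrite ler01 lexx.
pose F x := f (x + w) - f x.
have dsh x : differentiable f (x + w) -> is_derive x v (fun x => f (x + w)) ('D_v f (x + w)).
  move=> dfx; have := @diff_derivable _ _ _ _ _ v dfx; rewrite /derivable => c.
  have E : (fun h : R => h^-1 *: (f (h *: v + x + w) - f (x + w))) =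
    (fun h => h^-1 *: (f (h *: v + (x + w)) - f (x + w))).
    by apply/funext => h; rewrite addrA.
  by apply: DeriveDef; rewrite /derivable /derive /= E.
have dF (s : R) : 0 <= s <= 1 -> is_derive (z + s *: v) v F
    ('D_v f (z + s *: v + w) - 'D_v f (z + s *: v)).
  move=> s01; apply: is_deriveB.
    by apply: dsh; apply: df; have := inb s 1 s01 i01; rewrite scale1r.
  apply/derivableP/diff_derivable/df.
  by have := inb s 0 s01 i00; rewrite scale0r addr0.
have [s /dF[] //|s s01 Es] := @MVT_line F z v.
have s01' : 0 <= s <= 1 by case/andP: s01 => ? ?; rewrite !ltW.
have [t t01|t t01 Et] := @MVT_line ('D_v f) (z + s *: v) w.
  by apply: diff_derivable; have [+ _] := cf v; apply; exact: inb.
exists s, t; split=> //; rewrite -Et.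
have [_ <-] := dF _ s01'; rewrite -Es /F; ring.
Qed.

(** The second difference is symmetric in v and w, so its two evaluations give the mixed derivatives
    of either order a common value, at points arbitrarily close to x; continuity of both does the
    rest. *)
Lemma schwarz f (D : set V) (x v w : V) : open D -> D x -> Ck_on 2 D f ->
  'D_v ('D_w f) x = 'D_w ('D_v f) x.
Proof.
move=> oD Dx cf.
have Dxn : nbhs x D by exact: open_nbhs_nbhs.
have /nbhs_ballP[e /= e0 eD] := Dxn.
have cb : Ck_on 2 (ball x e) f := Ck_on_sub eD cf.
have [dfb cfb] := cb.
have c1 : {for x, continuous ('D_v ('D_w f))}.
  exact: (cf.2 w).2 v x Dx.
have c2 : {for x, continuous ('D_w ('D_v f))}.
  exact: (cf.2 v).2 w x Dx.
suff : forall r : R, 0 < r -> exists p q, [/\ ball x r p, ball x r q &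
    'D_v ('D_w f) p = 'D_w ('D_v f) q].
  move=> H; apply/eqP/negPn/negP => ne.
  have d0 : 0 < `|'D_v ('D_w f) x - 'D_w ('D_v f) x| / 2.
    by rewrite divr_gt0// normr_gt0 subr_eq0.
  have /cvgrPdist_lt/(_ _ d0)/nbhs_ballP[r1 /= r10 h1] := c1.
  have /cvgrPdist_lt/(_ _ d0)/nbhs_ballP[r2 /= r20 h2] := c2.
  have [|p [q [p1 q1 E]]] := H (Num.min r1 r2).
    by rewrite lt_min r10.
  have /h1 k1 : ball x r1 p by apply: le_ball p1; rewrite ge_min lexx.
  have /h2 k2 : ball x r2 q by apply: le_ball q1; rewrite ge_min lexx orbT.
  rewrite E in k1; have := ltrD k1 k2; rewrite -splitr.
  move: ('D_v ('D_w f) x) ('D_w ('D_v f) x) ('D_w ('D_v f) q) => A B C.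
  by rewrite (distrC B C) ltNge ler_distD.
move=> r r0.
pose m := Num.min r e.
have m0 : 0 < m by rewrite lt_min r0.
(* Scaling both vectors by h puts the whole parallelogram inside the ball of radius m; the factor
   h^2 that both mixed derivatives acquire cancels at the end. *)
pose h := m / (1 + `|v| + `|w|).
have d0 : 0 < 1 + `|v| + `|w| by rewrite -addrA ltr_pwDl// addr_ge0.
have h0 : 0 < h by rewrite divr_gt0.
have hm : `|h *: v| + `|h *: w| < m.
  rewrite !normrZ gtr0_norm// -mulrDr /h -mulrA gtr_pMr// mulrC.
  by rewrite gtr0_norm ?invr_gt0// ltr_pdivrMr// mul1r -addrA ltrDr ltr01.
have hm' : `|h *: w| + `|h *: v| < m by rewrite addrC.
have inm (s t : R) v' w' : 0 < s < 1 -> 0 < t < 1 -> `|h *: v'| + `|h *: w'| < m ->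
    ball x m (x + s *: (h *: v') + t *: (h *: w')).
  move=> /andP[s0 s1] /andP[t0 t1] Hm; rewrite -ball_normE /=.
  rewrite -addrA opprD addrA subrr add0r normrN.
  apply: le_lt_trans (ler_normD _ _) _.
  rewrite [X in X + _]normrZ [X in _ + X]normrZ.
  rewrite (gtr0_norm s0) (gtr0_norm t0).
  by apply: le_lt_trans Hm; apply: lerD; apply: ler_piMl => //; exact: ltW.
have mr p : ball x m p -> ball x r p.
  by apply: le_ball; rewrite ge_min lexx.
have me p : ball x m p -> ball x e p.
  by apply: le_ball; rewrite ge_min lexx orbT.
have DZ v' w' p : ball x m p -> 'D_(h *: w') ('D_(h *: v') f) p = h ^+ 2 * 'D_w' ('D_v' f) p.
  move=> pm.
  have E : {in (ball x e : set V), 'D_(h *: v') f =1 (h *: 'D_v' f)}.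
    move=> y; rewrite inE => ye; rewrite deriveE; last exact: dfb.
    by rewrite linearZ/= -deriveE//; exact: dfb.
  have dvf : differentiable ('D_v' f) p by have [+ _] := cfb v'; apply; exact: me.
  rewrite (derive_congr _ (ball_open x e) E) ?inE//; last exact: me.
  rewrite deriveZ; last exact: diff_derivable.
  have -> : 'D_(h *: w') ('D_v' f) p = h *: 'D_w' ('D_v' f) p.
    by rewrite (deriveE _ dvf) linearZ/= -deriveE.
  by rewrite expr2 -mulrA.
have [|s [t [s01 t01 E1]]] := @schwarz_mean f x e (h *: v) (h *: w) cb e0.
  by apply: lt_le_trans hm _; rewrite ge_min lexx orbT.
have [|s' [t' [s01' t01' E2]]] := @schwarz_mean f x e (h *: w) (h *: v) cb e0.
  by apply: lt_le_trans hm' _; rewrite ge_min lexx orbT.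
exists (x + s' *: (h *: w) + t' *: (h *: v)), (x + s *: (h *: v) + t *: (h *: w)).
split; [exact/mr/inm|exact/mr/inm|].
apply: (@mulfI _ (h ^+ 2)); first by rewrite expf_neq0// gt_eqF.
apply: (etrans (esym (DZ w v _ (inm _ _ _ _ s01' t01' hm')))); apply: (etrans (esym E2)).
apply: (etrans _ (DZ v w _ (inm _ _ _ _ s01 t01 hm))); apply: (etrans _ E1).
by rewrite (addrAC x); ring.
Qed.

End MeanValue.

(** * Inverse functions and closed forms *)

(** Lets the contraction principle be applied to row vectors. *)
HB.instance Definition _ (R : realType) (m n : nat) :=
  Uniform_isComplete.Build 'M[R]_(m, n) (@cauchy_cvg _).

Lemma near_forall_fin (T : topologicalType) (I : finType) (P : I -> T -> Prop)
    (x : T) : (forall i, \forall y \near x, P i y) ->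
  \forall y \near x, forall i, P i y.
Proof. by move=> Px; exact: (@filter_forall _ I P (nbhs x) _ Px). Qed.

Section InverseFunction.
Variable R : realType.

Lemma mulmxr_lipschitz n m (A : 'M[R]_(n, m)) :
  exists2 C : R, 0 < C & forall v : 'rV[R]_n, `|v *m A| <= C * `|v|.
Proof.
pose L : {linear 'rV[R]_n -> 'rV[R]_m} := mulmxr A.
by have [C C0 LC] := linear_lipschitz (@linear_rV_continuous _ _ _ L); exists C.
Qed.

(** With k the increment of f and A the Jacobian of h at f x, the increment of h o f is k *m A up to
    an error small against k, since f is continuous. Inverting A expresses k by the increment of h o
    f, and the error is harmless once k is known to be of the order of the increment of the
    argument. *)
Lemma smooth_lift_derive (V : normedModType R) n (f : V -> 'rV[R]_n)
    (h : 'rV[R]_n -> 'rV[R]_n) x :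
  {for x, continuous f} -> differentiable h (f x) ->
  jacobian h (f x) \in unitmx -> differentiable (h \o f) x ->
  is_diff x f (fun v => 'd (h \o f) x v *m invmx (jacobian h (f x))).
Proof.
move=> fc dh Ju dg.
set A := jacobian h (f x) in Ju *; set Ai := invmx A.
pose L : {linear V -> 'rV[R]_n} := mulmxr Ai \o 'd (h \o f) x.
have [C C0 AiC] := mulmxr_lipschitz Ai.
have [K K0 dgK] := linear_lipschitz (diff_continuous dg).
have Lc : continuous L.
  move=> v; apply: continuous_comp; first exact: diff_continuous.
  exact: linear_rV_continuous.
apply: (is_diff_littleo Lc) => e e0.
have K10 : 0 < K + 1 by rewrite addr_gt0.
(* The bound C * e2 <= 1/2 absorbs the error term into k. The other bound on e2 makes that term at
   most e / 2 times the argument, after k is replaced by its bound 2 C (K + 1) times the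
   argument. *)
pose e1 := e / (2 * C); pose e2 := Num.min (2 * C)^-1 (e / (4 * C ^+ 2 * (K + 1))).
have e10 : 0 < e1 by rewrite divr_gt0// mulr_gt0.
have d20 : 0 < 4 * C ^+ 2 * (K + 1) by rewrite !mulr_gt0// exprn_gt0.
have e20 : 0 < e2 by rewrite lt_min invr_gt0 mulr_gt0//= divr_gt0.
have Ce2 : C * e2 <= 2^-1.
  apply: (@le_trans _ _ (C * (2 * C)^-1)).
    by apply: ler_wpM2l; [exact: ltW|rewrite ge_min lexx].
  by rewrite invfM mulrCA divff ?mulr1// gt_eqF.
have Ce2' : C * e2 * (2 * C * (K + 1)) <= e / 2.
  apply: (@le_trans _ _ (C * (e / (4 * C ^+ 2 * (K + 1))) * (2 * C * (K + 1)))).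
    apply: ler_wpM2r; first by rewrite !mulr_ge0// ltW.
    by apply: ler_wpM2l; [exact: ltW|rewrite ge_min lexx orbT].
  rewrite le_eqVlt; apply/orP; left; apply/eqP.
  by field; rewrite ?gt_eqF.
have kc : (fun xi => f (xi + x) - f x) @ (0 : V) --> (0 : 'rV[R]_n).
  rewrite -[X in _ --> X](subrr (f x)); apply: cvgB; last exact: cvg_cst.
  apply: (@cvg_comp _ _ _ (fun xi => xi + x) f _ (nbhs x)) => //.
  have : (fun xi => xi + x) @ (0 : V) --> 0 + x.
    by apply: cvgD; [exact: cvg_id|exact: cvg_cst].
  by rewrite add0r.
have hk : \forall xi \near (0 : V),
    `|h (f (xi + x) - f x + f x) - h (f x) - (f (xi + x) - f x) *m A|
    <= e2 * `|f (xi + x) - f x|.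
  apply: (kc [set k | `|h (k + f x) - h (f x) - k *m A| <= e2 * `|k|]).
  apply: filterS (diff_littleo dh e20) => k /=.
  by rewrite -!deriveE// deriveEjacobian.
have H1 := diff_littleo dg e10; have H2 := diff_littleo dg ltr01.
near=> xi => /=.
set k := f (xi + x) - f x.
have hk' : `|h (f (xi + x)) - h (f x) - k *m A| <= e2 * `|k|.
  have : `|h (f (xi + x) - f x + f x) - h (f x) - (f (xi + x) - f x) *m A|
    <= e2 * `|f (xi + x) - f x| by near: xi; exact: hk.
  by rewrite subrK.
set r := h (f (xi + x)) - h (f x) - k *m A in hk'.
pose Dg := h (f (xi + x)) - h (f x).
have kE : k = Dg *m Ai - r *m Ai.
  by rewrite -mulmxBl /r opprB addrCA subrr addr0 /Ai mulmxK.
have h1 : `|Dg - 'd (h \o f) x xi| <= e1 * `|xi|.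
  have : `|(h \o f) (xi + x) - (h \o f) x - 'd (h \o f) x xi| <= e1 * `|xi|.
    by near: xi; exact: H1.
  exact.
have h2 : `|Dg - 'd (h \o f) x xi| <= 1 * `|xi|.
  have : `|(h \o f) (xi + x) - (h \o f) x - 'd (h \o f) x xi| <= 1 * `|xi|.
    by near: xi; exact: H2.
  exact.
have Dgb : `|Dg| <= (K + 1) * `|xi|.
  rewrite -[Dg](subrK ('d (h \o f) x xi)) mulrDl addrC.
  by apply: le_trans (ler_normD _ _) _; apply: lerD.
have kb : `|k| <= 2 * C * (K + 1) * `|xi|.
  have : `|k| <= C * ((K + 1) * `|xi|) + 2^-1 * `|k|.
    rewrite {1}kE; apply: le_trans (ler_normB _ _) _; apply: lerD.
      by apply: le_trans (AiC _) _; rewrite ler_pM2l.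
    apply: le_trans (AiC _) _; apply: (@le_trans _ _ (C * (e2 * `|k|))).
      by rewrite ler_pM2l.
    by rewrite mulrA ler_wpM2r.
  have -> : 2 * C * (K + 1) * `|xi| = 2 * (C * ((K + 1) * `|xi|)) by ring.
  move: (C * _) `|k| => z t; lra.
have -> : k - 'd (h \o f) x xi *m Ai = (Dg - 'd (h \o f) x xi) *m Ai - r *m Ai.
  by rewrite (mulmxBl Dg) [RHS]addrAC -kE.
apply: le_trans (ler_normB _ _) _.
have -> : e * `|xi| = C * (e1 * `|xi|) + e / 2 * `|xi|.
  by rewrite /e1; field; rewrite ?gt_eqF.
apply: lerD; first by apply: le_trans (AiC _) _; rewrite ler_pM2l.
apply: le_trans (AiC _) _; apply: (@le_trans _ _ (C * (e2 * `|k|))).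
  by rewrite ler_pM2l.
apply: (@le_trans _ _ (C * e2 * (2 * C * (K + 1)) * `|xi|)).
  have -> : C * (e2 * `|k|) = C * e2 * `|k| by rewrite mulrA.
  rewrite -(mulrA (C * e2)); apply: ler_wpM2l => //.
  by rewrite mulr_ge0// ltW.
by rewrite ler_wpM2r.
Unshelve. all: by end_near. Qed.

(** The derivative of f is that of h o f times the inverse of the Jacobian of h along f. If f is of
    class C^k, this product is too, and f gains one degree. *)
Lemma smooth_lift (V : normedModType R) n (D : set V) (D' : set 'rV[R]_n)
    (f : V -> 'rV[R]_n) (h : 'rV[R]_n -> 'rV[R]_n) :
  open D -> open D' -> (forall x, D x -> D' (f x)) ->
  (forall x, D x -> {for x, continuous f}) ->
  (forall y, D' y -> jacobian h y \in unitmx) ->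
  smooth_on D' h -> smooth_on D (h \o f) -> smooth_on D f.
Proof.
move=> oD oD' fD fc Ju sh sg.
have df x : D x -> is_diff x f (fun v => 'd (h \o f) x v *m invmx (jacobian h (f x))).
  move=> Dx; apply: smooth_lift_derive; [exact: fc|..].
  - by apply: smooth_on_differentiable sh _; exact: fD.
  - exact/Ju/fD.
  - exact: smooth_on_differentiable sg _.
elim => [|k IH]; first exact: fc.
split=> [x /df[]//|v].
apply: (@Ck_on_congr _ _ _ _ _
   (fun x => 'D_v (h \o f) x *m (invmx \o jacobian h \o f) x)) => //.
  move=> x; rewrite inE => Dx; have [d1 d2] := df _ Dx.
  rewrite [RHS]deriveE// d2 deriveE//.
  exact: smooth_on_differentiable sg _.
apply: Ck_on_mulmx => //; first by have [_] := sg k.+1; exact.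
apply: (Ck_on_comp oD oD' fD) => //.
by apply: (Ck_on_invmx oD') => //; exact: Ck_on_jacobian.
Qed.

(** Mean values are applied to the components of f minus its linear part at x0, whose derivative is
    small near x0 by continuity of the Jacobian; hence the estimate is uniform in both points. *)
Lemma C1_strict n m (D : set 'rV[R]_n) (f : 'rV[R]_n -> 'rV[R]_m) x0 (e : R) :
  open D -> D x0 -> Ck_on 1 D f -> 0 < e ->
  exists r : R, [/\ 0 < r, ball x0 r `<=` D & forall x y, ball x0 r x -> ball x0 r y ->
    `|f y - f x - (y - x) *m jacobian f x0| <= e * `|y - x|].
Proof.
move=> oD Dx0 c1 e0.
have [r1 /= r10 r1D] : exists2 r : R, 0 < r & ball x0 r `<=` D.
  by have /nbhs_ballP[r /= r0 ?] := open_nbhs_nbhs (conj oD Dx0); exists r.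
(* The norm is the largest entry, so a product with a column costs a sum of n terms; n + 1 also
   covers n = 0. *)
have e10 : 0 < e / n.+1%:R by rewrite divr_gt0.
have jc := Ck_on_continuous (Ck_on_jacobian oD c1) Dx0.
have /cvgrPdist_lt/(_ _ e10)/nbhs_ballP[r2 /= r20 r2J] := jc.
exists (Num.min r1 r2); split; first by rewrite lt_min r10.
  by move=> x xr; apply: r1D; apply: le_ball xr; rewrite ge_min lexx.
move=> x y xr yr; apply: normr_mx_le; first by rewrite mulr_ge0// ltW.
move=> i j; rewrite (ord1 i) {i}.
pose F z : R := (f z - z *m jacobian f x0) 0 j.
have dF z v : ball x0 (Num.min r1 r2) z ->
    is_derive z v F ((v *m (jacobian f z - jacobian f x0)) 0 j).
  move=> zr; have dfz : differentiable f z.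
    by apply: c1.1; apply: r1D; apply: le_ball zr; rewrite ge_min lexx.
  pose L : {linear 'rV[R]_n -> 'rV[R]_m} := mulmxr (jacobian f x0).
  have dL : differentiable L z by apply/linear_differentiable/linear_rV_continuous.
  have dfL : differentiable (f - (L : _ -> _)) z by exact: differentiableB.
  apply: DeriveDef; first exact/diff_derivable/(differentiable_entry 0 j dfL).
  rewrite -(derive_entry v 0 j dfL) deriveB; [|exact: diff_derivable..].
  rewrite deriveEjacobian// [in 'D_v L z]deriveE// diff_lin; last exact: linear_rV_continuous.
  by rewrite mulmxBr.
have [s s01|s s01 E] := @MVT_line R _ F x (y - x).
  by have [] := dF _ (y - x) (segment_ball xr yr s01).
have {}s01 : 0 <= s <= 1 by case/andP: s01 => ? ?; rewrite !ltW.
have zr := segment_ball xr yr s01.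
have [_ Ed] := dF _ (y - x) zr; rewrite Ed in E; rewrite (addrC x) subrK in E.
have -> : (f y - f x - (y - x) *m jacobian f x0) 0 j = F y - F x.
  by rewrite /F mulmxBl !mxE; ring.
rewrite E mxE; apply: le_trans (ler_norm_sum _ _ _) _.
apply: (@le_trans _ _ (\sum_(i < n) `|y - x| * (e / n.+1%:R))).
  apply: ler_sum => i _; rewrite normrM; apply: ler_pM => //.
    exact: normr_entry.
  apply: le_trans (normr_entry _ i j) _; rewrite distrC ltW//.
  by apply: r2J; apply: le_ball zr; rewrite ge_min lexx orbT.
rewrite sumr_const card_ord -[leLHS]mulr_natr -mulrA [leRHS]mulrC ler_wpM2l//.
rewrite -mulrA ger_pMr// mulrC ler_pdivrMr ?ltr0Sn// mul1r ler_nat.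
exact: leqnSn.
Qed.

(** Newton's map x - f x A^-1 with the fixed matrix A = Df(x0) contracts by 1/2 near x0. This gives
    injectivity at once, and openness by the fixed points of its translates by y A^-1. No regularity
    of the inverse is asserted; [smooth_lift] recovers smoothness later. *)
Lemma inverse_function n (D : set 'rV[R]_n) (f : 'rV[R]_n -> 'rV[R]_n) x0 :
  open D -> D x0 -> Ck_on 1 D f -> jacobian f x0 \in unitmx ->
  exists r : R, [/\ 0 < r, ball x0 r `<=` D,
    {in (ball x0 r : set _) &, injective f} &
    forall B, open B -> B `<=` ball x0 r -> open (f @` B)].
Proof.
move=> oD Dx0 c1 Ju; set A := jacobian f x0 in Ju.
have [C C0 AiC] := mulmxr_lipschitz (invmx A).
have e0 : 0 < (2 * C)^-1 by rewrite invr_gt0 mulr_gt0.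
have [r [r0 rD Hr]] := C1_strict oD Dx0 c1 e0.
pose phi x := x - f x *m invmx A.
have phiL x y : ball x0 r x -> ball x0 r y -> `|phi y - phi x| <= 2^-1 * `|y - x|.
  move=> xr yr.
  have -> : phi y - phi x = - ((f y - f x - (y - x) *m A) *m invmx A).
    rewrite !mulmxBl !mulmxK// /phi; move: (f y *m _) (f x *m _) => a b.
    rewrite [RHS]opprB !opprB addrACA [RHS]addrACA; congr (_ + _).
    exact: addrC.
  rewrite normrN; apply: le_trans (AiC _) _.
  apply: (@le_trans _ _ (C * ((2 * C)^-1 * `|y - x|))).
    by rewrite ler_pM2l//; exact: Hr.
  by rewrite mulrA invfM mulrCA divff ?mulr1// gt_eqF.
exists r; split=> //.
  move=> x y; rewrite !inE => xr yr fxy.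
  have := phiL _ _ xr yr; rewrite /phi fxy opprB addrA subrK => h.
  have : `|y - x| <= 0 by move: h; move: `|y - x| => z; lra.
  by rewrite normr_le0 subr_eq0 => /eqP.
move=> B oB Br.
rewrite openE => _ [x1 Bx1 <-].
have /nbhs_ballP[s /= s0 sB] := open_nbhs_nbhs (conj oB Bx1).
pose rho := s / 2.
have rho0 : 0 < rho by rewrite divr_gt0.
have cB : closed_ball x1 rho `<=` B.
  apply: subset_trans sB; apply: closed_ball_subset => //.
  by rewrite /rho ltr_pdivrMr// mulr2n mulrDr mulr1 ltrDl.
(* This radius lets the shift by (f x1 - y) A^-1 use up one half of rho and the contraction the
   other half, so that the closed ball is mapped into itself. *)
apply/nbhs_ballP; exists (rho / (2 * C)) => /=; first by rewrite divr_gt0// mulr_gt0.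
move=> y; rewrite -ball_normE /= => yb.
pose T x := phi x + y *m invmx A.
have TU : set_fun (closed_ball x1 rho) (closed_ball x1 rho) T.
  move=> x xU; have := xU; rewrite !closed_ballE// /closed_ball_ /= => xd.
  have -> : x1 - T x = (phi x1 - phi x) + (f x1 - y) *m invmx A.
    have E : x1 = phi x1 + f x1 *m invmx A by rewrite /phi subrK.
    by rewrite {1}E /T opprD mulmxBl addrACA.
  apply: le_trans (ler_normD _ _) _.
  have -> : rho = 2^-1 * rho + C * (rho / (2 * C)) by field; rewrite gt_eqF.
  apply: lerD.
    apply: (@le_trans _ _ (2^-1 * `|x1 - x|)).
      by apply: phiL; apply/Br => //; exact: cB.
    by rewrite ler_pM2l.
  by apply: le_trans (AiC _) _; rewrite ler_pM2l// ltW.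
have ctr : is_contraction (mkfun_fun TU).
  have hq : 0 <= (2^-1 : R) by rewrite invr_ge0.
  exists (NngNum hq); split=> /=; first by rewrite invf_lt1// ltr1n.
  move=> [p q] [/= pU qU]; rewrite /T opprD addrACA subrr addr0.
  by apply: phiL; apply/Br/cB.
have U0 : closed_ball x1 rho !=set0 by exists x1; exact: closed_ballxx.
have [x xU xT] := banach_fixed_point ctr (@closed_ball_closed _ _ _ _) U0.
exists x; first exact: cB.
have : T x = x by rewrite [RHS]xT.
rewrite /T /phi -[RHS]addr0 -addrA => /addrI.
rewrite addrC -mulmxBl => /(congr1 (mulmx^~ A)); rewrite mulmxKV// mul0mx.
by move=> /subr0_eq.
Qed.

(** Along the segment from x to x + h the mean value theorem evaluates the increment with the
    coefficients w at an intermediate point; their continuity turns the directional derivatives into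
    a differential. *)
Lemma gradient_is_diff n (D : set 'rV[R]_n) (f : 'rV[R]_n -> R)
    (w : 'I_n -> 'rV[R]_n -> R) :
  open D -> (forall i x, D x -> {for x, continuous (w i)}) ->
  (forall x v, D x -> is_derive x v f (\sum_i v 0 i * w i x)) ->
  forall x, D x -> is_diff x f (fun v => \sum_i v 0 i * w i x).
Proof.
move=> oD wc df x Dx.
pose L v : R := \sum_i (v : 'rV[R]_n) 0 i * w i x.
have Ll : linear L.
  move=> a u v; rewrite /L [a *: \sum_i _]mulr_sumr -big_split/=.
  by apply: eq_bigr => i _; rewrite !mxE mulrDl mulrA.
pose LM := GRing.isLinear.Build _ _ _ _ _ Ll.
pose LL : {linear 'rV[R]_n -> R} := HB.pack L LM.
apply: (@is_diff_littleo _ _ _ f LL x); first exact: linear_rV_continuous.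
move=> e e0.
have e10 : 0 < e / n.+1%:R by rewrite divr_gt0.
have /nbhs_ballP[r1 /= r10 r1D] := open_nbhs_nbhs (conj oD Dx).
have : \forall y \near x, forall i, `|w i x - w i y| < e / n.+1%:R.
  by apply: near_forall_fin => i; have /cvgrPdist_lt := wc i x Dx; exact.
move=> /nbhs_ballP[r2 /= r20 r2w].
have m0 : 0 < Num.min r1 r2 by rewrite lt_min r10.
near=> h.
have hr : `|h| < Num.min r1 r2.
  near: h; apply/nbhs_ballP; exists (Num.min r1 r2) => //= h.
  by rewrite -ball_normE /= sub0r normrN.
have hb : ball x (Num.min r1 r2) (h + x).
  by rewrite -ball_normE /= opprD addrCA subrr addr0 normrN.
have xb : ball x (Num.min r1 r2) x by apply: ballxx; rewrite lt_min r10.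
have D1 y : ball x (Num.min r1 r2) y -> D y.
  by move=> yb; apply: r1D; apply: le_ball yb; rewrite ge_min lexx.
have [s s01|s s01 E] := @MVT_line R _ f x (h + x - x).
  by have [] := df _ (h + x - x) (D1 _ (segment_ball xb hb s01)).
have {}s01 : 0 <= s <= 1 by case/andP: s01 => ? ?; rewrite !ltW.
have zr := segment_ball xb hb s01.
have [_ Ed] := df _ (h + x - x) (D1 _ zr).
have := etrans E Ed; move: zr; rewrite addrK (addrC x h) => zr {}E.
have -> : f (h + x) - f x - LL h =
    \sum_i h 0 i * (w i (x + s *: h) - w i x).
  by rewrite E -sumrB; apply: eq_bigr => i _; rewrite mulrBr.
apply: le_trans (ler_norm_sum _ _ _) _.
apply: (@le_trans _ _ (\sum_(i < n) `|h| * (e / n.+1%:R))).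
  apply: ler_sum => i _; rewrite normrM; apply: ler_pM => //.
    exact: normr_entry.
  rewrite distrC ltW//; apply: r2w.
  by apply: le_ball zr; rewrite ge_min lexx orbT.
rewrite sumr_const card_ord -[leLHS]mulr_natr -mulrA [leRHS]mulrC ler_wpM2l//.
rewrite -mulrA ger_pMr// mulrC ler_pdivrMr ?ltr0Sn// mul1r ler_nat.
exact: leqnSn.
Unshelve. all: by end_near. Qed.

End InverseFunction.

(** * The Poincaré lemma *)

Section Poincare.
Variable R : realType.
Local Notation mu := (@lebesgue_measure R).

Lemma is_derive_line0 (V W : normedModType R) (f : V -> W) x v l :
  is_derive (0 : R) 1 (fun t : R => f (x + t *: v)) l -> is_derive x v f l.
Proof.
have E : (fun h : R => h^-1 *: (f (x + (h *: (1 : R) + 0) *: v) - f (x + 0 *: v)))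
    = (fun h => h^-1 *: (f (h *: v + x) - f x)).
  apply/funext => h; congr (_ *: (f _ - f _)); last by rewrite scale0r addr0.
  by rewrite [h *: _]mulr1 addr0 addrC.
by case; rewrite /derivable /derive /= E => h1 h2; apply: DeriveDef.
Qed.

Lemma continuous_line (V : normedModType R) (x v : V) :
  continuous (fun s : R => x + s *: v).
Proof.
move=> s; apply: cvgD; first exact: cvg_cst.
exact: scalel_continuous.
Qed.

Lemma Rintegral_FTC2 (f F : R -> R) (a b : R) : a < b ->
  (forall x, a <= x <= b -> {for x, continuous f}) ->
  (forall x, a <= x <= b -> is_derive x 1 F (f x)) ->
  \int[mu]_(x in `[a, b]) f x = F b - F a.
Proof.
move=> ab fc dF; rewrite /Rintegral.
have Fc x : a <= x <= b -> {for x, continuous F}.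
  by move=> /dF[/derivable1_diffP/differentiable_continuous].
rewrite (@continuous_FTC2 _ f F a b ab)//.
- by apply: continuous_in_subspaceT => x; rewrite inE/= in_itv/=; exact: fc.
- split.
  + move=> x; rewrite in_itv/= => /andP[h1 h2].
    have hx : a <= x <= b by rewrite !ltW.
    by have [] := dF x hx.
  + by apply: cvg_at_right_filter; apply: Fc; rewrite lexx ltW.
  + by apply: cvg_at_left_filter; apply: Fc; rewrite lexx ltW.
- move=> x; rewrite in_itv/= => /andP[h1 h2]; rewrite derive1E.
  have hx : a <= x <= b by rewrite !ltW.
  by have [_ ->] := dF x hx.
Qed.

(** The primitive is the integral of the form along straight segments from x0. Its derivative along
    v is taken under the integral, and with z = x - x0 closedness turns the result into the
    s-derivative of s times the form at x0 + s z on v, whose values at 0 and 1 give the claim. *)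
Lemma poincare n (D : set 'rV[R]_n) (w : 'I_n -> 'rV[R]_n -> R) x0 :
  open D -> D x0 -> (forall i, Ck_on 1 D (w i)) ->
  (forall i j x, D x -> 'D_('e_i) (w j) x = 'D_('e_j) (w i) x) ->
  exists r : R, exists f : 'rV[R]_n -> R, [/\ 0 < r, ball x0 r `<=` D &
    forall x, ball x0 r x -> is_diff x f (fun v => \sum_i v 0 i * w i x)].
Proof.
move=> oD Dx0 cw closed.
have wc i x : D x -> {for x, continuous (w i)}.
  by move=> Dx; exact: (Ck_on_continuous (cw i) Dx).
(* Bounds for the coefficients and their first derivatives on a ball, needed to dominate the
   derivative of the integrand. *)
have [r [r0 rD [M [M0 Mw MDw]]]] : exists r : R, [/\ 0 < r, ball x0 r `<=` D &
    exists M : R, [/\ 0 < M, forall i x, ball x0 r x -> `|w i x| <= M &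
      forall i j x, ball x0 r x -> `|'D_('e_i) (w j) x| <= M]].
  have /nbhs_ballP[r1 /= r10 r1D] := open_nbhs_nbhs (conj oD Dx0).
  pose M := 1 + \sum_i `|w i x0| + \sum_i \sum_j `|'D_('e_i) (w j) x0|.
  have n1 : \forall x \near x0, forall i, `|w i x0 - w i x| < 1.
    by apply: near_forall_fin => i; have /cvgrPdist_lt := wc i x0 Dx0; exact.
  have n2 : \forall x \near x0, forall i j,
      `|'D_('e_i) (w j) x0 - 'D_('e_i) (w j) x| < 1.
    apply: near_forall_fin => i; apply: near_forall_fin => j.
    by have /cvgrPdist_lt := (cw j).2 'e_i x0 Dx0; exact.
  have : nbhs x0 (fun x => (forall i, `|w i x0 - w i x| < 1) /\
      (forall i j, `|'D_('e_i) (w j) x0 - 'D_('e_i) (w j) x| < 1)).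
    exact: filterI n1 n2.
  move=> /nbhs_ballP[r2 /= r20 r2w].
  exists (Num.min r1 r2); split; first by rewrite lt_min r10.
    by move=> x xr; apply: r1D; apply: le_ball xr; rewrite ge_min lexx.
  have S0 : 0 <= \sum_i `|w i x0| by apply: sumr_ge0.
  have T0 : 0 <= \sum_i \sum_j `|'D_('e_i) (w j) x0|.
    by do 2 apply: sumr_ge0 => ? _.
  have bd (a b : R) : `|a - b| < 1 -> `|b| <= 1 + `|a|.
    move=> ab; rewrite -[b](subrK a) (le_trans (ler_normD _ _))// lerD2r.
    by rewrite distrC ltW.
  exists M; split; first by rewrite /M -addrA ltr_pwDl// addr_ge0.
    move=> i x xr; have /r2w[/(_ i)/bd h _] : ball x0 r2 x.
      by apply: le_ball xr; rewrite ge_min lexx orbT.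
    apply: (le_trans h); rewrite /M -addrA lerD2l (bigD1 i)//= -addrA lerDl.
    by rewrite addr_ge0// sumr_ge0.
  move=> i j x xr; have /r2w[_ /(_ i j)/bd h] : ball x0 r2 x.
    by apply: le_ball xr; rewrite ge_min lexx orbT.
  apply: (le_trans h); rewrite /M -addrA lerD2l.
  apply: (@le_trans _ _ (\sum_i \sum_j `|'D_('e_i) (w j) x0|)).
    rewrite (bigD1 i)//= (bigD1 j)//= -addrA lerDl.
    by rewrite addr_ge0// ?sumr_ge0// => k _; exact: sumr_ge0.
  by rewrite lerDr.
pose G (z : 'rV[R]_n) (s : R) : R := \sum_i z 0 i * w i (x0 + s *: z).
pose f x := \int[mu]_(s in `[0, 1]) G (x - x0) s.
exists r, f; split=> //.
have ob : open (ball x0 r : set 'rV[R]_n) by exact: ball_open.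
apply: (@gradient_is_diff R n (ball x0 r)) => //.
  by move=> i x xr; apply: wc; exact: rD.
move=> x v xr.
have inb z (s : R) : ball x0 r (x0 + z) -> 0 <= s <= 1 -> ball x0 r (x0 + s *: z).
  move=> zr s01; have := segment_ball (ballxx x0 r0) zr s01.
  by rewrite [x0 + z]addrC addrK.
have dw i y u : ball x0 r y -> is_derive y u (w i) (\sum_j u 0 j * 'D_('e_j) (w i) y).
  move=> yr; have dwy : differentiable (w i) y by apply: (cw i).1; exact: rD.
  by apply: DeriveDef; [exact: diff_derivable|exact: derive_row_sum].
have [d d0 dP] : exists2 d : R, 0 < d &
    forall t : R, `|t| < d -> ball x0 r (x + t *: v).
  have /nbhs_ballP[d1 /= d10 d1P] := open_nbhs_nbhs (conj ob xr).
  exists (d1 / (1 + `|v|)); first by rewrite divr_gt0// ltr_pwDl.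
  move=> t td; apply: d1P; rewrite -ball_normE /= opprD addrA subrr add0r normrN.
  rewrite normrZ; apply: (@le_lt_trans _ _ (`|t| * (1 + `|v|))).
    by rewrite ler_wpM2l// lerDr.
  by rewrite -ltr_pdivlMr// ltr_pwDl.
pose F (t s : R) : R := G (x + t *: v - x0) s.
have zE t : x0 + (x + t *: v - x0) = x + t *: v by rewrite addrC subrK.
pose dF (t s : R) : R := let z := x + t *: v - x0 in
  \sum_i (v 0 i * w i (x0 + s *: z) +
    z 0 i * \sum_j (s *: v) 0 j * 'D_('e_j) (w i) (x0 + s *: z)).
have Fd (t s : R) : `|t| < d -> 0 <= s <= 1 -> is_derive t 1 (F ^~ s) (dF t s).
  move=> td s01; rewrite /F /G /dF.
  have br : ball x0 r (x0 + s *: (x + t *: v - x0)) by apply: inb; rewrite ?zE//; exact: dP.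
  have -> : (fun t0 : R => \sum_i (x + t0 *: v - x0) 0 i * w i (x0 + s *: (x + t0 *: v - x0)))
     = \sum_i (fun t0 => (x + t0 *: v - x0) 0 i * w i (x0 + s *: (x + t0 *: v - x0))).
    by apply/funext => t0; rewrite fct_sumE.
  apply: is_derive_sum => i.
  have h1 : is_derive t 1 (fun t0 : R => (x + t0 *: v - x0) 0 i) (v 0 i).
    have -> : (fun t0 : R => (x + t0 *: v - x0) 0 i) =
       (fun t0 => (x 0 i - x0 0 i) + t0 * v 0 i).
      by apply/funext => t0; rewrite !mxE; ring.
    by apply: is_derive_eq; rewrite /GRing.scale/=; ring.
  have h2 : is_derive t 1 (fun t0 : R => w i (x0 + s *: (x + t0 *: v - x0)))
      (\sum_j (s *: v) 0 j * 'D_('e_j) (w i) (x0 + s *: (x + t *: v - x0))).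
    have e0 t0 : x0 + s *: (x + t0 *: v - x0) = (x0 + s *: (x - x0)) + t0 *: (s *: v).
      by rewrite addrAC scalerDr addrA !scalerA mulrC.
    have -> : (fun t0 : R => w i (x0 + s *: (x + t0 *: v - x0))) =
      (fun t0 => w i ((x0 + s *: (x - x0)) + t0 *: (s *: v))).
      by apply/funext => t0; rewrite e0.
    have [h3 h4] := dw i _ (s *: v) br.
    by rewrite e0 in h3 h4 *; rewrite -h4; exact: is_derive_line.
  have [p1 p2] := is_deriveM h1 h2.
  apply: DeriveDef; first exact: p1.
  rewrite p2 addrC; congr (_ + _); exact: mulrC.
pose I z := (fun s : R => x0 + s *: z) @^-1` ball x0 r.
have oI z : open (I z).
  by apply: open_comp => // s _; exact: continuous_line.
have cI (h : 'rV[R]_n -> R) z : Ck_on 0 D h -> Ck_on 0 (I z) (fun s => h (x0 + s *: z)).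
  move=> ch s Is; apply: continuous_comp; last by apply: ch; exact: rD.
  exact: continuous_line.
have cdw i j : Ck_on 0 D ('D_('e_j) (w i)) by exact: (cw i).2.
have Gi z : ball x0 r (x0 + z) -> mu.-integrable `[0%R, 1%R] (EFin \o G z).
  move=> zr; apply: continuous_compact_integrable; first exact: segment_compact.
  apply: continuous_in_subspaceT => s; rewrite inE/= in_itv/= => s01.
  have : I z s by exact: inb.
  move: s {s01}; change (Ck_on 0 (I z) (G z)).
  apply: Ck_on_sum => // i; apply: Ck_onM => //; first exact: Ck_on_cst.
  by apply: cI => y /wc.
(* A bound for [dF], uniform in s and in small t. *)
pose K := \sum_(i < n) (`|v| * M + r * \sum_(j < n) `|v| * M).
have K0 : 0 <= K.
  apply: sumr_ge0 => i _; have vM : 0 <= `|v| * M by rewrite mulr_ge0// ltW.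
  rewrite addr_ge0// mulr_ge0//; first exact: ltW.
  exact: sumr_ge0.
have dFK (t s : R) : `|t| < d -> 0 <= s <= 1 -> `|dF t s| <= K.
  move=> td s01; apply: le_trans (ler_norm_sum _ _ _) _; apply: ler_sum => i _.
  have br : ball x0 r (x0 + s *: (x + t *: v - x0)) by apply: inb; rewrite ?zE//; exact: dP.
  apply: le_trans (ler_normD _ _) _; apply: lerD.
    rewrite normrM; apply: ler_pM => //; first exact: normr_entry.
    exact: Mw.
  rewrite normrM; apply: ler_pM => //.
    apply: le_trans (normr_entry _ _ _) _; rewrite distrC ltW//.
    by have := dP _ td; rewrite -ball_normE.
  apply: le_trans (ler_norm_sum _ _ _) _; apply: ler_sum => j _.
  rewrite normrM; apply: ler_pM => //; last exact: MDw.
  apply: le_trans (normr_entry _ _ _) _; rewrite normrZ.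
  by case/andP: s01 => s0 s1; rewrite ger0_norm// ler_piMl.
have d01 : (0 : R) \in `]- d, d[ by rewrite in_itv/= oppr_lt0 d0.
have td (t : R) : t \in `]- d, d[ -> `|t| < d by rewrite in_itv/= ltr_norml.
have H1 (t : R) : [set` `]- d, d[ ] t -> mu.-integrable `[0%R, 1%R] (EFin \o F t).
  by move=> /= /td ht; apply: Gi; rewrite zE; exact: dP.
have H2 (t s : R) : [set` `]- d, d[ ] t -> `[0%R, 1%R]%classic s -> derivable (F ^~ s) t 1.
  by move=> /= /td ht; rewrite in_itv/= => hs; have [] := Fd t s ht hs.
have H3 : mu.-integrable `[0%R, 1%R] (EFin \o (fun=> K : R)).
  apply: continuous_compact_integrable; first exact: segment_compact.
  by move=> s; exact: cvg_cst.
have H4 (t s : R) : [set` `]- d, d[ ] t -> `[0%R, 1%R]%classic s -> `|partial1of2 F t s| <= K.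
  move=> /= /td ht; rewrite in_itv/= => hs; rewrite partial1of2E.
  by have [_ ->] := Fd t s ht hs; exact: dFK.
have mB : measurable (`[0%R, 1%R]%classic : set (measurableTypeR R)) by exact: measurable_itv.
apply: is_derive_line0.
have dphi := @derivable_under_integral R _ _ mu F _ mB 0 (- d) d d01 H1 H2 _ (fun=> K0) H3 H4.
have Ephi := @differentiation_under_integral R _ _ mu F _ mB 0 (- d) d d01 H1 H2 _ (fun=> K0) H3 H4.
apply: DeriveDef; first exact: dphi.
rewrite -derive1E; apply: (etrans Ephi).
rewrite (@eq_Rintegral _ _ _ mu _ (dF 0)); last first.
  move=> s; rewrite inE/= in_itv/= => hs; rewrite partial1of2E.
  by have [_ ->] := Fd 0 s (td _ d01) hs.
pose z := x - x0.
have zr : ball x0 r (x0 + z) by rewrite /z addrC subrK.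
have z0 : x + 0 *: v - x0 = z by rewrite scale0r addr0.
(* By closedness, an antiderivative in s of the differentiated integrand. *)
pose H s : R := s * \sum_i v 0 i * w i (x0 + s *: z).
have FTC := @Rintegral_FTC2 (dF 0) H 0 1 ltr01.
apply: (etrans (FTC _ _)).
- move=> s s01; have : I z s by exact: inb.
  move: s {s01}; change (Ck_on 0 (I z) (dF 0)).
  rewrite /dF z0; apply: Ck_on_sum => // i; apply: Ck_onD => //.
    apply: Ck_onM => //; first exact: Ck_on_cst.
    by apply: cI => y /wc.
  apply: Ck_onM => //; first exact: Ck_on_cst.
  apply: (@Ck_on_sum R _ _ 0 (I z) _ _
    (fun j (s : R) => (s *: v) 0 j * 'D_('e_j) (w i) (x0 + s *: z))) => // j.
  have a1 : Ck_on 0 (I z) (fun s => (s *: v) 0 j).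
    move=> s _; apply: (@continuous_comp _ _ _ (fun s : R => s *: v)
      (fun u : 'rV[R]_n => u 0 j)); first exact: scalel_continuous.
    exact: coord_continuous.
  exact: (Ck_onM (oI z) a1 (cI _ z (cdw i j))).
- move=> s s01; have br : ball x0 r (x0 + s *: z) by exact: inb.
  have h1 : is_derive s 1 (fun s : R => \sum_i v 0 i * w i (x0 + s *: z))
      (\sum_i v 0 i * \sum_j z 0 j * 'D_('e_j) (w i) (x0 + s *: z)).
    rewrite (_ : (fun s : R => _) = \sum_i (fun s => v 0 i * w i (x0 + s *: z))).
      apply: is_derive_sum => i.
      have [h3 h4] := dw i _ z br.
      have [h5 h6] := is_derive_line h3.
      exact: (is_deriveZ (v 0 i) (DeriveDef h5 (etrans h6 h4))).
    by apply/funext => t; rewrite fct_sumE.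
  have [h3 h4] := is_deriveM (is_derive_id s 1) h1.
  apply: DeriveDef; first exact: h3.
  rewrite h4 /dF z0 big_split/= [X in _ + X = _ + _]mulr1 addrC.
  congr (_ + _); rewrite [LHS]mulr_sumr.
  rewrite (eq_bigr (fun i => \sum_j s * (v 0 i *
    (z 0 j * 'D_('e_j) (w i) (x0 + s *: z))))); last first.
    by move=> i _; rewrite !mulr_sumr.
  rewrite exchange_big/=; apply: eq_bigr => i _.
  rewrite mulr_sumr; apply: eq_bigr => j _.
  rewrite [(s *: v) 0 j]mxE (closed i j); last exact: rD.
  ring.
- by rewrite /H mul1r mul0r subr0 scale1r /z (addrC x0) subrK.
Qed.

End Poincare.

(** * Covering maps *)

Lemma pair_continuous (X Y Z : topologicalType) (f : X -> Y) (g : X -> Z) x :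
  {for x, continuous f} -> {for x, continuous g} ->
  {for x, continuous (fun y => (f y, g y))}.
Proof.
move=> fc gc W [[W1 W2] /= [n1 n2] W12].
have n : nbhs x (f @^-1` W1 `&` g @^-1` W2).
  by apply: filterI; [exact: fc|exact: gc].
by apply: filterS n => y [? ?]; exact: (W12 (f y, g y)).
Qed.

(** * Paths parametrized by a segment *)

Section Segment.
Variable R : realType.

(** Precomposing with this map makes a path on a segment continuous on the whole line and constant
    outside, which avoids subspace topologies. *)
Definition clamp (a b s : R) : R := Num.max a (Num.min s b).

Lemma clamp_in (a b s : R) : a <= b -> a <= clamp a b s <= b.
Proof.
move=> ab; rewrite /clamp le_max lexx/= ge_max ab ge_min lexx orbT.
by [].
Qed.

Lemma clamp_id (a b s : R) : a <= s <= b -> clamp a b s = s.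
Proof.
by move=> /andP[as_ sb]; rewrite /clamp (min_idPl sb) (max_idPr as_).
Qed.

Lemma clamp_continuous (a b : R) : continuous (clamp a b).
Proof.
move=> s; apply: (@continuous_max R R (cst a) (fun s => Num.min s b)).
  exact: cst_continuous.
by apply: (@continuous_min R R id (cst b)); [exact: cvg_id|exact: cst_continuous].
Qed.

Lemma affine_continuous (c d : R) : continuous (fun s : R => c + d * s).
Proof. by move=> s; apply: cvgD; [exact: cvg_cst|exact: mulrl_continuous]. Qed.

Lemma within_clamp_continuous (T : topologicalType) (f : R -> T) :
  {within `[0, 1]%classic, continuous f} -> continuous (f \o clamp 0 1).
Proof.
move=> fc s; have /subspace_continuousP fc' := fc.
have c01 : `[0, 1]%classic (clamp 0 1 s) by rewrite /= in_itv/=; exact: clamp_in.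
move=> W /(fc' _ c01) /= nW.
have nc : nbhs s (clamp 0 1 @^-1` [set z | `[0, 1]%classic z -> W (f z)]).
  exact: clamp_continuous nW.
by apply: filterS nc => z /=; apply; rewrite /= in_itv/=; exact: clamp_in.
Qed.

(** The points where P holds and those where it fails are both open in the segment, which is
    connected. Existence and uniqueness of lifts and their dependence on a parameter are all proved
    by this continuation. *)
Lemma segment_locally_constant (P : R -> Prop) (a b : R) :
  (forall s, a <= s <= b -> exists2 I : set R, nbhs s I &
     forall r r', I r -> I r' -> a <= r <= b -> a <= r' <= b -> P r -> P r') ->
  forall r r', a <= r <= b -> a <= r' <= b -> P r -> P r'.
Proof.
move=> loc r0 r1 ar0 ar1 Pr0.
pose A : set R := [set` `[a, b]].
have AE s : A s = (a <= s <= b) by rewrite /A /= in_itv.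
(* The union of open sets on which P is constant, taken around the points where Q holds; it is used
   for P and for its negation. *)
pose C (Q : R -> Prop) : set R := [set y | exists s I, [/\ a <= s <= b, Q s,
   open I, I s & I y /\ forall r r', I r -> I r' -> a <= r <= b -> a <= r' <= b -> P r -> P r']].
have oC Q : open (C Q).
  rewrite openE => y [s [I [h1 h2 h3 h4 [h5 h6]]]].
  have : nbhs y I by exact: open_nbhs_nbhs.
  by apply: filterS => z Iz; exists s, I.
have inC Q s : a <= s <= b -> Q s -> C Q s.
  move=> asb Qs; have [I /= nI HI] := loc s asb.
  exists s, I^°; split => //; first exact: open_interior.
  split=> //; by move=> r r' /interior_subset Ir /interior_subset Ir'; exact: HI.
have E : A `&` [set s | P s] = A.
  apply: (@segment_connected R a b).
  - by exists r0; split=> //; rewrite AE.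
  - exists (C P) => //; apply/seteqP; split=> y [Ay Py]; split=> //.
      by apply: inC => //; rewrite -AE.
    case: Py => s [I [h1 h2 h3 h4 [h5 h6]]]; exact: (h6 s).
  - exists (~` C (fun s => ~ P s)); first exact: open_closedC.
    apply/seteqP; split=> y [Ay Py]; split=> //.
      by move=> [s [I [h1 h2 h3 h4 [h5 h6]]]]; apply: h2; exact: (h6 y).
    by apply: contrapT => nPy; apply: Py; exact: inC.
have : A r1 by rewrite AE.
by rewrite -E => -[].
Qed.

Lemma paste_continuous (T : topologicalType) (f g : R -> T) (a : R) :
  continuous f -> continuous g -> f a = g a ->
  continuous (fun s => if s <= a then f s else g s).
Proof.
move=> fc gc fga s.
have [sa|as_|->] := ltgtP s a.
- rewrite /continuous_at ltW//.
  apply: (cvg_trans _ (fc s)); apply: near_eq_cvg.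
  near=> x; suff -> : x <= a by [].
  by apply: ltW; near: x; exact: lt_nbhsl.
- rewrite /continuous_at leNgt as_/=.
  apply: (cvg_trans _ (gc s)); apply: near_eq_cvg.
  near=> x; suff -> : (x <= a) = false by [].
  by apply/negbTE; rewrite -ltNge; near: x; exact: lt_nbhsr.
- rewrite /continuous_at lexx => W /= fW; have fW' := fc a _ fW; rewrite fga in fW.
  have : nbhs a (f @^-1` W `&` g @^-1` W).
    by apply: filterI => //; exact: gc.
  by apply: filterS => x [/= ? ?]; case: ifP.
Unshelve. all: by end_near. Qed.

End Segment.

(** * Lifting of paths, homotopies and maps *)

Section Covering.
Variables (R : realType).

(** One sheet A over an evenly covered N, with its section sig. Openness of the rest of the preimage
    says that A is closed in the preimage, which is what continuation arguments use. *)
Definition covering_sheet (T U : topologicalType) (pi : T -> U) (N : set U)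
    (A : set T) (sig : U -> T) :=
  [/\ open A, open (pi @^-1` N `\` A), forall x, A x -> N (pi x) /\ sig (pi x) = x,
      forall y, N y -> A (sig y) /\ pi (sig y) = y &
      forall y, N y -> {for y, continuous sig}].

Lemma covering_mapP (T U : topologicalType) (pi : T -> U) : covering_map pi ->
  forall u, exists N : set U, [/\ open N, N u & forall t, N (pi t) ->
    exists A sig, A t /\ covering_sheet pi N A sig].
Proof.
move=> [pic _ ev] u; have [N [oO Ou [S [disj cov sh]]]] := ev u.
exists N; split=> // t Ot.
have : (pi @^-1` N) t by [].
rewrite -cov => -[A SA At]; have [oA injA piA opA] := sh _ SA.
have /choice[sig sigP] y : exists x, N y -> A x /\ pi x = y.
  have [Oy|nOy] := pselect (N y); last by exists t.
  by move: Oy; rewrite -piA => -[x Ax <-]; exists x.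
have OA x : A x -> N (pi x) by move=> Ax; rewrite -piA; exists x.
have sigK x : A x -> sig (pi x) = x.
  move=> Ax; have [h1 h2] := sigP _ (OA _ Ax).
  by apply: injA; rewrite ?inE.
exists A, sig; split=> //; split=> //.
(* The rest of the preimage is the union of the other sheets. *)
- rewrite (_ : _ `\` _ = \bigcup_(B in S `&` [set B | B <> A]) B).
    by apply: bigcup_open => B [/sh[]].
  apply/seteqP; split=> x.
    move=> [Ox nAx]; move: Ox; rewrite -cov => -[B SB Bx].
    by exists B => //; split=> // BA; apply: nAx; rewrite -BA.
  move=> [B [SB nBA] Bx]; split; first by rewrite -cov; exists B.
  by move=> Ax; apply: nBA; apply: disj => //; exists x.
- by move=> x Ax; split; [exact: OA|exact: sigK].
- move=> y Oy W /= nW.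
  have [Asy pisy] := sigP _ Oy.
  have oWA : open (W^° `&` A) by apply: openI => //; exact: open_interior.
  have : open (pi @` (W^° `&` A)) by apply: opA => // x [].
  move=> oi; have : nbhs y (pi @` (W^° `&` A)).
    apply: open_nbhs_nbhs; split=> //; exists (sig y) => //; split=> //.
  apply: filterS => _ [x [Wx Ax] <-] /=; rewrite sigK//.
  exact: interior_subset Wx.
Qed.

Section Lifts.
Variables (T U : topologicalType) (pi : T -> U).
Hypothesis cpi : covering_map pi.

Lemma covering_continuous : continuous pi.
Proof. by case: cpi. Qed.

(** Where f and g agree, they lie in one sheet and agree nearby; where they differ, f stays nearby
    in one sheet and g outside it. *)
Lemma lift_unique (f g : R -> T) (a b : R) : continuous f -> continuous g ->
  (forall s, a <= s <= b -> pi (f s) = pi (g s)) ->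
  forall r s, a <= r <= b -> a <= s <= b -> f r = g r -> f s = g s.
Proof.
move=> fc gc fg; apply: segment_locally_constant => s asb.
have [N [oN Ns HN]] := covering_mapP cpi (pi (f s)).
have [A [sA [Af [oA oAc sAP _ _]]]] := HN (f s) Ns.
have nf : nbhs s (f @^-1` A) by apply: fc; exact: open_nbhs_nbhs.
have [fgs|nfgs] := pselect (f s = g s).
  exists (f @^-1` A `&` g @^-1` A).
    by apply: filterI => //; apply: gc; apply: open_nbhs_nbhs; rewrite -fgs.
  move=> r r' _ [/= Ar' Br'] _ ar' _.
  have [_ E1] := sAP _ Ar'; have [_ E2] := sAP _ Br'.
  by rewrite -E1 -E2 fg.
exists (f @^-1` A `&` g @^-1` (pi @^-1` N `\` A)).
  apply: filterI => //; apply: gc; apply: open_nbhs_nbhs; split=> //; split.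
    by rewrite /preimage/= -fg.
  move=> Ag; apply: nfgs; have [_ E1] := sAP _ Ag; have [_ E2] := sAP _ Af.
  by rewrite -E1 -E2 fg.
by move=> r r' [/= Ar [_ nAr]] _ _ _ fgr; exfalso; apply: nAr; rewrite -fgr.
Qed.

(** A sheet is open and closed in the preimage of N, so a path over N cannot leave it. The minimum
    and maximum allow b on either side of a. *)
Lemma sheet_stay (N : set U) A sig (f : R -> T) (a b : R) :
  covering_sheet pi N A sig -> continuous f ->
  (forall s, Num.min a b <= s <= Num.max a b -> N (pi (f s))) ->
  A (f a) -> A (f b).
Proof.
move=> [oA oAc _ _ _] fc Nf.
apply: (@segment_locally_constant R (fun x => A (f x)) (Num.min a b) (Num.max a b)).
- move=> s sab; have [As|nAs] := pselect (A (f s)).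
    exists (f @^-1` A) => //; apply: fc; exact: open_nbhs_nbhs.
  exists (f @^-1` (pi @^-1` N `\` A)); last by move=> r r' [_ nA].
  apply: fc; apply: open_nbhs_nbhs; split=> //; split=> //; exact: Nf.
- by rewrite ge_min lexx le_max lexx.
- by rewrite ge_min lexx orbT le_max lexx orbT.
Qed.

(** Lifts are total paths constrained over [0, 1] only; hence they are compared there only. *)
Definition is_lift (gam : R -> U) (t : T) (f : R -> T) :=
  [/\ continuous f, f 0 = t & forall s, 0 <= s <= 1 -> pi (f s) = gam s].

Lemma is_lift_unique gam t f g : is_lift gam t f -> is_lift gam t g ->
  forall s, 0 <= s <= 1 -> f s = g s.
Proof.
move=> [fc f0 fg] [gc g0 gg] s s01.
apply: (@lift_unique f g 0 1 fc gc _ 0) => //.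
- by move=> r r01; rewrite fg// gg.
- by rewrite lexx ler01.
- by rewrite f0 g0.
Qed.

(** A lift over [0, r] is prolonged over a short interval by pasting to it the section of the sheet
    that contains its endpoint. *)
Lemma lift_exists (gam : R -> U) t : continuous gam -> pi t = gam 0 ->
  exists f, is_lift gam t f.
Proof.
move=> gc pit.
pose P s := exists f : R -> T, [/\ continuous f, f 0 = t &
  forall r, 0 <= r <= s -> pi (f r) = gam r].
suff [f [fc f0 fP]] : P 1 by exists f.
have i01 : 0 <= (0 : R) <= 1 by rewrite lexx ler01.
have i11 : 0 <= (1 : R) <= 1 by rewrite lexx ler01.
apply: (@segment_locally_constant R P 0 1 _ 0 1 i01 i11); last first.
  exists (cst t); split=> //; first exact: cst_continuous.
  by move=> r r0; have -> : r = 0 by apply/eqP; rewrite eq_le andbC.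
move=> s s01; have [N [oN Ns HN]] := covering_mapP cpi (gam s).
have : nbhs s (gam @^-1` N) by apply: gc; exact: open_nbhs_nbhs.
move=> /nbhs_ballP[e /= e0 eN]; exists (ball s e); first exact: nbhsx_ballx.
move=> r r' rs rs' /andP[r0 r1] r01' [f [fc f0 fP]].
have [rr|rr] := leP r' r.
  exists f; split=> // x /andP[x0 xr]; apply: fP; rewrite x0 (le_trans xr)//.
have Nr : N (pi (f r)) by rewrite fP ?r0 ?lexx//; exact: eN.
have [A [sig [Af [_ _ sP NP sigc]]]] := HN _ Nr.
(* Clamping keeps gam inside N, where the section is continuous. *)
pose h x := sig (gam (clamp r r' x)).
have Nc x : N (gam (clamp r r' x)).
  apply: eN; have := clamp_in x (ltW rr).
  move: rs rs'; rewrite -!ball_normE /= !ltr_norml => /andP[a1 a2] /andP[a3 a4] /andP[a5 a6].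
  by apply/andP; split; lra.
have hc : continuous h.
  move=> x; apply: (@continuous_comp _ _ _ (fun x => gam (clamp r r' x)) sig).
    by apply: continuous_comp; [exact: clamp_continuous|exact: gc].
  exact: sigc.
have rrr : clamp r r' r = r by rewrite clamp_id// lexx ltW.
have fh : f r = h r.
  by rewrite /h rrr -fP ?r0 ?lexx//; have [_ ->] := sP _ Af.
exists (fun x => if x <= r then f x else h x); split.
- exact: paste_continuous.
- by rewrite r0.
- move=> x /andP[x0 xr']; case: ifP => [xr|/negbT]; first by rewrite fP// x0.
  rewrite -ltNge => rx; rewrite /h; have [_ ->] := NP _ (Nc x).
  by rewrite clamp_id// xr' ltW.
Qed.

(** The lifts L r are given one by one, with no joint continuity. Continuity of r |-> L r s at r0 is
    propagated in s from sheet to sheet; at s = 1 all values lie over the single point u, so the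
    endpoint is locally constant in r. *)
Lemma homotopy_lift_endpoint (H : R -> R -> U) t (L : R -> R -> T) u :
  continuous (fun p : R * R => H p.1 p.2) ->
  (forall r, 0 <= r <= 1 -> is_lift (H r) t (L r)) ->
  (forall r, 0 <= r <= 1 -> H r 1 = u) -> L 0 1 = L 1 1.
Proof.
move=> Hc HL Hu.
have i01 : 0 <= (0 : R) <= 1 by rewrite lexx ler01.
have i11 : 0 <= (1 : R) <= 1 by rewrite lexx ler01.
have key r0 : 0 <= r0 <= 1 -> forall W, open W -> W (L r0 1) ->
    exists2 I : set R, nbhs r0 I & forall r, I r -> 0 <= r <= 1 -> W (L r 1).
  move=> r01.
  pose P s := forall W, open W -> W (L r0 s) ->
    exists2 I : set R, nbhs r0 I & forall r, I r -> 0 <= r <= 1 -> W (L r s).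
  apply: (@segment_locally_constant R P 0 1 _ 0 1 i01 i11); last first.
    move=> W oW; have [_ -> _] := HL _ r01 => Wt.
    exists setT; first exact: filterT.
    by move=> r _ /HL[_ -> _].
  move=> s s01; have [N [oN Ns HN]] := covering_mapP cpi (H r0 s).
  have : nbhs (r0, s) ((fun p : R * R => H p.1 p.2) @^-1` N).
    by apply: Hc; exact: open_nbhs_nbhs.
  move=> [[I J] /= [nI nJ] IJ].
  have /nbhs_ballP[e /= e0 eJ] := nJ.
  exists (ball s e); first exact: nbhsx_ballx.
  move=> a b as_ bs a01 b01 Pa W oW WL.
  have inJ x : Num.min a b <= x <= Num.max a b -> J x.
    move=> xab; apply: eJ; move: as_ bs xab; rewrite -!ball_normE /= !ltr_norml.
    move=> /andP[a1 a2] /andP[a3 a4]; rewrite ge_min le_max => /andP[a5 a6].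
    by clear -a1 a2 a3 a4 a5 a6; apply/andP; split; case/orP: a5; case/orP: a6; lra.
  have in01 x : Num.min a b <= x <= Num.max a b -> 0 <= x <= 1.
    move: a01 b01 => /andP[a1 a2] /andP[a3 a4]; rewrite ge_min le_max => /andP[a5 a6].
    by clear -a1 a2 a3 a4 a5 a6; apply/andP; split; case/orP: a5; case/orP: a6; lra.
  have ma : Num.min a b <= a <= Num.max a b by rewrite ge_min lexx le_max lexx.
  have mb : Num.min a b <= b <= Num.max a b.
    by rewrite ge_min lexx orbT le_max lexx orbT.
  have NL r x : I r -> 0 <= r <= 1 -> Num.min a b <= x <= Num.max a b -> N (pi (L r x)).
    move=> Ir rr xab; have [_ _ ->] := HL _ rr; last exact: in01.
    exact: (IJ (r, x) (conj Ir (inJ _ xab))).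
  have Ir0 : I r0 by exact: nbhs_singleton.
  have [A [sig [AL sh]]] := HN _ (NL r0 a Ir0 r01 ma).
  have [oA oAc sP NP sigc] := sh.
  have [I1 nI1 I1P] := Pa A oA AL.
  have stay r : I r -> I1 r -> 0 <= r <= 1 -> A (L r b).
    move=> Ir I1r rr; apply: (@sheet_stay N A sig (L r) a b sh).
    - by have [] := HL _ rr.
    - by move=> x xab; exact: NL.
    - exact: I1P.
  have LE r : I r -> I1 r -> 0 <= r <= 1 -> L r b = sig (H r b).
    move=> Ir I1r rr; have [_ <-] := sP _ (stay _ Ir I1r rr).
    by have [_ _ ->] := HL _ rr.
  have sigHc : {for r0, continuous (fun r => sig (H r b))}.
    apply: (@continuous_comp _ _ _ (fun r => H r b) sig); last first.
      by apply: sigc; have [_ _ <-//] := HL _ r01; exact: NL.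
    apply: (@continuous_comp _ _ _ (fun r => (r, b)) (fun p : R * R => H p.1 p.2)).
      by apply: (@pair_continuous _ _ _ id (cst b)); [exact: cvg_id|exact: cst_continuous].
    exact: Hc.
  have I1r0 : I1 r0 by exact: nbhs_singleton.
  have : nbhs r0 ((fun r => sig (H r b)) @^-1` W).
    by apply: sigHc; rewrite -LE//; exact: open_nbhs_nbhs.
  move=> nW; exists (I `&` I1 `&` (fun r => sig (H r b)) @^-1` W).
    by apply: filterI => //; exact: filterI.
  by move=> r [[Ir I1r] /= Wr] rr; rewrite LE.
apply/esym; apply: (@segment_locally_constant R (fun r => L r 1 = L 0 1) 0 1 _ 0 1) => //.
move=> r0 r01; have [N [oN Nu HN]] := covering_mapP cpi u.
have piL r : 0 <= r <= 1 -> pi (L r 1) = u.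
  by move=> rr; have [_ _ ->//] := HL _ rr; exact: Hu.
have [A [sig [AL [oA _ sP _ _]]]] : exists A sig, A (L r0 1) /\ covering_sheet pi N A sig.
  by apply: HN; rewrite piL.
have [I nI IP] := key r0 r01 A oA AL.
have LE r : I r -> 0 <= r <= 1 -> L r 1 = sig u.
  by move=> Ir rr; have [_ <-] := sP _ (IP _ Ir rr); rewrite piL.
by exists I => // r r' Ir Ir' rr rr' <-; rewrite !LE.
Qed.

End Lifts.

Lemma simply_connected_path (A : topologicalType) : simply_connected R A ->
  forall x y : A, exists f : R -> A, [/\ continuous f, f 0 = x & f 1 = y].
Proof.
move=> [pc _] x y; have [f [fc f0 f1]] := pc x y.
exists (f \o clamp 0 1); split.
- exact: within_clamp_continuous.
- by rewrite /= clamp_id ?lexx ?ler01.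
- by rewrite /= clamp_id ?lexx ?ler01.
Qed.

(** The path gam1 followed by gam2 reversed is a loop. Contracting it with fixed ends deforms its
    lift to a constant one, so the lift of the loop closes up; its first half is the lift of gam1,
    and its second half traversed backwards is that of gam2. *)
Lemma simply_connected_lift (A M B : topologicalType) (p : A -> M) (q : B -> M)
    (gam1 gam2 : R -> A) (b : B) (f1 f2 : R -> B) :
  simply_connected R A -> continuous p -> covering_map q ->
  continuous gam1 -> continuous gam2 -> gam1 0 = gam2 0 -> gam1 1 = gam2 1 ->
  is_lift q (p \o gam1) b f1 -> is_lift q (p \o gam2) b f2 -> f1 1 = f2 1.
Proof.
move=> [_ sc] pc cq g1c g2c g0 g1 lf1 lf2.
pose ell (s : R) := if s <= 2^-1 then gam1 (2 * s) else gam2 (2 + - 2 * s).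
have h2 : 2 * 2^-1 = 1 :> R by rewrite divff.
have ellc : continuous ell.
  apply: (@paste_continuous R A (fun s => gam1 (2 * s)) (fun s => gam2 (2 + - 2 * s)) 2^-1).
  - move=> s; apply: (@continuous_comp R R _ (fun s => 2 * s) gam1); last exact: g1c.
    exact: mulrl_continuous.
  - move=> s; apply: (@continuous_comp R R _ (fun s => 2 + - 2 * s) gam2); last exact: g2c.
    exact: affine_continuous.
  - by rewrite h2 (_ : 2 + - 2 / 2 = 1)//; lra.
have ell0 : ell 0 = gam1 0 by rewrite /ell invr_ge0 ler0n mulr0.
have ell1 : ell 1 = gam1 0.
  rewrite /ell ifF; last by apply/negbTE; rewrite -ltNge; lra.
  by rewrite mulr1 subrr g0.
have [H [Hc H0 H1 Hends]] := sc ell (continuous_subspaceT ellc) (etrans ell0 (esym ell1)).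
pose K r s := p (H (clamp 0 1 r, clamp 0 1 s)).
have Kc : continuous (fun z : R * R => K z.1 z.2).
  move=> z; apply: (@continuous_comp _ _ _ (fun z : R * R => H (clamp 0 1 z.1, clamp 0 1 z.2)) p);
    last exact: pc.
  have /subspace_continuousP Hc' := Hc.
  have c01 (y : R * R) : (`[0, 1]%classic `*` `[0, 1]%classic) (clamp 0 1 y.1, clamp 0 1 y.2).
    by split; rewrite /= in_itv/=; exact: clamp_in.
  move=> W /(Hc' _ (c01 z)) /= nW.
  have cc : {for z, continuous (fun y : R * R => (clamp 0 1 y.1, clamp 0 1 y.2))}.
    apply: pair_continuous.
      by apply: (@continuous_comp _ _ _ fst (clamp 0 1)); [exact: cvg_fst|exact: clamp_continuous].
    by apply: (@continuous_comp _ _ _ snd (clamp 0 1)); [exact: cvg_snd|exact: clamp_continuous].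
  have nc : nbhs z ((fun y : R * R => (clamp 0 1 y.1, clamp 0 1 y.2)) @^-1`
      [set y | (`[0, 1]%classic `*` `[0, 1]%classic) y -> W (H y)]) by exact: cc nW.
  by apply: filterS nc => y /=; apply; exact: c01.
have b01 (s : R) : 0 <= clamp 0 1 s <= 1 by exact: clamp_in.
have i01 : 0 <= (0 : R) <= 1 by rewrite lexx ler01.
have i11 : 0 <= (1 : R) <= 1 by rewrite lexx ler01.
have [f1c f10 f1P] := lf1; have [f2c f20 f2P] := lf2.
have qb : q b = p (gam1 0) by rewrite -f10 f1P.
have /choice[L LP] r : exists f, is_lift q (K r) b f.
  apply: (lift_exists cq).
    move=> s; apply: (@continuous_comp _ _ _ (fun s => (r, s)) (fun z : R * R => K z.1 z.2)).
      by apply: pair_continuous; [exact: cst_continuous|exact: cvg_id].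
    exact: Kc.
  rewrite qb /K; congr (p _); rewrite (clamp_id i01).
  by have [-> _] := Hends _ (b01 r); rewrite ell0.
have LE : L 0 1 = L 1 1.
  apply: (homotopy_lift_endpoint cq Kc (u := p (gam1 0))).
    by move=> r _; exact: LP.
  move=> r rr; rewrite /K (clamp_id i11).
  by have [_ ->] := Hends _ (b01 r); rewrite ell0.
have L1 : L 1 1 = b.
  apply: (@is_lift_unique _ _ _ cq (K 1) b (L 1) (cst b)) => //.
  split=> //; first exact: cst_continuous.
  move=> s s01; rewrite /K (clamp_id i11) H1; last exact: b01.
  by rewrite ell0 qb.
have [L0c L00 L0P] := LP 0.
have L0P' s : 0 <= s <= 1 -> q (L 0 s) = p (ell s).
  move=> s01; rewrite L0P// /K (clamp_id i01) (clamp_id s01).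
  by rewrite H0.
have E1 : L 0 2^-1 = f1 1.
  have -> : 2^-1 = 2^-1 * 1 :> R by rewrite mulr1.
  apply: (@is_lift_unique _ _ _ cq (p \o gam1) b (fun s => L 0 (2^-1 * s)) f1) => //.
  split.
  - move=> s; apply: (@continuous_comp R R _ (fun s => 2^-1 * s) (L 0)); last exact: L0c.
    exact: mulrl_continuous.
  - by rewrite mulr0.
  - move=> s /andP[s0 s1]; rewrite L0P'; last by apply/andP; split; lra.
    by rewrite /ell ifT; [rewrite mulrA h2 mul1r|lra].
have E2 : L 0 2^-1 = f2 1.
  have -> : 2^-1 = 1 + - 2^-1 * 1 :> R by lra.
  apply: (@is_lift_unique _ _ _ cq (p \o gam2) b (fun s => L 0 (1 + - 2^-1 * s)) f2) => //.
  split.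
  - move=> s; apply: (@continuous_comp R R _ (fun s => 1 + - 2^-1 * s) (L 0)); last exact: L0c.
    exact: affine_continuous.
  - by rewrite mulr0 addr0 LE L1.
  - move=> s /andP[s0 s1]; rewrite L0P'; last by apply/andP; split; lra.
    rewrite /ell; case: ifP => [le|_]; last first.
      by congr (p (gam2 _)); lra.
    have -> : s = 1 by lra.
    by rewrite /= -g1 (_ : 2 * (1 + - 2^-1 * 1) = 1)//; lra.
by rewrite -E1 E2.
Qed.

(** The paths to nearby points have to stay in W; this yields the continuity of lifted maps. *)
Definition locally_path_connected (A : topologicalType) :=
  forall (a : A) (W : set A), nbhs a W -> exists2 V, nbhs a V & forall x, V x ->
    exists f : R -> A, [/\ continuous f, f 0 = a, f 1 = x &
      forall s, 0 <= s <= 1 -> W (f s)].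

Lemma concat_continuous (A : topologicalType) (f g : R -> A) :
  continuous f -> continuous g -> f 1 = g 0 -> exists h : R -> A, [/\ continuous h,
    forall s, 0 <= s <= 1 -> h (2^-1 * s) = f s &
    forall s, 0 <= s <= 1 -> h (2^-1 + 2^-1 * s) = g s].
Proof.
move=> fc gc fg.
exists (fun s => if s <= 2^-1 then f (2 * s) else g (-1 + 2 * s)); split.
- apply: (@paste_continuous R A (fun s => f (2 * s)) (fun s => g (-1 + 2 * s))).
  + move=> s; apply: (@continuous_comp R R _ (fun s => 2 * s) f); last exact: fc.
    exact: mulrl_continuous.
  + move=> s; apply: (@continuous_comp R R _ (fun s => -1 + 2 * s) g); last exact: gc.
    exact: affine_continuous.
  + by rewrite divff// addNr.
- by move=> s /andP[s0 s1]; rewrite mulrA divff// mul1r ifT//; lra.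
- move=> s /andP[s0 s1]; case: ifP => [le|_].
    have -> : s = 0 by lra.
    by rewrite mulr0 addr0 divff// fg addNr.
  by congr g; lra.
Qed.

(** A point x goes to the end of the lift of p along any path from a to x. Simple connectedness
    makes this independent of the path, and on a small neighbourhood the map is the section of a
    sheet composed with p. *)
Lemma covering_lift_map (A M B : topologicalType) (p : A -> M) (q : B -> M)
    (a : A) (b : B) :
  simply_connected R A -> locally_path_connected A -> continuous p ->
  covering_map q -> p a = q b ->
  exists F : A -> B, [/\ continuous F, F a = b & forall x, q (F x) = p x].
Proof.
move=> sc lpc pc cq pab.
have i01 : 0 <= (0 : R) <= 1 by rewrite lexx ler01.
have i11 : 0 <= (1 : R) <= 1 by rewrite lexx ler01.
have pgc (gam : R -> A) : continuous gam -> continuous (p \o gam).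
  by move=> gc s; apply: continuous_comp; [exact: gc|exact: pc].
have /choice[F FP] x : exists y, exists (gam : R -> A) (f : R -> B), [/\ continuous gam, gam 0 = a,
    gam 1 = x, is_lift q (p \o gam) b f & f 1 = y].
  have [gam [gc g0 g1]] := simply_connected_path sc a x.
  have [f fP] := lift_exists cq (pgc _ gc) (esym (etrans (congr1 p g0) pab)).
  by exists (f 1), gam, f.
have Funiq gam f : continuous gam -> gam 0 = a -> is_lift q (p \o gam) b f ->
    f 1 = F (gam 1).
  move=> gc g0 lf; have [gam' [f' [gc' g0' g1' lf' <-]]] := FP (gam 1).
  exact: (simply_connected_lift sc pc cq gc gc' (etrans g0 (esym g0')) (esym g1') lf lf').
have Fq x : q (F x) = p x.
  have [gam [f [gc g0 g1 [fc f0 fP] <-]]] := FP x.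
  by rewrite fP//= g1.
(* Paths that start elsewhere are reduced to paths from a by concatenation. *)
have Fpath gam f : continuous gam -> is_lift q (p \o gam) (F (gam 0)) f ->
    f 1 = F (gam 1).
  move=> gc lf; have [gam' [f' [gc' g0' g1' lf' f1']]] := FP (gam 0).
  have [fc f0 fP] := lf; have [fc' f0' fP'] := lf'.
  have [h [hc h1 h2]] := concat_continuous gc' gc g1'.
  have [k [kc k1 k2]] := concat_continuous fc' fc (etrans f1' (esym f0)).
  have h10 : h 1 = gam 1.
    by rewrite -h2//; congr h; lra.
  have k10 : k 1 = f 1.
    by rewrite -k2//; congr k; lra.
  rewrite -k10 -h10; apply: Funiq => //.
    by rewrite -[0](mulr0 2^-1) h1.
  split=> //; first by rewrite -[0](mulr0 2^-1) k1.
  move=> s /andP[s0 s1]; have [le|lt] := leP s 2^-1.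
    have -> : s = 2^-1 * (2 * s) by lra.
    have i : 0 <= 2 * s <= 1 by apply/andP; split; lra.
    by rewrite k1// fP'//= h1.
  have -> : s = 2^-1 + 2^-1 * (2 * s - 1) by lra.
  have i : 0 <= 2 * s - 1 <= 1 by apply/andP; split; lra.
  by rewrite k2// fP//= h2.
have Fa : F a = b.
  have -> : a = (cst a : R -> A) 1 by [].
  rewrite -(@Funiq (cst a) (cst b)) //; first exact: cst_continuous.
  by split=> //; exact: cst_continuous.
exists F; split=> // x.
have [N [oN Nx HN]] := covering_mapP cq (p x).
have [S [sig [SF [oS _ sP NP sigc]]]] : exists S sig, S (F x) /\ covering_sheet q N S sig.
  by apply: HN; rewrite Fq.
have nW : nbhs x (p @^-1` N) by apply: pc; exact: open_nbhs_nbhs.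
have [V nV VP] := lpc x _ nW.
(* Over N, the lift of a short path is its image under the section. *)
have FE y : V y -> F y = sig (p y).
  move=> Vy; have [gam [gc g0 g1 gN]] := VP _ Vy.
  pose f s := sig (p (gam (clamp 0 1 s))).
  have b01 (s : R) : 0 <= clamp 0 1 s <= 1 by exact: clamp_in.
  have -> : F y = F (gam 1) by rewrite g1.
  rewrite -(@Fpath gam f) //; first by rewrite /f clamp_id// g1.
  split.
  - move=> s; apply: (@continuous_comp _ _ _ (fun s => p (gam (clamp 0 1 s))) sig).
      apply: (@continuous_comp _ _ _ (clamp 0 1) (p \o gam)); first exact: clamp_continuous.
      exact: pgc.
    by apply: sigc; exact: gN.
  - by rewrite /f clamp_id// g0 -Fq; have [_ ->] := sP _ SF.
  - move=> s s01; rewrite /f; have [_ ->] := NP _ (gN _ (b01 s)).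
    by rewrite clamp_id.
have Fx : F x = sig (p x) by apply: FE; exact: (nbhs_singleton nV).
rewrite /continuous_at Fx.
have c : {for x, continuous (sig \o p)}.
  by apply: continuous_comp; [exact: pc|exact: sigc].
move=> W /= nWx; have n1 : nbhs x (V `&` (sig \o p) @^-1` W).
  by apply: filterI => //; exact: c.
by apply: filterS n1 => y [Vy /=]; rewrite FE.
Qed.

(** F lifts p through q and G lifts q through p. Each composite lifts a covering through itself and
    fixes a base point, so it is the identity by uniqueness along paths. *)
Lemma covering_lift_homeo (A M B : topologicalType) (p : A -> M) (q : B -> M) :
  simply_connected R A -> locally_path_connected A -> covering_map p ->
  simply_connected R B -> locally_path_connected B -> covering_map q ->
  forall a : A, exists F : A -> B, exists G : B -> A,
    [/\ cancel F G, cancel G F, continuous F, continuous G &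
      (forall x, q (F x) = p x) /\ forall y, p (G y) = q y].
Proof.
move=> scA lpA cp scB lpB cq a.
have [b qb] : exists b, q b = p a by case: cq.
have [F [Fc Fa qF]] := covering_lift_map scA lpA (covering_continuous cp) cq (esym qb).
have [G [Gc Gb pG]] := covering_lift_map scB lpB (covering_continuous cq) cp qb.
have i01 : 0 <= (0 : R) <= 1 by rewrite lexx ler01.
have i11 : 0 <= (1 : R) <= 1 by rewrite lexx ler01.
exists F, G; split=> //.
- move=> x; have [gam [gc g0 g1]] := simply_connected_path scA a x.
  rewrite -g1; apply: (@lift_unique _ _ _ cp (G \o F \o gam) gam 0 1 _ gc _ 0) => //.
  + move=> s; apply: continuous_comp; first exact: gc.
    by apply: continuous_comp; [exact: Fc|exact: Gc].
  + by move=> s _ /=; rewrite pG qF.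
  + by rewrite /= g0 Fa Gb.
- move=> x; have [gam [gc g0 g1]] := simply_connected_path scB b x.
  rewrite -g1; apply: (@lift_unique _ _ _ cq (F \o G \o gam) gam 0 1 _ gc _ 0) => //.
  + move=> s; apply: continuous_comp; first exact: gc.
    by apply: continuous_comp; [exact: Gc|exact: Fc].
  + by move=> s _ /=; rewrite qF pG.
  + by rewrite /= g0 Gb Fa.
Qed.

End Covering.

(** * Charts and smooth maps of manifolds *)

Section Charts.
Variables (R : realType) (n : nat) (M : topologicalType).
Implicit Types (c : chart R n M) (p : M).

Lemma near_chart c p (Q : set M) : chart_dom c p -> nbhs p Q ->
  \forall x \near chart_fun c p,
    [/\ chart_dom c (chart_inv c x), Q (chart_inv c x) &
        chart_fun c (chart_inv c x) = x].
Proof.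
move=> cp nQ.
have ip : (chart_fun c @` chart_dom c) (chart_fun c p) by exists p.
have n1 : nbhs (chart_fun c p) (chart_fun c @` chart_dom c).
  by apply: open_nbhs_nbhs; split=> //; exact: chart_img_open.
have n2 : nbhs (chart_fun c p) (chart_inv c @^-1` Q).
  by apply: chart_inv_continuous => //; rewrite chart_funK.
near=> x.
have [q cq qx] : (chart_fun c @` chart_dom c) x by near: x.
have Qx : Q (chart_inv c x) by near: x.
by split=> //; rewrite -qx chart_funK.
Unshelve. all: by end_near. Qed.

Lemma chart_image_open c (Q : set M) : open Q ->
  open (chart_fun c @` (chart_dom c `&` Q)).
Proof.
move=> oQ; rewrite openE => _ [p [cp Qp] <-].
have nQ : nbhs p Q by exact: open_nbhs_nbhs.
have := near_chart cp nQ; apply: filterS => x [cx Qx xE].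
by exists (chart_inv c x).
Qed.

End Charts.

Lemma manifold_locally_path_connected (R : realType) (n : nat)
  (M : manifold R n) : locally_path_connected R M.
Proof.
move=> a W nW; pose c := mf_chart a.
have ca : chart_dom c a by exact: mf_chart_dom.
have /nbhs_ballP[r /= r0 rP] := near_chart ca nW.
exists (chart_dom c `&` chart_fun c @^-1` ball (chart_fun c a) r).
  apply: filterI; first by apply: open_nbhs_nbhs; split=> //; exact: chart_dom_open.
  by apply: (chart_fun_continuous ca); exact: nbhsx_ballx.
move=> x [cx xr].
pose f s := chart_inv c (chart_fun c a + clamp 0 1 s *: (chart_fun c x - chart_fun c a)).
have inb s : ball (chart_fun c a) r
    (chart_fun c a + clamp 0 1 s *: (chart_fun c x - chart_fun c a)).
  by apply: segment_ball => //; [exact: ballxx|exact: clamp_in].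
exists f; split.
- move=> s; apply: (@continuous_comp _ _ _
    (fun s => chart_fun c a + clamp 0 1 s *: (chart_fun c x - chart_fun c a))).
    apply: (@continuous_comp _ _ _ (clamp 0 1)
      (fun s => chart_fun c a + s *: (chart_fun c x - chart_fun c a))).
      exact: clamp_continuous.
    exact: continuous_line.
  apply: chart_inv_continuous; have [h1 h2 h3] := rP _ (inb s).
  by rewrite -h3; exists (chart_inv c (chart_fun c a + clamp 0 1 s *: (chart_fun c x - chart_fun c a))).
- by rewrite /f clamp_id ?lexx ?ler01// scale0r addr0 chart_funK.
- by rewrite /f clamp_id ?lexx ?ler01// scale1r addrC subrK chart_funK.
- by move=> s _; have [] := rP _ (inb s).
Qed.

(* Unfolding these during unification makes failing rewrites diverge. *)
Local Opaque jacobian derive.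

Section SmoothMapsCharts.
Variable R : realType.

Section Two.
Variables (m n : nat) (M : manifold R m) (N : manifold R n).
Variables (F : M -> N).
Hypothesis sF : smooth_map F.

Lemma smooth_map_differentiable c d p : mf_atlas M c -> mf_atlas N d ->
  chart_dom c p -> chart_dom d (F p) ->
  differentiable (chart_fun d \o F \o chart_inv c) (chart_fun c p).
Proof.
move=> ac ad cp dF; apply: smooth_on_differentiable (sF.2 _ _ ac ad) _.
by exists p.
Qed.

End Two.

Lemma smooth_map_id n (M : manifold R n) : smooth_map (id : M -> M).
Proof.
split; first by move=> x; exact: cvg_id.
move=> c d ac ad; exact: mf_transition.
Qed.

(** The coordinate expression of G o F agrees with the composite of the two coordinate expressions
    near the point only, because charts and their inverses are meaningful on their domains and
    images only. *)
Lemma jacobian_chart_comp m n q (M : manifold R m) (N : manifold R n)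
    (P : manifold R q) (F : M -> N) (G : N -> P) c d e p :
  smooth_map F -> smooth_map G -> mf_atlas M c -> mf_atlas N d -> mf_atlas P e ->
  chart_dom c p -> chart_dom d (F p) -> chart_dom e (G (F p)) ->
  differentiable (chart_fun e \o (G \o F) \o chart_inv c) (chart_fun c p) /\
  jacobian (chart_fun e \o (G \o F) \o chart_inv c) (chart_fun c p) =
  jacobian (chart_fun d \o F \o chart_inv c) (chart_fun c p) *m
  jacobian (chart_fun e \o G \o chart_inv d) (chart_fun d (F p)).
Proof.
move=> sF sG ac ad ae cp dF eG.
have dfF := smooth_map_differentiable sF ac ad cp dF.
have dfG := smooth_map_differentiable sG ad ae dF eG.
have xE : (chart_fun d \o F \o chart_inv c) (chart_fun c p) = chart_fun d (F p).
  by rewrite /= chart_funK.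
have dG' : differentiable (chart_fun e \o G \o chart_inv d)
    ((chart_fun d \o F \o chart_inv c) (chart_fun c p)) by rewrite xE.
have dc := differentiable_comp dfF dG'.
have near_eq : {near chart_fun c p,
    (chart_fun e \o G \o chart_inv d) \o (chart_fun d \o F \o chart_inv c) =1
    chart_fun e \o (G \o F) \o chart_inv c}.
  have nd : nbhs p (F @^-1` chart_dom d).
    by apply: sF.1; apply: open_nbhs_nbhs; split=> //; exact: chart_dom_open.
  have := near_chart cp nd; apply: filterS => x [h1 h2 h3] /=.
  by rewrite chart_funK.
split; first exact: near_eq_differentiable near_eq dc.
apply: (etrans (esym (near_eq_jacobian near_eq dc))).
by rewrite (jacobian_comp dfF dG') xE.
Qed.

Lemma differential_comp m n q (M : manifold R m) (N : manifold R n)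
    (P : manifold R q) (F : M -> N) (G : N -> P) p :
  smooth_map F -> smooth_map G ->
  differential (G \o F) p = differential F p *m differential G (F p).
Proof.
move=> sF sG; rewrite /differential.
have [_ E] := jacobian_chart_comp sF sG (mf_chart_atlas p)
  (mf_chart_atlas (F p)) (mf_chart_atlas (G (F p))) (mf_chart_dom p)
  (mf_chart_dom (F p)) (mf_chart_dom (G (F p))).
exact: E.
Qed.

Lemma differential_chart m n (M : manifold R m) (N : manifold R n) (F : M -> N)
    c d p : smooth_map F -> mf_atlas M c -> mf_atlas N d ->
  chart_dom c p -> chart_dom d (F p) ->
  jacobian (chart_fun d \o F \o chart_inv c) (chart_fun c p) =
  jacobian (chart_fun (mf_chart p) \o chart_inv c) (chart_fun c p) *m
  differential F p *m
  jacobian (chart_fun d \o chart_inv (mf_chart (F p)))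
    (chart_fun (mf_chart (F p)) (F p)).
Proof.
move=> sF ac ad cp dF.
have acp := mf_chart_atlas p; have dcp := mf_chart_dom p.
have acF := mf_chart_atlas (F p); have dcF := mf_chart_dom (F p).
have [_ E1] := jacobian_chart_comp (smooth_map_id M) sF ac acp ad cp dcp dF.
have [_ E2] := jacobian_chart_comp sF (smooth_map_id N) acp acF ad dcp dcF dF.
by apply: (etrans E1); rewrite -mulmxA; congr (_ *m _); exact: E2.
Qed.

Lemma jacobian_transition n (M : manifold R n) c d p : mf_atlas M c ->
  mf_atlas M d -> chart_dom c p -> chart_dom d p ->
  jacobian (chart_fun d \o chart_inv c) (chart_fun c p) *m
  jacobian (chart_fun c \o chart_inv d) (chart_fun d p) = 1%:M.
Proof.
move=> ac ad cp dp.
have sid := smooth_map_id M.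
have [_ <-] := jacobian_chart_comp sid sid ac ad ac cp dp cp.
have dI : differentiable (id : 'rV[R]_n -> 'rV[R]_n) (chart_fun c p) by exact: ex_diff.
rewrite -(jacobian_id (chart_fun c p)); apply/esym/near_eq_jacobian => //.
have : \forall x \near chart_fun c p, [/\ chart_dom c (chart_inv c x), setT (chart_inv c x) &
        chart_fun c (chart_inv c x) = x].
  by apply: near_chart => //; exact: filterT.
by apply: filterS => x [_ _ /= ->].
Qed.

Lemma jacobian_transition_unit n (M : manifold R n) c d p : mf_atlas M c ->
  mf_atlas M d -> chart_dom c p -> chart_dom d p ->
  jacobian (chart_fun d \o chart_inv c) (chart_fun c p) \in unitmx.
Proof.
move=> ac ad cp dp.
exact: (mulmx1_unit (jacobian_transition ac ad cp dp)).1.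
Qed.

Lemma jacobian_chart_unit n (M N : manifold R n) (F : M -> N) c d p :
  smooth_map F -> mf_atlas M c -> mf_atlas N d -> chart_dom c p ->
  chart_dom d (F p) -> differential F p \in unitmx ->
  jacobian (chart_fun d \o F \o chart_inv c) (chart_fun c p) \in unitmx.
Proof.
move=> sF ac ad cp dF u; rewrite (differential_chart sF ac ad cp dF).
have mul3 (X Y Z : 'M[R]_n) : X \in unitmx -> Y \in unitmx -> Z \in unitmx ->
    X *m Y *m Z \in unitmx by move=> x y z; rewrite !unitmx_mul x y z.
apply: (mul3 _ _ _ _ u).
  exact: jacobian_transition_unit ac (mf_chart_atlas p) cp (mf_chart_dom p).
exact: jacobian_transition_unit (mf_chart_atlas _) ad (mf_chart_dom _) dF.
Qed.

(** In charts, q o F = p is smooth and the Jacobian of q is invertible, so [smooth_lift] applies. *)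
Lemma smooth_map_lift n (A B M : manifold R n) (p : A -> M) (q : B -> M)
    (F : A -> B) : smooth_map p -> smooth_map q ->
  (forall b, differential q b \in unitmx) -> continuous F ->
  (forall a, q (F a) = p a) -> smooth_map F.
Proof.
move=> sp sq qu Fc qF; split=> // c d ac ad k.
apply: Ck_on_local => _ [a [ca da] <-].
pose e := mf_chart (p a).
have ea : chart_dom e (p a) by exact: mf_chart_dom.
have ae : mf_atlas M e by exact: mf_chart_atlas.
pose O1 := F @^-1` chart_dom d `&` p @^-1` chart_dom e.
have oO1 : open O1.
  by apply: openI; apply: open_comp; try exact: chart_dom_open;
    move=> ? _; first [exact: Fc|exact: sp.1].
pose D := chart_fun c @` (chart_dom c `&` O1).
pose D' := chart_fun d @` (chart_dom d `&` q @^-1` chart_dom e).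
have oq : open (q @^-1` chart_dom e).
  by apply: open_comp; [move=> ? _; exact: sq.1|exact: chart_dom_open].
exists D; first by exists a.
apply: (@smooth_lift R _ n D D' (chart_fun d \o F \o chart_inv c)
  (chart_fun e \o q \o chart_inv d)).
- exact: chart_image_open.
- exact: chart_image_open.
- move=> _ [x [cx [dx ex]] <-]; exists (F x); last by rewrite /= chart_funK.
  by split=> //; rewrite /preimage/= qF.
- move=> _ [x [cx [dx ex]] <-].
  apply: continuous_comp; first by apply: chart_inv_continuous; exists x.
  rewrite (chart_funK cx); exact: (continuous_comp (Fc x) (chart_fun_continuous dx)).
- move=> _ [x [dx ex] <-]; exact: jacobian_chart_unit.
- move=> j; apply: Ck_on_sub (sq.2 _ _ ad ae j).
  by move=> _ [x [dx ex] <-]; exists x.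
- move=> j; apply: (@Ck_on_congr _ _ _ _ _ (chart_fun e \o p \o chart_inv c)).
  + exact: chart_image_open.
  + move=> x; rewrite inE => -[y [cy [dy ey]] <-] /=.
    by rewrite !chart_funK// qF.
  + apply: Ck_on_sub (sp.2 _ _ ac ae j).
    by move=> _ [x [cx [dx ex]] <-]; exists x.
Qed.

(** A nonzero vector killed by the differential would have length zero. *)
Lemma pullback_unit n (M N : riemannian R n) (F : M -> N) p :
  pullback_metric F p = rm_metric p -> differential F p \in unitmx.
Proof.
move=> E; rewrite -row_free_unit; apply/row_freeP.
have nz (v : 'rV[R]_n) : v *m differential F p = 0 -> v = 0.
  move=> vJ; apply/eqP/negPn/negP => v0; have := rm_pos p v0.
  by rewrite -E /pullback_metric !mulmxA vJ !mul0mx mxE ltxx.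
by apply/row_freeP/inj_row_free.
Qed.

Lemma isometric_lift n (A B M : riemannian R n) (p : A -> M) (q : B -> M)
    (F : A -> B) : smooth_map p -> smooth_map q ->
  (forall x, pullback_metric p x = rm_metric x) ->
  (forall x, pullback_metric q x = rm_metric x) -> continuous F ->
  (forall a, q (F a) = p a) ->
  smooth_map F /\ forall x, pullback_metric F x = rm_metric x.
Proof.
move=> sp sq ip iq Fc qF.
have sF : smooth_map F.
  by apply: (smooth_map_lift sp sq) => // b; exact: pullback_unit.
split; first exact: sF.
move=> x; apply: (etrans _ (ip x)).
have E : differential p x = differential F x *m differential q (F x).
  rewrite -(differential_comp x sF sq); congr (differential _ x).
  by apply/funext => y; exact/esym/qF.
transitivity (differential F x *m pullback_metric q (F x) *m (differential F x)^T).
  by rewrite iq.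
rewrite /pullback_metric E trmx_mul !mulmxA.
by congr (_ *m _ *m _ *m _ *m _); exact: congr1 (qF x).
Qed.

(** The lift of one covering through the other is a homeomorphism and inherits smoothness and
    isometry from the two coverings; a is the base point at which lifting starts. *)
Lemma riemannian_covering_isometry n (A B M : riemannian R n) (p : A -> M)
    (q : B -> M) (a : A) : riemannian_universal_covering p ->
  riemannian_universal_covering q ->
  exists F : A -> B, diffeomorphism F /\ forall x, pullback_metric F x = rm_metric x.
Proof.
move=> [scA cp sp ip] [scB cq sq iq].
have [F [G [FK GK Fc Gc [qF pG]]]] := covering_lift_homeo scA
  (@manifold_locally_path_connected R n A) cp scB
  (@manifold_locally_path_connected R n B) cq a.
have [sF iF] := isometric_lift sp sq ip iq Fc qF.
have [sG iG] := isometric_lift sq sp iq ip Gc pG.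
by exists F; split=> //; exists G.
Qed.

End SmoothMapsCharts.

(** * Lie brackets and primitives in a frame *)

Section Frames.
Variable R : realType.

Lemma derive_mulmx (V : normedModType R) m n p (A : V -> 'M[R]_(m, n))
    (B : V -> 'M[R]_(n, p)) x v : differentiable A x -> differentiable B x ->
  differentiable (fun y => A y *m B y) x /\
  'D_v (fun y => A y *m B y) x = 'D_v A x *m B x + A x *m 'D_v B x.
Proof.
move=> dA dB.
have E i j : (fun y => (A y *m B y) i j) =
    \sum_(k < n) ((fun y => A y i k) * (fun y => B y k j)).
  by apply/funext => y; rewrite mxE fct_sumE.
have dAe i k : differentiable (fun y => A y i k) x by exact: differentiable_entry.
have dBe k j : differentiable (fun y => B y k j) x by exact: differentiable_entry.
have d : differentiable (fun y => A y *m B y) x.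
  apply: differentiable_mx => i j; rewrite E.
  by apply: differentiable_sum => k; exact: differentiableM.
split=> //; apply/matrixP => i j.
rewrite (derive_entry v i j d) E derive_sum; last first.
  by move=> k; apply: diff_derivable; exact: differentiableM.
rewrite mxE [X in X + _]mxE [X in _ + X]mxE -big_split/=.
apply: eq_bigr => k _.
rewrite deriveM; [|exact: diff_derivable..].
rewrite (derive_entry v i k dA) (derive_entry v k j dB) addrC.
by congr (_ + _); exact: mulrC.
Qed.

(** Differentiating the relations between psi-related fields produces the second derivative of psi
    on (X, Y) in one term and on (Y, X) in the other; by symmetry they cancel. *)
Lemma bracket_natural n (D : set 'rV[R]_n) (psi X Y X' Y' : 'rV[R]_n -> 'rV[R]_n) x :
  open D -> D x -> Ck_on 2 D psi -> differentiable X x -> differentiable Y x ->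
  differentiable X' (psi x) -> differentiable Y' (psi x) ->
  (forall y, D y -> X' (psi y) = X y *m jacobian psi y) ->
  (forall y, D y -> Y' (psi y) = Y y *m jacobian psi y) ->
  'D_(X' (psi x)) Y' (psi x) - 'D_(Y' (psi x)) X' (psi x) =
  ('D_(X x) Y x - 'D_(Y x) X x) *m jacobian psi x.
Proof.
move=> oD Dx c2 dX dY dX' dY' XE YE.
have nD : nbhs x D by exact: open_nbhs_nbhs.
have dpsi y : D y -> differentiable psi y by exact: c2.1.
have dJ : differentiable (jacobian psi) x by exact: (Ck_on_jacobian oD c2).1.
have half (Z Z' : 'rV[R]_n -> 'rV[R]_n) v : differentiable Z x -> differentiable Z' (psi x) ->
    (forall y, D y -> Z' (psi y) = Z y *m jacobian psi y) ->
    'D_(v *m jacobian psi x) Z' (psi x) =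
    'D_v Z x *m jacobian psi x + Z x *m 'D_v (jacobian psi) x.
  move=> dZ dZ' ZE.
  have [_ <-] := derive_mulmx v dZ dJ.
  rewrite -deriveEjacobian; last exact: dpsi.
  rewrite -(derive_comp v (dpsi _ Dx) dZ').
  by apply: near_eq_derive; apply: filterS nD => y /ZE.
have hess (v w : 'rV[R]_n) j : (w *m 'D_v (jacobian psi) x) 0 j =
    'D_w ('D_v (fun y => psi y 0 j)) x.
  have c2j : Ck_on 2 D (fun y => psi y 0 j) by exact: Ck_on_entry.
  have dvj : differentiable ('D_v (fun y => psi y 0 j)) x by exact: (c2j.2 v).1.
  rewrite (derive_row_sum w dvj) mxE; apply: eq_bigr => k _; congr (_ * _).
  rewrite (derive_entry v k j dJ) -(schwarz _ _ oD Dx c2j).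
  apply: near_eq_derive; apply: filterS nD => y Dy.
  by rewrite jacobian_entry//; exact: dpsi.
have sym : Y x *m 'D_(X x) (jacobian psi) x = X x *m 'D_(Y x) (jacobian psi) x.
  apply/rowP => j; apply: (etrans (hess _ _ j)).
  apply: etrans (esym (hess _ _ j)).
  apply: (schwarz _ _ oD Dx); exact: Ck_on_entry.
rewrite (XE x Dx) (YE x Dx) (half Y Y' (X x) dY dY' YE) (half X X' (Y x) dX dX' XE).
rewrite sym mulmxBl; move: (_ *m 'D_(Y x) _ x) => u.
move: ('D_(X x) Y x *m _) ('D_(Y x) X x *m _) => v w.
by rewrite opprD addrACA subrr addr0.
Qed.

(** The functions a i are the values on the frame of a one-form alpha, and C holds the structure
    constants of the frame. By d alpha(X, Y) = X alpha(Y) - Y alpha(X) - alpha([X, Y]) the last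
    hypothesis says that alpha is closed, so the Poincaré lemma integrates it. *)
Lemma frame_primitive n (D : set 'rV[R]_n) x0 (U : 'I_n -> 'rV[R]_n -> 'rV[R]_n)
    (a : 'I_n -> 'rV[R]_n -> R) (C : 'I_n -> 'I_n -> 'I_n -> R) :
  open D -> D x0 -> (forall i, smooth_on D (U i)) ->
  (forall x, D x -> \matrix_i U i x \in unitmx) ->
  (forall i, smooth_on D (a i)) ->
  (forall x i j, D x -> 'D_(U i x) (U j) x - 'D_(U j x) (U i) x =
     \sum_k C i j k *: U k x) ->
  (forall x i j, D x -> 'D_(U i x) (a j) x - 'D_(U j x) (a i) x =
     \sum_k C i j k * a k x) ->
  exists r : R, exists f : 'rV[R]_n -> R, [/\ 0 < r, ball x0 r `<=` D,
    smooth_on (ball x0 r) f, f x0 = 0 &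
    forall x i, ball x0 r x -> 'D_(U i x) f x = a i x].
Proof.
move=> oD Dx0 sU Wu sa bU ba.
pose W x : 'M[R]_n := \matrix_i U i x.
(* The coordinate components of alpha, recovered from its values on the frame. *)
pose al x : 'cV[R]_n := invmx (W x) *m \col_i a i x.
have sW k : Ck_on k D W.
  apply: Ck_on_mx => // i j.
  under [fun _ => _]funext do rewrite mxE.
  exact: Ck_on_entry (sU i k).
have sal k : Ck_on k D al.
  apply: Ck_on_mulmx => //; first exact: Ck_on_invmx.
  apply: Ck_on_mx => // i j.
  by under [fun _ => _]funext do rewrite mxE; exact: sa.
have Ual x : D x -> forall j, U j x *m al x = (a j x)%:M.
  move=> Dx j; have : W x *m al x = \col_i a i x by rewrite mulKVmx//; exact: Wu.
  move=> /row_matrixP/(_ j); rewrite row_mul rowK => ->.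
  by apply/matrixP => p q; rewrite !mxE !ord1 eqxx mulr1n.
have dU j x : D x -> differentiable (U j) x by exact: (sU j 1%N).1.
have dal x : D x -> differentiable al x by exact: (sal 1%N).1.
pose w i x : R := al x i 0.
have sw i k : Ck_on k D (w i) by exact: Ck_on_entry.
have closed i j x : D x -> 'D_('e_i) (w j) x = 'D_('e_j) (w i) x.
  move=> Dx; pose G : 'M[R]_n := \matrix_(k, l) 'D_('e_k) (w l) x.
  have DG (v w' : 'rV[R]_n) : (w' *m 'D_v al x) = v *m G *m w'^T.
    apply/matrixP => p q; rewrite !ord1 {p q} [RHS]mxE mxE; apply: eq_bigr => l _.
    rewrite (derive_entry v l 0 (dal _ Dx)) [w'^T _ _]mxE mulrC; congr (_ * _).
    have dw : differentiable (w l) x by exact: (sw l 1%N).1.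
    rewrite (derive_row_sum v dw) mxE; apply: eq_bigr => k _.
    by rewrite mxE.
  (* The antisymmetrized derivative of alpha vanishes on all pairs of frame vectors, and therefore
     altogether. *)
  have sym i' j' : U i' x *m (G - G^T) *m (U j' x)^T = 0.
    have nDx : nbhs x D by exact: open_nbhs_nbhs.
    have H (v : 'rV[R]_n) k : ('D_v (a k) x)%:M = 'D_v (U k) x *m al x + U k x *m 'D_v al x.
      have [d <-] := derive_mulmx v (dU k _ Dx) (dal _ Dx).
      apply/matrixP => p q; rewrite !ord1 {p q} (derive_entry v 0 0 d) mxE eqxx mulr1n.
      apply: near_eq_derive; apply: filterS nDx => y Dy.
      by rewrite Ual// mxE eqxx mulr1n.
    have E : ('D_(U i' x) (a j') x - 'D_(U j' x) (a i') x)%:M =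
        ('D_(U i' x) (U j') x - 'D_(U j' x) (U i') x) *m al x.
      rewrite ba// bU// mulmx_suml raddf_sum; apply: eq_bigr => k _.
      by rewrite -scalemxAl Ual// scale_scalar_mx.
    rewrite raddfB/= !H mulmxBl opprD addrACA in E.
    move: E => /(canRL (addKr _)); rewrite addNr => E.
    move: E; rewrite !DG => E.
    rewrite mulmxBr mulmxBl -E; congr (_ - _).
    have tr11 (A : 'M[R]_1) : A^T = A by apply/matrixP => p q; rewrite mxE !ord1.
    by rewrite -[RHS]tr11 !trmx_mul trmxK mulmxA.
  have WGW : W x *m (G - G^T) *m (W x)^T = 0.
    apply/matrixP => p q; rewrite [RHS]mxE.
    transitivity ((U p x *m (G - G^T) *m (U q x)^T) 0 0); last by rewrite sym mxE.
    rewrite mxE [RHS]mxE; apply: eq_bigr => k _.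
    rewrite [(W x)^T _ _]mxE [(U q x)^T _ _]mxE [W x q k]mxE; congr (_ * _).
    by rewrite mxE [RHS]mxE; apply: eq_bigr => l _; rewrite [W x p l]mxE.
  have : G - G^T = 0.
    have Wxu : W x \in unitmx by exact: Wu.
    have WTu : (W x)^T \in unitmx by rewrite unitmx_tr.
    rewrite -[G - G^T](mulKmx Wxu) -[W x *m _](mulmxK WTu).
    by rewrite WGW mul0mx mulmx0.
  by move=> /subr0_eq/matrixP/(_ i j); rewrite !mxE.
have [r [f [r0 rD fP]]] := poincare oD Dx0 (fun i => sw i 1%N) closed.
have ob : open (ball x0 r : set 'rV[R]_n) by exact: ball_open.
have df x v : ball x0 r x -> 'D_v f x = \sum_i v 0 i * w i x.
  by move=> xr; have [d dE] := fP x xr; rewrite deriveE// dE.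
have sf k : Ck_on k (ball x0 r) f.
  elim: k => [|k _]; first by move=> x /fP[/differentiable_continuous].
  split=> [x /fP[]//|v].
  apply: (@Ck_on_congr _ _ _ _ _ (fun x => \sum_i v 0 i * w i x)) => //.
    by move=> x; rewrite inE => /df ->.
  apply: Ck_on_sum => // i; apply: Ck_onM => //; first exact: Ck_on_cst.
  exact: Ck_on_sub rD (sw i k).
exists r, (fun x => f x - f x0); split=> //.
- by move=> k; apply: Ck_onB => //; exact: Ck_on_cst.
- by rewrite subrr.
- move=> x i xr; have [dfx _] := fP x xr.
  have -> : (fun y => f y - f x0) = f - cst (f x0) by [].
  rewrite deriveB; [|exact: diff_derivable|exact: derivable_cst].
  rewrite derive_cst subr0 df//.
  have := Ual _ (rD _ xr) i => /matrixP/(_ 0 0); rewrite !mxE eqxx mulr1n => <-.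
  by apply: eq_bigr => k _.
Qed.

End Frames.

(** * Twisted coordinates in dimension four *)

Section Four.
Variable R : realType.

Lemma ord4P (P : 'I_4 -> Prop) : P 0 -> P 1 -> P 2 -> P 3 -> forall i, P i.
Proof.
move=> P0 P1 P2 P3 [[|[|[|[|//]]]] h].
- by rewrite (_ : Ordinal h = 0)//; exact/val_inj.
- by rewrite (_ : Ordinal h = 1)//; exact/val_inj.
- by rewrite (_ : Ordinal h = 2)//; exact/val_inj.
- by rewrite (_ : Ordinal h = 3)//; exact/val_inj.
Qed.

Lemma ord4_neq0 (P : 'I_4 -> Prop) : P 1 -> P 2 -> P 3 -> forall i, i != 0 -> P i.
Proof. by move=> P1 P2 P3; apply: ord4P. Qed.

Lemma sum4 (V : nmodType) (F : 'I_4 -> V) : \sum_i F i = F 0 + F 1 + F 2 + F 3.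
Proof.
rewrite !big_ord_recl big_ord0 addr0 !addrA.
by congr (F _ + F _ + F _ + F _); exact/val_inj.
Qed.

Lemma row4E (a b c d : R) : (row4 a b c d 0 0 = a) * (row4 a b c d 0 1 = b) *
  (row4 a b c d 0 2 = c) * (row4 a b c d 0 3 = d).
Proof. by rewrite !mxE. Qed.

Lemma row4_eta (v : 'rV[R]_4) : v = row4 (v 0 0) (v 0 1) (v 0 2) (v 0 3).
Proof. by apply/rowP; apply: ord4P; rewrite row4E. Qed.

Definition rows4 (u v w z : 'rV[R]_4) : 'M[R]_4 :=
  \matrix_(i < 4) [:: u; v; w; z]`_i.

Lemma rows4E (u v w z : 'rV[R]_4) j : (rows4 u v w z 0 j = u 0 j) *
  (rows4 u v w z 1 j = v 0 j) * (rows4 u v w z 2 j = w 0 j) *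
  (rows4 u v w z 3 j = z 0 j).
Proof. by rewrite !mxE. Qed.

Lemma derive_comp_real (V : normedModType R) (f : V -> R) (h : R -> R) x v dh :
  differentiable f x -> is_derive (f x) 1 h dh ->
  'D_v (h \o f) x = dh * 'D_v f x.
Proof.
move=> df [/derivable1_diffP hd hE].
rewrite deriveE; last exact: differentiable_comp.
rewrite diff_comp// diff1E//= -deriveE//.
by rewrite derive1E hE mulrC.
Qed.

(* Right multiplication by [twist be t] maps (s, xi, eta + i zeta) to
   (s, e^(t/2) xi, e^(-t/2) e^(-i be t) (eta + i zeta)). *)
Definition twist (be t : R) : 'M[R]_4 :=
  rows4 (row4 1 0 0 0) (row4 0 (expR (t / 2)) 0 0)
   (row4 0 0 (expR (- (t / 2)) * cos (be * t)) (- (expR (- (t / 2)) * sin (be * t))))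
   (row4 0 0 (expR (- (t / 2)) * sin (be * t)) (expR (- (t / 2)) * cos (be * t))).

(** The generator of the one-parameter group t |-> twist be t. *)
Definition twist_gen (be : R) : 'M[R]_4 :=
  rows4 0 (row4 0 2^-1 0 0) (row4 0 0 (- 2^-1) (- be)) (row4 0 0 be (- 2^-1)).

Lemma mul_twist be t (v : 'rV[R]_4) : v *m twist be t =
  row4 (v 0 0) (expR (t / 2) * v 0 1)
    (expR (- (t / 2)) * (cos (be * t) * v 0 2 + sin (be * t) * v 0 3))
    (expR (- (t / 2)) * (cos (be * t) * v 0 3 - sin (be * t) * v 0 2)).
Proof.
by apply/rowP; apply: ord4P; rewrite mxE sum4 !rows4E !row4E; ring.
Qed.

Lemma twist0 be : twist be 0 = 1%:M.
Proof.
apply/row_matrixP => i; rewrite !rowE mulmx1 mul_twist.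
rewrite mulr0 mul0r oppr0 expR0 cos0 sin0 !mul1r !mul0r addr0 subr0.
by rewrite -row4_eta.
Qed.

Lemma twistD be s t : twist be (s + t) = twist be s *m twist be t.
Proof.
apply/row_matrixP => i; rewrite !rowE mulmxA !mul_twist !row4E.
have -> : - ((s + t) / 2) = - (s / 2) + - (t / 2) by lra.
rewrite (mulrDl s t) (mulrDr be) !expRD cosD sinD.
by apply/rowP; apply: ord4P; rewrite !row4E; ring.
Qed.

Lemma twist_unit be t : twist be t \in unitmx.
Proof.
have : twist be t *m twist be (- t) = 1%:M by rewrite -twistD subrr twist0.
by move=> /mulmx1_unit[].
Qed.

Lemma is_derive_twist (be t : R) i j :
  is_derive t 1 (fun s => twist be s i j) ((twist_gen be *m twist be t) i j).
Proof.
have dexp (c : R) : is_derive t 1 (fun s => expR (c * s)) (c * expR (c * t)).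
  have d1 : is_derive t 1 (fun s : R => c * s) c.
    by apply: is_derive_eq; rewrite /GRing.scale/=; ring.
  by apply: is_derive_eq; rewrite mulrC.
have dcos : is_derive t 1 (fun s => cos (be * s)) (- be * sin (be * t)).
  have d1 : is_derive t 1 (fun s : R => be * s) be.
    by apply: is_derive_eq; rewrite /GRing.scale/=; ring.
  by apply: is_derive_eq; rewrite /GRing.scale/=; ring.
have dsin : is_derive t 1 (fun s => sin (be * s)) (be * cos (be * t)).
  have d1 : is_derive t 1 (fun s : R => be * s) be.
    by apply: is_derive_eq; rewrite /GRing.scale/=; ring.
  by apply: is_derive_eq; rewrite /GRing.scale/=; ring.
have E1 : (fun s : R => expR (s / 2)) = (fun s => expR (2^-1 * s)).
  by apply/funext => s; rewrite mulrC.
have E2 : (fun s : R => expR (- (s / 2))) = (fun s => expR (- 2^-1 * s)).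
  by apply/funext => s; rewrite mulNr mulrC.
have e1 : is_derive t 1 (fun s : R => expR (s / 2)) (2^-1 * expR (t / 2)).
  by rewrite E1 [t / 2]mulrC; exact: dexp.
have e2 : is_derive t 1 (fun s : R => expR (- (s / 2))) (- 2^-1 * expR (- (t / 2))).
  by rewrite E2 [t / 2]mulrC -mulNr; exact: dexp.
have c0 (c : R) : is_derive t 1 (fun=> c : R) 0 by exact: is_derive_cst.
have prod (f g : R -> R) df dg : is_derive t 1 f df -> is_derive t 1 g dg ->
    is_derive t 1 (fun s => f s * g s) (df * g t + f t * dg).
  move=> hf hg; have := is_deriveM hf hg.
  by move=> h; apply: (is_derive_eq h); rewrite /GRing.scale/= addrC mulrC.
have opp (f : R -> R) df : is_derive t 1 f df -> is_derive t 1 (fun s => - f s) (- df).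
  by move=> hf; exact: is_deriveN hf.
have e2c := prod _ _ _ _ e2 dcos; have e2s := prod _ _ _ _ e2 dsin.
have fold i' j' F : (fun s => twist be s i' j') = F ->
    (exists2 dF, is_derive t 1 F dF & dF = (twist_gen be *m twist be t) i' j') ->
    is_derive t 1 (fun s => twist be s i' j') ((twist_gen be *m twist be t) i' j').
  by move=> -> [dF + <-].
move: i j; apply: ord4P; apply: ord4P;
  (apply: fold; [by apply/funext => s; rewrite /twist !rows4E !row4E; reflexivity
   | eexists; [by first [exact: is_derive_cst | exact: e1 | exact: e2c | exact: e2s | exact: opp e2s]
   | by rewrite mxE sum4 /twist_gen /twist !rows4E !row4E ?mxE; ring]]).
Qed.

(** The coefficient of u k in [u i, u j] when be = b / (2a): up to the factor 2a, u 0 acts on the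
    span of the others by [twist_gen], and these commute. *)
Definition twist_struct (a be : R) (i j k : 'I_4) : R :=
  2 * a * ((i == 0)%:R * twist_gen be j k - (j == 0)%:R * twist_gen be i k).

Lemma bracket_table (a b : R) (u : 'I_4 -> 'rV[R]_4) (br : 'I_4 -> 'I_4 -> 'rV[R]_4) :
  a != 0 -> (forall i j, br i j = - br j i) ->
  [/\ br 0 1 = a *: u 1, br 0 2 = - a *: u 2 - b *: u 3,
      br 0 3 = b *: u 2 - a *: u 3 &
      [/\ br 1 2 = 0, br 1 3 = 0 & br 2 3 = 0]] ->
  forall i j, br i j = \sum_k twist_struct a (b / (2 * a)) i j k *: u k.
Proof.
move=> a0 skew [b01 b02 b03 [b12 b13 b23]].
have b00 i : br i i = 0.
  apply/rowP => k; have := skew i i => /rowP/(_ k); rewrite !mxE; lra.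
have z0 k : (0 : 'rV[R]_4) 0 k = 0 by rewrite mxE.
have addE (v w : 'rV[R]_4) k : (v + w) 0 k = v 0 k + w 0 k by rewrite mxE.
have oppE (v : 'rV[R]_4) k : (- v) 0 k = - v 0 k by rewrite mxE.
have scaleE c (v : 'rV[R]_4) k : (c *: v) 0 k = c * v 0 k by rewrite mxE.
apply: ord4P; apply: ord4P; rewrite sum4 /twist_struct /twist_gen;
  rewrite ?b00 ?b01 ?b02 ?b03 ?b12 ?b13 ?b23 ?(skew 1 0) ?(skew 2 0) ?(skew 3 0)
    ?(skew 2 1) ?(skew 3 1) ?(skew 3 2) ?b01 ?b02 ?b03 ?b12 ?b13 ?b23;
  apply/rowP => l; rewrite !rows4E ?row4E ?z0 /= !(addE, oppE, scaleE, z0);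
  by first [ring|field].
Qed.

(** The components of psi are primitives of one-forms whose values on the frame are the entries of
    2a times [twist] at the first component t. They are closed because the derivative of [twist] is
    [twist_gen] times [twist] and [twist_gen] also gives the structure constants. As t enters the
    other forms, it has to be found before them. *)
Lemma frame_development (a b : R) (D : set 'rV[R]_4) (x0 : 'rV[R]_4)
    (U : 'I_4 -> 'rV[R]_4 -> 'rV[R]_4) :
  a != 0 -> open D -> D x0 -> (forall i, smooth_on D (U i)) ->
  (forall x, D x -> \matrix_i U i x \in unitmx) ->
  (forall x, D x ->
     let br i j := 'D_(U i x) (U j) x - 'D_(U j x) (U i) x in
     [/\ br 0 1 = a *: U 1 x, br 0 2 = - a *: U 2 x - b *: U 3 x,
         br 0 3 = b *: U 2 x - a *: U 3 x &
         [/\ br 1 2 = 0, br 1 3 = 0 & br 2 3 = 0]]) ->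
  exists r : R, exists psi : 'rV[R]_4 -> 'rV[R]_4,
    [/\ 0 < r, ball x0 r `<=` D, smooth_on (ball x0 r) psi, psi x0 = 0 &
    forall x, ball x0 r x -> (\matrix_i U i x) *m jacobian psi x =
       (2 * a) *: twist (b / (2 * a)) (psi x 0 0)].
Proof.
move=> a0 oD Dx0 sU Wu hbr.
pose be := b / (2 * a).
pose C := twist_struct a be.
have bU x i j : D x -> 'D_(U i x) (U j) x - 'D_(U j x) (U i) x = \sum_k C i j k *: U k x.
  move=> /hbr h; apply: (bracket_table (br := fun i j => 'D_(U i x) (U j) x - 'D_(U j x) (U i) x)
    (u := fun k => U k x) a0 _ h) => i' j'.
  by rewrite opprB.
have prim (t : 'rV[R]_4 -> R) (D' : set 'rV[R]_4) j : open D' -> D' x0 -> D' `<=` D ->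
    smooth_on D' t -> (forall x i, D' x -> 'D_(U i x) t x = 2 * a * (i == 0)%:R) ->
    exists r : R, exists f : 'rV[R]_4 -> R, [/\ 0 < r, ball x0 r `<=` D',
      smooth_on (ball x0 r) f, f x0 = 0 &
      forall x i, ball x0 r x -> 'D_(U i x) f x = 2 * a * twist be (t x) i j].
  move=> oD' Dx0' DD' st tE.
  apply: (@frame_primitive R 4 D' x0 U (fun i x => 2 * a * twist be (t x) i j) C) => //.
  - by move=> i k; exact: Ck_on_sub DD' (sU i k).
  - by move=> x /DD'; exact: Wu.
  - move=> i k; apply: Ck_onM => //; first exact: Ck_on_cst.
    have st2 : Ck_on k D' (fun x => t x / 2).
      by apply: Ck_onM => //; exact: Ck_on_cst.
    have sbt : Ck_on k D' (fun x => be * t x).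
      by apply: Ck_onM => //; exact: Ck_on_cst.
    have [sc ss] := Ck_on_cos_sin oD' sbt.
    have se1 := Ck_on_exp oD' st2; have se2 := Ck_on_exp oD' (Ck_onN oD' st2).
    move: i j; apply: ord4P; apply: ord4P;
      (under [fun _ => _]funext do rewrite /twist !rows4E !row4E);
      by first [exact: Ck_on_cst | exact: se1 | exact: Ck_onM
        | apply: Ck_onN => //; exact: Ck_onM].
  - by move=> x i j' /DD'; exact: bU.
  - move=> x i i' Dx.
    have dt : differentiable t x by exact: smooth_on_differentiable st Dx.
    have dF k l : 'D_(U l x) (fun x => 2 * a * twist be (t x) k j) x =
        2 * a * ((twist_gen be *m twist be (t x)) k j * (2 * a * (l == 0)%:R)).
      have dtw : differentiable (fun x => twist be (t x) k j) x.
        apply: (@differentiable_comp _ _ _ _ t (fun s => twist be s k j)) => //.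
        by apply/derivable1_diffP; have [] := is_derive_twist be (t x) k j.
      have -> : (fun x => 2 * a * twist be (t x) k j) =
          (2 * a) *: (fun x => twist be (t x) k j) by [].
      rewrite deriveZ; last exact: diff_derivable.
      congr (_ * _); rewrite -(tE x l Dx).
      exact: (derive_comp_real _ dt (is_derive_twist be (t x) k j)).
    rewrite !dF !mxE -!mulrBr.
    under [RHS]eq_bigr do rewrite /C /twist_struct mulrBr mulrBl.
    rewrite sumrB mulrBr; congr (_ - _).
      rewrite mulrCA [RHS](eq_bigr (fun k => 2 * a * (2 * a * (i == 0)%:R) *
        (twist_gen be i' k * twist be (t x) k j))).
        by rewrite -mulr_sumr; ring.
      by move=> k _; ring.
    rewrite mulrCA [RHS](eq_bigr (fun k => 2 * a * (2 * a * (i' == 0)%:R) *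
        (twist_gen be i k * twist be (t x) k j))).
      by rewrite -mulr_sumr; ring.
    by move=> k _; ring.
(* The brackets have no component along [U 0], so the form with the constant values 2a, 0, 0, 0 on
   the frame is closed. *)
have [r0 [t [r00 r0D st t0 tE]]] : exists r : R, exists f : 'rV[R]_4 -> R, [/\ 0 < r, ball x0 r `<=` D,
      smooth_on (ball x0 r) f, f x0 = 0 &
      forall x i, ball x0 r x -> 'D_(U i x) f x = 2 * a * (i == 0)%:R].
  apply: (@frame_primitive R 4 D x0 U (fun i _ => 2 * a * (i == 0)%:R) C) => //.
  - by move=> i k; exact: Ck_on_cst.
  - move=> x i j Dx; rewrite !derive_cst subr0 big1// => k _; rewrite /C /twist_struct.
    move: i j k; apply: ord4P; apply: ord4P; apply: ord4P;
      rewrite /twist_gen !rows4E ?row4E ?mxE /=; ring.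
have ob (r : R) : open (ball x0 r : set 'rV[R]_4) by exact: ball_open.
have [r1 [xi [r10 r1D sxi xi0 xiE]]] := prim t _ 1 (ob r0) (ballxx x0 r00) r0D st tE.
have [r2 [eta [r20 r2D seta eta0 etaE]]] := prim t _ 2 (ob r0) (ballxx x0 r00) r0D st tE.
have [r3 [zeta [r30 r3D szeta zeta0 zetaE]]] := prim t _ 3 (ob r0) (ballxx x0 r00) r0D st tE.
pose r := Num.min r1 (Num.min r2 r3).
have l1 : ball x0 r `<=` (ball x0 r1 : set 'rV[R]_4) by apply: le_ball; rewrite ge_min lexx.
have l2 : ball x0 r `<=` (ball x0 r2 : set 'rV[R]_4).
  by apply: le_ball; rewrite !ge_min lexx orbT.
have l3 : ball x0 r `<=` (ball x0 r3 : set 'rV[R]_4).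
  by apply: le_ball; rewrite !ge_min lexx !orbT.
pose psi x := row4 (t x) (xi x) (eta x) (zeta x).
have spsi : smooth_on (ball x0 r) psi.
  move=> k; apply: Ck_on_mx => // i; apply: ord4P;
  (under [fun _ => _]funext do rewrite (ord1 i) row4E).
  + exact: Ck_on_sub (subset_trans l1 r1D) (st k).
  + exact: Ck_on_sub l1 (sxi k).
  + exact: Ck_on_sub l2 (seta k).
  + exact: Ck_on_sub l3 (szeta k).
exists r, psi; split=> //.
- by rewrite !lt_min r10 r20.
- exact: subset_trans l1 (subset_trans r1D r0D).
- by rewrite /psi t0 xi0 eta0 zeta0; apply/rowP; apply: ord4P; rewrite row4E mxE.
- move=> x xr; have dpsi : differentiable psi x by exact: smooth_on_differentiable spsi xr.
  apply/row_matrixP => i; rewrite row_mul rowK -deriveEjacobian//.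
  have pE j : (fun y => psi y 0 j) = nth t [:: t; xi; eta; zeta] j.
    by move: j; apply: ord4P; apply/funext => y; rewrite row4E.
  apply/rowP => j; rewrite (derive_entry _ 0 j dpsi) pE mxE [RHS]mxE {1}/psi row4E.
  move: j; apply: ord4P => /=.
  + rewrite tE; last exact/r1D/l1.
    by move: i; apply: ord4P; rewrite /twist !rows4E row4E.
  + by rewrite xiE//; exact: l1.
  + by rewrite etaE//; exact: l2.
  + by rewrite zetaE//; exact: l3.
Qed.

End Four.

(** * Lie groups and their invariant frames *)

Lemma product_chart_open (R : realType) n (M : manifold R n) (mul : M -> M -> M)
    (c d e : chart R n M) : continuous (fun pq : M * M => mul pq.1 pq.2) ->
  open [set xy : 'rV[R]_n * 'rV[R]_n | exists p q, [/\ chart_dom c p, chart_dom d q,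
    chart_dom e (mul p q) & xy = (chart_fun c p, chart_fun d q)]].
Proof.
move=> mulc; rewrite openE => _ [p [q [cp dq epq ->]]].
have mc : {for (p, q), continuous (fun pq : M * M => mul pq.1 pq.2)} by exact: mulc.
have [[P Q] /= [nP nQ] PQ] : nbhs (p, q) ((fun pq : M * M => mul pq.1 pq.2) @^-1` chart_dom e).
  by apply: mc; apply: open_nbhs_nbhs; split=> //; exact: chart_dom_open.
exists ([set x | [/\ chart_dom c (chart_inv c x), P (chart_inv c x) & chart_fun c (chart_inv c x) = x]],
  [set x | [/\ chart_dom d (chart_inv d x), Q (chart_inv d x) & chart_fun d (chart_inv d x) = x]]).
  by split; [exact: near_chart cp nP|exact: near_chart dq nQ].
move=> [x y] /= [[cx Px xE] [dy Qy yE]]; exists (chart_inv c x), (chart_inv d y).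
by split=> //; [exact: (PQ (_, _))|rewrite xE yE].
Qed.

Section GroupLaws.
Variables (R : realType) (n : nat) (M : manifold R n) (S : lie_group_structure M).
Local Notation "x ** y" := (lg_mul S x y) (at level 40, left associativity).
Local Notation one := (lg_one S).
Local Notation inv := (lg_inv S).

Lemma lg_mulKV g x : inv g ** (g ** x) = x.
Proof. by rewrite lg_mulA lg_mulV lg_mul1. Qed.

Lemma lg_mulI g : injective (lg_mul S g).
Proof. exact: can_inj (lg_mulKV g). Qed.

Lemma lg_mulr1 g : g ** one = g.
Proof. by apply: (lg_mulI (g := inv g)); rewrite lg_mulA lg_mulV lg_mul1. Qed.

Lemma lg_mulrV g : g ** inv g = one.
Proof. by apply: (lg_mulI (g := inv g)); rewrite lg_mulKV lg_mulr1. Qed.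

Lemma lg_mulVK g x : g ** (inv g ** x) = x.
Proof. by rewrite lg_mulA lg_mulrV lg_mul1. Qed.

Lemma left_translation_continuous g : continuous (lg_mul S g).
Proof.
move=> x; have c2 : {for (g, x), continuous (fun pq : M * M => pq.1 ** pq.2)}.
  exact: lg_mul_continuous.
apply: (@continuous_comp _ _ _ (fun y => (g, y)) (fun pq : M * M => pq.1 ** pq.2)) => //.
apply: pair_continuous; first exact: cst_continuous.
by move=> y; exact: cvg_id.
Qed.

Lemma left_translation_open g (A : set M) : open A -> open (lg_mul S g @` A).
Proof.
move=> oA; have -> : lg_mul S g @` A = lg_mul S (inv g) @^-1` A.
  apply/seteqP; split=> [_ [x Ax <-]|x Ax]; first by rewrite /= lg_mulKV.
  by exists (inv g ** x) => //; rewrite lg_mulVK.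
by apply: open_comp => // x _; exact: left_translation_continuous.
Qed.

(** Left translation is multiplication restricted to a slice, and in charts the slice is an affine
    embedding. *)
Lemma left_translation_smooth g : smooth_map (lg_mul S g).
Proof.
split; first exact: left_translation_continuous.
move=> d e ad ae k; pose c := mf_chart g.
have ac : mf_atlas M c by exact: mf_chart_atlas.
have cg : chart_dom c g by exact: mf_chart_dom.
have := lg_mul_smooth S ac ad ae k.
set D := (X in Ck_on _ X) => cD.
pose l (v : 'rV[R]_n) : 'rV[R]_n * 'rV[R]_n := (0, v).
have l_lin : linear l.
  by move=> a v w; rewrite /l; congr pair; rewrite /= scaler0 addr0.
pose lM := GRing.isLinear.Build _ _ _ _ _ l_lin.
pose lL : {linear 'rV[R]_n -> ('rV[R]_n * 'rV[R]_n)%type} := HB.pack l lM.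
have lc : continuous lL.
  move=> x; have h : {for x, continuous (fun y : 'rV[R]_n => (0 : 'rV[R]_n, y))}.
    by apply: pair_continuous; [exact: cst_continuous|exact: cvg_id].
  exact: h.
have oD : open D by exact: product_chart_open (@lg_mul_continuous _ _ _ S).
have := Ck_on_comp_affine (chart_fun c g, 0) lc oD cD.
set f := (X in Ck_on _ _ X); set D' := (X in Ck_on _ X) => h.
have -> : (chart_fun e \o lg_mul S g) \o chart_inv d = f.
  by apply/funext => x; rewrite /f /= addr0 add0r chart_funK.
apply: Ck_on_sub h => _ [x [dx ex] <-]; exists g, x; split=> //.
by rewrite /lL /= /l; congr pair; rewrite /= ?addr0 ?add0r.
Qed.

End GroupLaws.

Section FieldsInCharts.
Variables (R : realType) (n : nat).

Lemma local_fieldE (M : manifold R n) (X : vector_field M) c p : chart_dom c p ->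
  local_field X c (chart_fun c p) =
  X p *m jacobian (chart_fun c \o chart_inv (mf_chart p)) (chart_fun (mf_chart p) p).
Proof. by move=> cp; rewrite /local_field (chart_funK cp). Qed.

Lemma local_field_smooth_map (M N : manifold R n) (F : M -> N) (X : vector_field M)
    (Y : vector_field N) c d p : smooth_map F -> mf_atlas M c -> mf_atlas N d ->
  chart_dom c p -> chart_dom d (F p) -> X p *m differential F p = Y (F p) ->
  local_field Y d (chart_fun d (F p)) =
  local_field X c (chart_fun c p) *m
    jacobian (chart_fun d \o F \o chart_inv c) (chart_fun c p).
Proof.
move=> sF ac ad cp dF XY; rewrite (local_fieldE X cp) (local_fieldE Y dF) -XY.
have := differential_chart sF ac ad cp dF.
have := jacobian_transition (mf_chart_atlas _) ac (mf_chart_dom _) cp.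
move: (jacobian _ _) (jacobian _ _) (jacobian _ _) => J1 J2 J3 J12 ->.
by rewrite !mulmxA -(mulmxA (X p) J3) J12 mulmx1.
Qed.

Lemma local_field_transition (M : manifold R n) (X : vector_field M) c d p :
  mf_atlas M c -> mf_atlas M d -> chart_dom c p -> chart_dom d p ->
  local_field X d (chart_fun d p) =
  local_field X c (chart_fun c p) *m jacobian (chart_fun d \o chart_inv c) (chart_fun c p).
Proof.
move=> ac ad cp dp; rewrite (local_fieldE X cp) (local_fieldE X dp) -mulmxA.
have sid := smooth_map_id M.
have [_ E] := jacobian_chart_comp sid sid (mf_chart_atlas p) ac ad (mf_chart_dom p) cp dp.
by congr (_ *m _); exact: E.
Qed.

(** The bracket is defined in the chart chosen at each point; naturality under transition maps makes
    the same formula valid in every chart. *)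
Lemma lie_bracket_chart (M : manifold R n) (X Y : vector_field M) c p :
  smooth_field X -> smooth_field Y -> mf_atlas M c -> chart_dom c p ->
  let x := chart_fun c p in
  'D_(local_field X c x) (local_field Y c) x - 'D_(local_field Y c x) (local_field X c) x
  = local_field (lie_bracket X Y) c x.
Proof.
move=> sX sY ac cp x; pose d := mf_chart p.
have ad : mf_atlas M d by exact: mf_chart_atlas.
have dp : chart_dom d p by exact: mf_chart_dom.
rewrite [RHS](local_fieldE _ cp) -/d /lie_bracket -/d {}/x.
pose E := chart_fun d @` (chart_dom d `&` chart_dom c).
have oE : open E by apply: chart_image_open; exact: chart_dom_open.
have Ep : E (chart_fun d p) by exists p.
have diffX (Z : vector_field M) e : smooth_field Z -> mf_atlas M e -> chart_dom e p ->
    differentiable (local_field Z e) (chart_fun e p).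
  by move=> sZ ae ep; apply: smooth_on_differentiable (sZ _ ae) _; exists p.
have xE : (chart_fun c \o chart_inv d) (chart_fun d p) = chart_fun c p.
  by rewrite /= (chart_funK dp).
have tr (Z : vector_field M) y : E y -> local_field Z c ((chart_fun c \o chart_inv d) y) =
    local_field Z d y *m jacobian (chart_fun c \o chart_inv d) y.
  by move=> [q [dq cq] <-]; rewrite /= (chart_funK dq); exact: local_field_transition.
have := @bracket_natural R n E (chart_fun c \o chart_inv d) (local_field X d) (local_field Y d)
  (local_field X c) (local_field Y c) (chart_fun d p) oE Ep (mf_transition ad ac 2%N)
  (diffX _ _ sX ad dp) (diffX _ _ sY ad dp).
rewrite xE => H.
exact: H (diffX _ _ sX ac cp) (diffX _ _ sY ac cp) (tr X) (tr Y).
Qed.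

End FieldsInCharts.

Section FrameUniqueness.
Variable R : realType.

Lemma affine_is_diff n (p : 'rV[R]_n) (T : 'M[R]_n) x :
  is_diff x (fun y : 'rV[R]_n => p + y *m T) (mulmxr T).
Proof.
have Tc : continuous (mulmxr T : 'rV[R]_n -> 'rV[R]_n) by exact: linear_rV_continuous.
have dT : is_diff x (mulmxr T : 'rV[R]_n -> 'rV[R]_n) (mulmxr T).
  by apply: DiffDef; [exact: linear_differentiable|exact: diff_lin].
have := @is_diffD _ _ _ (cst p) (mulmxr T : 'rV[R]_n -> _) 0 (mulmxr T) x (is_diff_cst p x) dT.
by rewrite add0r.
Qed.

Lemma jacobian_affine n (p : 'rV[R]_n) (T : 'M[R]_n) x :
  jacobian (fun y : 'rV[R]_n => p + y *m T) x = T.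
Proof.
have [d e] := affine_is_diff p T x.
apply/row_matrixP => i; rewrite !rowE -deriveEjacobian// deriveE//.
by rewrite e.
Qed.

(** The derivative of the first coordinate does not involve the map, because the first column of
    [twist] is constant; so the first coordinates agree. Then the derivatives of all coordinates
    agree. *)
Lemma frame_unique (k be : R) (x0 : 'rV[R]_4) (r : R) (W : 'rV[R]_4 -> 'M[R]_4)
    (A B : 'rV[R]_4 -> 'rV[R]_4) :
  (forall x, ball x0 r x -> W x \in unitmx) ->
  (forall x, ball x0 r x -> differentiable A x) ->
  (forall x, ball x0 r x -> differentiable B x) ->
  (forall x, ball x0 r x -> W x *m jacobian A x = k *: twist be (A x 0 0)) ->
  (forall x, ball x0 r x -> W x *m jacobian B x = k *: twist be (B x 0 0)) ->
  A x0 = B x0 -> forall x, ball x0 r x -> A x = B x.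
Proof.
move=> Wu dA dB eA eB AB0 x xr.
have r0 : 0 < r by move: xr => [].
have x0r : ball x0 r x0 by exact: ballxx.
have same j : (forall y v, ball x0 r y -> ('D_v A y) 0 j = ('D_v B y) 0 j) ->
    forall y, ball x0 r y -> A y 0 j = B y 0 j.
  move=> DAB y yr; apply/eqP; rewrite -subr_eq0; apply/eqP.
  have d y' : ball x0 r y' -> forall v, is_derive y' v (fun z => A z 0 j - B z 0 j) 0.
    move=> yr' v.
    have d1 : derivable (fun z => A z 0 j) y' v.
      by apply: diff_derivable; apply: differentiable_entry; exact: dA.
    have d2 : derivable (fun z => B z 0 j) y' v.
      by apply: diff_derivable; apply: differentiable_entry; exact: dB.
    apply: DeriveDef; first exact: derivableB d1 d2.
    apply: (etrans (deriveB d1 d2)).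
    rewrite -(derive_entry v 0 j (dA _ yr')) -(derive_entry v 0 j (dB _ yr')).
    by rewrite DAB// subrr.
  by rewrite (derive_eq0_ball_cst d yr x0r) AB0 subrr.
have DE (F : 'rV[R]_4 -> 'rV[R]_4) y v : ball x0 r y -> differentiable F y ->
    W y *m jacobian F y = k *: twist be (F y 0 0) ->
    'D_v F y = (k *: (v *m invmx (W y))) *m twist be (F y 0 0).
  move=> yr dF eF; rewrite deriveEjacobian// -scalemxAl scalemxAr -eF mulmxA.
  by rewrite -(mulmxA v) mulVmx ?mulmx1//; exact: Wu.
have AB00 : forall y, ball x0 r y -> A y 0 0 = B y 0 0.
  apply: same => y v yr.
  rewrite (DE A y v yr (dA _ yr) (eA _ yr)) (DE B y v yr (dB _ yr) (eB _ yr)).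
  by rewrite !mul_twist !row4E.
apply/rowP => j; apply: same => // y v yr.
rewrite (DE A y v yr (dA _ yr) (eA _ yr)) (DE B y v yr (dB _ yr) (eB _ yr)).
by rewrite AB00.
Qed.

End FrameUniqueness.

Section InvariantFrames.
Variables (R : realType) (M : manifold R 4) (S : lie_group_structure M).
Variables (u : 'I_4 -> vector_field M).
Hypothesis u_inv : forall i, left_invariant S (u i).
Hypothesis u_free : forall p, (\matrix_i u i p) \in unitmx.
Local Notation "x ** y" := (lg_mul S x y) (at level 40, left associativity).
Local Notation one := (lg_one S).

Definition local_frame (c : chart R 4 M) x := \matrix_i local_field (u i) c x.

Lemma local_frameE c p : chart_dom c p ->
  local_frame c (chart_fun c p) =
  (\matrix_i u i p) *m
    jacobian (chart_fun c \o chart_inv (mf_chart p)) (chart_fun (mf_chart p) p).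
Proof.
by move=> cp; apply/row_matrixP => i; rewrite row_mul !rowK (local_fieldE _ cp).
Qed.

Lemma local_frame_unit c p : mf_atlas M c -> chart_dom c p ->
  local_frame c (chart_fun c p) \in unitmx.
Proof.
move=> ac cp; rewrite (local_frameE cp) unitmx_mul u_free /=.
exact: jacobian_transition_unit (mf_chart_atlas _) ac (mf_chart_dom _) cp.
Qed.

Lemma local_frame_translate g c d p : mf_atlas M c -> mf_atlas M d ->
  chart_dom c p -> chart_dom d (g ** p) ->
  local_frame d (chart_fun d (g ** p)) = local_frame c (chart_fun c p) *m
    jacobian (chart_fun d \o lg_mul S g \o chart_inv c) (chart_fun c p).
Proof.
move=> ac ad cp dp; apply/row_matrixP => i.
have E e x : row i (local_frame e x) = local_field (u i) e x by exact: rowK.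
apply: (etrans (E d _)); apply/esym; apply: (etrans (row_mul i _ _)).
apply/esym; apply: (etrans _ (esym (congr1 (mulmx^~ _) (E c _)))).
apply: (@local_field_smooth_map _ _ _ _ (lg_mul S g)) => //.
  exact: left_translation_smooth.
exact: u_inv.
Qed.

Variables (k be : R) (x0 : 'rV[R]_4) (r : R) (psi : 'rV[R]_4 -> 'rV[R]_4).
Let c := mf_chart one.
Hypothesis r0 : 0 < r.
Hypothesis x0E : x0 = chart_fun c one.
Hypothesis spsi : smooth_on (ball x0 r) psi.
Hypothesis psi0 : psi x0 = 0.
Hypothesis psi_frame : forall x, ball x0 r x ->
  local_frame c x *m jacobian psi x = k *: twist be (psi x 0 0).

(** For fixed g, both sides of the product formula solve the frame equation as functions of h, the
    left one by left invariance and the right one by [twistD]. They agree at the unit, and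
    [frame_unique] identifies them. *)
Lemma development_mul : exists2 N : set M, nbhs one N &
  forall g h, N g -> N h -> [/\ chart_dom c (g ** h),
    ball x0 r (chart_fun c (g ** h)) &
    psi (chart_fun c (g ** h)) =
    psi (chart_fun c g) + psi (chart_fun c h) *m twist be (psi (chart_fun c g) 0 0)].
Proof.
have ac : mf_atlas M c by exact: mf_chart_atlas.
have c1 : chart_dom c one by exact: mf_chart_dom.
have dpsi x : ball x0 r x -> differentiable psi x.
  by move=> xr; exact: smooth_on_differentiable spsi xr.
have x0r : ball x0 r x0 by exact: ballxx.
have ob : open (ball x0 r : set 'rV[R]_4) by exact: ball_open.
pose Q0 := chart_dom c `&` chart_fun c @^-1` ball x0 r.
have nQ0 : nbhs one Q0.
  apply: filterI; first by apply: open_nbhs_nbhs; split=> //; exact: chart_dom_open.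
  apply: (chart_fun_continuous c1); rewrite -x0E.
  by apply: open_nbhs_nbhs; split=> //; rewrite x0E.
have mc : {for (one, one), continuous (fun pq : M * M => pq.1 ** pq.2)}.
  exact: lg_mul_continuous.
have nQ1 : nbhs (one ** one) Q0 by rewrite lg_mul1.
have [[P Q] /= [nP nQ] PQ] := mc Q0 nQ1.
have /nbhs_ballP[r' /= r'0 r'P] : nbhs x0 [set x | [/\ chart_dom c (chart_inv c x),
    (Q `&` Q0) (chart_inv c x) & chart_fun c (chart_inv c x) = x]].
  by rewrite x0E; exact: near_chart c1 (filterI nQ nQ0).
exists (P `&` Q0 `&` chart_fun c @^-1` ball x0 r').
  apply: filterI; first exact: filterI.
  apply: (chart_fun_continuous c1); rewrite -x0E.
  by apply: open_nbhs_nbhs; split; [exact: ball_open|rewrite x0E; exact: ballxx].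
move=> g h [[Pg [cg gr]] _] [[_ [ch _]] hr'].
have Q0m x : ball x0 r' x -> Q0 (g ** chart_inv c x).
  by move=> /r'P[_ [Qx _] _]; exact: (PQ (g, _)).
have Eh : chart_inv c (chart_fun c h) = h by rewrite chart_funK.
have := Q0m _ hr'; rewrite Eh => -[cgh ghr]; split=> //.
pose m := chart_fun c \o lg_mul S g \o chart_inv c.
have dm x : ball x0 r' x -> differentiable m x.
  move=> xr; have [cx _ xE] := r'P _ xr; have [mx _] := Q0m _ xr.
  by rewrite -xE; apply: smooth_map_differentiable => //; exact: left_translation_smooth.
have mr x : ball x0 r' x -> ball x0 r (m x) by move=> /Q0m[].
have := @frame_unique R k be x0 r' (local_frame c) (psi \o m)
  (fun x => psi (chart_fun c g) + psi x *m twist be (psi (chart_fun c g) 0 0)).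
have rr' x : ball x0 r' x -> ball x0 r x.
  by move=> /r'P[_ [_ [_ xr]] xE]; rewrite -xE.
have dB y := affine_is_diff (psi (chart_fun c g)) (twist be (psi (chart_fun c g) 0 0)) y.
move=> H; suff : (psi \o m) (chart_fun c h) = psi (chart_fun c g) +
    psi (chart_fun c h) *m twist be (psi (chart_fun c g) 0 0).
  by rewrite /m /= Eh.
refine (H _ _ _ _ _ _ _ hr').
- by move=> x /r'P[cx _ xE]; rewrite -xE; exact: local_frame_unit.
- by move=> x xr; apply: differentiable_comp; [exact: dm|exact/dpsi/mr].
- move=> x xr; have [dA _] := dB (psi x).
  exact: (differentiable_comp (dpsi _ (rr' _ xr)) dA).
- move=> x xr; rewrite jacobian_comp; [|exact: dm|exact/dpsi/mr].
  have [cx _ xE] := r'P _ xr; have [mx _] := Q0m _ xr.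
  rewrite mulmxA -[in X in X *m jacobian psi _]xE -local_frame_translate//.
  exact/psi_frame/mr.
- move=> x xr; have dp := dpsi _ (rr' _ xr).
  have dA : differentiable (fun y => psi (chart_fun c g) +
      y *m twist be (psi (chart_fun c g) 0 0)) (psi x) by have [] := dB (psi x).
  rewrite (jacobian_comp dp dA) jacobian_affine mulmxA (psi_frame (rr' _ xr)).
  rewrite -scalemxAl -twistD; congr (_ *: twist be _).
  by rewrite mxE mul_twist row4E addrC.
- by rewrite /m /= x0E chart_funK// lg_mulr1 -x0E psi0 mul0mx addr0.
Qed.

End InvariantFrames.

(** * Local homomorphisms from the model group *)

Section LocalInverse.
Variables (R : realType) (n : nat).

(** Openness of psi is continuity of its local inverse chi, and continuity of psi is openness of
    chi. *)
Lemma local_inverse (x0 : 'rV[R]_n) (r : R) (psi : 'rV[R]_n -> 'rV[R]_n) :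
  0 < r -> smooth_on (ball x0 r) psi -> jacobian psi x0 \in unitmx ->
  exists (r' rho : R) (chi : 'rV[R]_n -> 'rV[R]_n),
  [/\ 0 < r' /\ 0 < rho, ball x0 r' `<=` (ball x0 r : set 'rV[R]_n),
    {in (ball x0 r' : set _) &, injective psi},
    (forall y, ball (psi x0) rho y ->
       [/\ ball x0 r' (chi y), psi (chi y) = y & {for y, continuous chi}]) &
    forall B, open B -> B `<=` ball (psi x0) rho -> open (chi @` B)].
Proof.
move=> r0 spsi Ju.
have ob (s : R) x : open (ball x s : set 'rV[R]_n) by exact: ball_open.
have [r' [r'0 r'r inj img]] := inverse_function (ob r x0) (ballxx x0 r0) (spsi 1%N) Ju.
have oV : open (psi @` ball x0 r') by exact: img.
have /nbhs_ballP[rho /= rho0 rhoP] : nbhs (psi x0) (psi @` ball x0 r').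
  by apply: open_nbhs_nbhs; split=> //; exists x0 => //; exact: ballxx.
have /choice[chi chiP] (y : 'rV[R]_n) : exists x, ball (psi x0) rho y -> ball x0 r' x /\ psi x = y.
  by have [/rhoP[x xr <-]|yr] := pselect (ball (psi x0) rho y); [exists x|exists x0].
have chiK x : ball x0 r' x -> ball (psi x0) rho (psi x) -> chi (psi x) = x.
  by move=> xr /chiP[cr E]; apply: inj => //; rewrite inE.
exists r', rho, chi; split=> //.
  move=> y yr; have [cr E] := chiP _ yr; split=> //.
  move=> W nW; have /nbhs_ballP[s /= s0 sW] := nW.
  have : nbhs y (psi @` (ball x0 r' `&` ball (chi y) s) `&` ball (psi x0) rho).
    apply: open_nbhs_nbhs; split.
      apply: openI; last exact: ob.
      by apply: img; [apply: openI; exact: ob|exact: subIsetl].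
    by split=> //; exists (chi y) => //; split=> //; exact: ballxx.
  apply: filterS => _ [[x [xr xs] <-] yr']; apply: sW.
  by rewrite chiK.
move=> B oB Br.
have -> : chi @` B = ball x0 r' `&` psi @^-1` B.
  apply/seteqP; split=> [_ [y By <-]|x [xr Bx]].
    by have [cr E] := chiP _ (Br _ By); split; rewrite //= E.
  by exists (psi x) => //; apply: chiK => //; exact: Br.
rewrite openE => x [xr Bx]; apply: filterI.
  by apply: open_nbhs_nbhs; split=> //; exact: ob.
have pc : {for x, continuous psi} := spsi 0%N x (r'r _ xr).
by apply: pc; exact: open_nbhs_nbhs.
Qed.

End LocalInverse.

Section LocalToGlobal.
Variables (R : realType) (M : manifold R 4) (S : lie_group_structure M) (be : R).
Local Notation "x ** y" := (lg_mul S x y) (at level 40, left associativity).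
Local Notation one := (lg_one S).
Local Notation inv := (lg_inv S).

(** The semidirect product of R and R^3; a single sum suffices because [twist] fixes the first
    coordinate. *)
Definition model_mul (x y : 'rV[R]_4) : 'rV[R]_4 := x + y *m twist be (x 0 0).

Lemma dyadic_small (del : R) (v : 'rV[R]_4) : 0 < del ->
  exists n, `|(2 ^+ n)^-1 *: v| < del.
Proof.
move=> d0; exists (Num.truncn (`|v| / del)).+1; set n := _.+1.
rewrite normrZ ger0_norm ?invr_ge0 ?exprn_ge0// mulrC ltr_pdivrMr ?exprn_gt0//.
rewrite mulrC -ltr_pdivrMr// (lt_le_trans (truncnS_gt _))//.
by rewrite -natrX ler_nat ltnW// ltn_expl.
Qed.

Lemma dyadic_shrink (del : R) n k (v : 'rV[R]_4) :
  `|(2 ^+ n)^-1 *: v| < del -> `|(2 ^+ (n + k))^-1 *: v| < del.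
Proof.
have -> : (2 ^+ (n + k))^-1 *: v = (2 ^+ k)^-1 *: ((2 ^+ n)^-1 *: v).
  by rewrite scalerA -invfM -exprD addnC.
apply: le_lt_trans; rewrite normrZ ler_piMl//.
rewrite ger0_norm ?invr_ge0 ?exprn_ge0// invf_le1 ?exprn_gt0// exprn_ege1//; lra.
Qed.

(* A local homomorphism f of the additive group extends as v |-> f(v / 2^n)^(2^n). *)
Lemma extend_additive (f : 'rV[R]_4 -> M) (del : R) : 0 < del ->
  (forall v w, `|v| < del -> `|w| < del -> f (v + w) = f v ** f w) ->
  exists F : 'rV[R]_4 -> M, [/\ forall v, `|v| < del -> F v = f v,
    forall v w, F (v + w) = F v ** F w &
    forall v n, `|(2 ^+ n)^-1 *: v| < del ->
      F v = iter n (fun x => x ** x) (f ((2 ^+ n)^-1 *: v))].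
Proof.
move=> d0 fD.
pose sq x := x ** x.
pose G n v := iter n sq (f ((2 ^+ n)^-1 *: v)).
have half (v : 'rV[R]_4) : v = 2^-1 *: v + 2^-1 *: v.
  by rewrite -scalerDl [_ + _](_ : _ = 1) ?scale1r//; lra.
have GS n v : `|(2 ^+ n)^-1 *: v| < del -> G n.+1 v = G n v.
  move=> vn; have vn' := dyadic_shrink 1 vn; rewrite addn1 in vn'; rewrite /G iterSr {2}/sq -fD//.
  by rewrite exprS invfM -scalerA -half.
have GD n k v : `|(2 ^+ n)^-1 *: v| < del ->
    `|(2 ^+ (n + k))^-1 *: v| < del /\ G (n + k)%N v = G n v.
  move=> vn; elim: k => [|k [IH1 IH2]]; first by rewrite addn0.
  by split; [exact: dyadic_shrink|rewrite addnS GS].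
have /choice[N NP] (v : 'rV[R]_4) : exists n, `|(2 ^+ n)^-1 *: v| < del.
  exact: dyadic_small.
pose F v := G (N v) v.
have FE n v : `|(2 ^+ n)^-1 *: v| < del -> F v = G n v.
  move=> vn; have [_ <-] := GD n (N v) v vn.
  by rewrite addnC; have [_ ->] := GD _ n v (NP v).
(* Powers of commuting elements multiply; small vectors have commuting images because addition is
   commutative. *)
have sqD n x y : x ** y = y ** x -> iter n sq (x ** y) = iter n sq x ** iter n sq y.
  elim: n x y => [//|n IH] x y xy; rewrite !iterSr -IH; last first.
    have h : x ** (y ** y) = (y ** y) ** x by rewrite lg_mulA xy -lg_mulA xy lg_mulA.
    by rewrite /sq -lg_mulA h lg_mulA h -lg_mulA.
  by rewrite /sq -!lg_mulA; congr (iter n sq (x ** _)); rewrite !lg_mulA xy.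
exists F; split=> [v vd|v w|v n vn]; last exact: FE.
  by rewrite (FE 0%N) /G ?expr0 ?invr1 ?scale1r.
(* An exponent at which v, w and v + w all become small. *)
pose m := N (v + w); pose n := (N v + N w + m)%N.
have vn := dyadic_shrink (N w + m) (NP v).
have wn := dyadic_shrink (N v + m) (NP w).
have vwn := dyadic_shrink (N v + N w) (NP (v + w)); rewrite -/m in vwn.
rewrite addnA -/n in vn; rewrite addnCA addnA -/n in wn.
rewrite addnC -/n in vwn.
rewrite !(FE n)// /G scalerDr fD// sqD// -!fD// addrC//.
Qed.

(** On the factors R and R^3 the local homomorphism is additive and extends by squaring to E1 and
    E3. Their product is multiplicative once E1 and E3 satisfy the commutation rule of the
    semidirect product. *)
Lemma extend_homomorphism (f : 'rV[R]_4 -> M) (del : R) : 0 < del ->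
  (forall v w, `|v| < del -> `|w| < del -> f (model_mul v w) = f v ** f w) ->
  exists F : 'rV[R]_4 -> M, (forall v, `|v| < del -> F v = f v) /\
    forall v w, F (model_mul v w) = F v ** F w.
Proof.
move=> d0 fD.
pose P1 (v : 'rV[R]_4) := row4 (v 0 0) 0 0 0.
pose P3 (v : 'rV[R]_4) := row4 0 (v 0 1) (v 0 2) (v 0 3).
have normP (v w : 'rV[R]_4) : (forall j, `|w 0 j| <= `|v 0 j|) -> `|v| < del -> `|w| < del.
  move=> wv; apply: le_lt_trans; apply: normr_mx_le => // i j; rewrite (ord1 i).
  exact: le_trans (wv j) (normr_entry _ _ _).
have n1 v : `|v| < del -> `|P1 v| < del.
  by apply: normP; apply: ord4P; rewrite row4E ?normr0.
have n3 v : `|v| < del -> `|P3 v| < del.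
  by apply: normP; apply: ord4P; rewrite row4E ?normr0.
have P1D v w : P1 (v + w) = model_mul (P1 v) (P1 w).
  rewrite /model_mul mul_twist !row4E; apply/rowP; apply: ord4P;
  by rewrite !mxE /=; ring.
have P3D v w : P3 (v + w) = model_mul (P3 v) (P3 w).
  rewrite /model_mul row4E twist0 mulmx1; apply/rowP; apply: ord4P;
  by rewrite !mxE /=; ring.
have [|E1 [E1f E1D E1i]] := @extend_additive (f \o P1) del d0.
  by move=> v w vd wd; rewrite /= P1D fD//; exact: n1.
have [|E3 [E3f E3D E3i]] := @extend_additive (f \o P3) del d0.
  by move=> v w vd wd; rewrite /= P3D fD//; exact: n3.
have P11 v : P1 (P1 v) = P1 v by rewrite /P1 row4E.
have P3tw v t : P3 v *m twist be t = P3 (v *m twist be t).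
  by rewrite /P3 !mul_twist !row4E; apply/rowP; apply: ord4P; rewrite !row4E; ring.
have P13 x v : model_mul (P1 x) (P3 v) = model_mul (P3 (v *m twist be (x 0 0))) (P1 x).
  by rewrite /model_mul P3tw !row4E twist0 mulmx1 addrC.
have conjX g p q n : g ** p = q ** g ->
    g ** iter n (fun x => x ** x) p = iter n (fun x => x ** x) q ** g.
  elim: n p q => // n IH p q gp; rewrite !iterSr; apply: IH.
  by rewrite lg_mulA gp -!lg_mulA gp.
(* For small x the rule holds for small v, and taking powers 2^n extends it to every v. *)
have conj1 x v : `|P1 x| < del ->
    E1 (P1 x) ** E3 v = E3 (v *m twist be (x 0 0)) ** E1 (P1 x).
  move=> xd; have [n vn] := dyadic_small v d0; have [m wm] := dyadic_small (v *m twist be (x 0 0)) d0.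
  have vn' := dyadic_shrink m vn; have wm' := dyadic_shrink n wm.
  rewrite addnC in wm'.
  rewrite (E3i _ _ vn') (E3i _ _ wm'); apply: conjX; rewrite (E1f _ xd) /= P11.
  rewrite -fD//; last exact: n3.
  rewrite P13 fD//; first by rewrite -scalemxAl.
  by rewrite -scalemxAl; exact: n3.
(* Writing x as the double of x / 2 removes the restriction on x, by induction on the number of
   halvings. *)
have conj x v : E1 (P1 x) ** E3 v = E3 (v *m twist be (x 0 0)) ** E1 (P1 x).
  have [n] := dyadic_small (P1 x) d0; elim: n x v => [|n IH] x v.
    by rewrite expr0 invr1 scale1r; exact: conj1.
  rewrite exprSr invfM -scalerA => xn.
  pose y := 2^-1 *: x.
  have yE : P1 y = 2^-1 *: P1 x by apply/rowP; apply: ord4P; rewrite !mxE /= ?mulr0.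
  have P1E : P1 x = P1 y + P1 y by rewrite yE -scalerDl [_ + _](_ : _ = 1) ?scale1r//; lra.
  have xE : x 0 0 = y 0 0 + y 0 0 by rewrite mxE; lra.
  rewrite -yE in xn; have IHy w := IH y w xn.
  by rewrite P1E E1D xE twistD mulmxA lg_mulA -IHy -!lg_mulA IHy.
exists (fun v => E3 v ** E1 (P1 v)); split=> [v vd|v w].
  rewrite E3f// E1f ?n1//= P11 -fD ?n1 ?n3//; congr f.
  rewrite /model_mul row4E twist0 mulmx1.
  by apply/rowP; apply: ord4P; rewrite !mxE /=; ring.
have -> : P1 (model_mul v w) = P1 v + P1 w.
  rewrite /model_mul mul_twist; apply/rowP; apply: ord4P; rewrite !mxE /=; ring.
rewrite E3D E1D -!lg_mulA; congr (_ ** _).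
by rewrite !lg_mulA conj.
Qed.

End LocalToGlobal.

(** * The model group and its homomorphisms *)

Section ModelGroup.
Variables (R : realType) (be : R).
Local Notation mul := (model_mul be).

Lemma model_mul00 x y : mul x y 0 0 = x 0 0 + y 0 0.
Proof. by rewrite /model_mul mul_twist mxE row4E. Qed.

Lemma model_mulA x y z : mul x (mul y z) = mul (mul x y) z.
Proof.
have := model_mul00 x y; rewrite /model_mul => ->.
by rewrite (addrC (x 0 0)) twistD mulmxDl mulmxA addrA.
Qed.

Definition model_inv (x : 'rV[R]_4) : 'rV[R]_4 := - (x *m twist be (- x 0 0)).

Lemma model_mulxV x : mul x (model_inv x) = 0.
Proof.
by rewrite /model_mul /model_inv mulNmx -mulmxA -twistD addNr twist0 mulmx1 subrr.
Qed.

Lemma model_mulVx x : mul (model_inv x) x = 0.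
Proof.
have E : model_inv x 0 0 = - x 0 0 by rewrite /model_inv mxE mul_twist row4E.
by rewrite /model_mul E addNr.
Qed.

Lemma model_mul0 x : mul 0 x = x.
Proof. by rewrite /model_mul mxE twist0 mulmx1 add0r. Qed.

Lemma model_mulx0 x : mul x 0 = x.
Proof. by rewrite /model_mul mul0mx addr0. Qed.

Lemma model_mul_continuous x : continuous (mul x).
Proof.
move=> y; apply: differentiable_continuous.
by have [] := affine_is_diff x (twist be (x 0 0)) y.
Qed.

Lemma model_mul_open x (A : set 'rV[R]_4) : open A -> open (mul x @` A).
Proof.
move=> oA; have -> : mul x @` A = mul (model_inv x) @^-1` A.
  apply/seteqP; split=> [_ [y Ay <-]|y Ay].
    by rewrite /= model_mulA model_mulVx model_mul0.
  by exists (mul (model_inv x) y) => //; rewrite model_mulA model_mulxV model_mul0.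
by apply: open_comp => // y _; exact: model_mul_continuous.
Qed.

End ModelGroup.

Section HomomorphismCovering.
Variables (R : realType) (M : manifold R 4) (S : lie_group_structure M) (be : R).
Local Notation "x ** y" := (lg_mul S x y) (at level 40, left associativity).
Local Notation one := (lg_one S).
Local Notation inv := (lg_inv S).
Local Notation mul := (model_mul be).
Local Notation minv := (model_inv be).
Variables (F : 'rV[R]_4 -> M) (rho : R).
Hypothesis FM : forall v w, F (mul v w) = F v ** F w.
Hypothesis rho0 : 0 < rho.
Hypothesis F_inj : {in (ball 0 rho : set 'rV[R]_4) &, injective F}.
Hypothesis F_cont : {for 0, continuous F}.
Hypothesis F_open : forall B, open B -> B `<=` ball 0 rho -> open (F @` B).

Lemma homomorphism0 : F 0 = one.
Proof.
apply: (lg_mulI (S := S) (g := F 0)).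
by rewrite lg_mulr1 -FM model_mul0.
Qed.

(** Translations in both groups carry continuity at 0 to every point. *)
Lemma homomorphism_continuous : continuous F.
Proof.
move=> x; have E : F = lg_mul S (F x) \o F \o mul (minv x).
  by apply/funext => y; rewrite /= -FM model_mulA model_mulxV model_mul0.
have c1 : {for x, continuous (mul (minv x))} by exact: model_mul_continuous.
have c2 : {for mul (minv x) x, continuous F} by rewrite model_mulVx.
have c3 : {for F (mul (minv x) x), continuous (lg_mul S (F x))}.
  exact: left_translation_continuous.
rewrite E.
exact: (continuous_comp c1 (continuous_comp c2 c3)).
Qed.

Lemma homomorphism_open A : open A -> open (F @` A).
Proof.
move=> oA; rewrite openE => _ [x Ax <-].
pose B := mul (minv x) @` A `&` ball 0 rho.
have oB : open B by apply: openI; [exact: model_mul_open|exact: ball_open].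
have oFB : open (lg_mul S (F x) @` (F @` B)).
  by apply: left_translation_open; apply: F_open oB _; exact: subIsetr.
have FBA : lg_mul S (F x) @` (F @` B) `<=` F @` A.
  move=> _ [_ [_ [[y Ay <-] _] <-] <-]; exists y => //.
  by rewrite -FM model_mulA model_mulxV model_mul0.
have n : nbhs (F x) (lg_mul S (F x) @` (F @` B)).
  apply: open_nbhs_nbhs; split=> //; exists one; last exact: lg_mulr1.
  exists 0; last exact: homomorphism0.
  by split; [exists x => //; exact: model_mulVx|exact: ballxx].
exact: filterS FBA n.
Qed.

Hypothesis M_conn : connected [set: M].

(** The image is an open subgroup, so its complement is a union of open translates of it;
    connectedness of M leaves nothing outside. *)
Lemma homomorphism_surjective q : exists p, F p = q.
Proof.
have oF : open (range F) by exact: homomorphism_open openT.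
have cF : closed (range F).
  rewrite -openC openE => p np.
  have n : nbhs p (lg_mul S p @` range F).
    apply: open_nbhs_nbhs; split; first exact: left_translation_open.
    by exists one; [exists 0 => //; exact: homomorphism0|exact: lg_mulr1].
  apply: filterS n => _ [_ [x _ <-] <-] [y _ yE]; apply: np.
  exists (mul y (minv x)) => //; rewrite FM yE -lg_mulA -FM model_mulxV.
  by rewrite homomorphism0 lg_mulr1.
have rT : range F = setT.
  apply: M_conn.
  - by exists (F 0); exists 0.
  - by exists (range F) => //; rewrite setTI.
  - by exists (range F) => //; rewrite setTI.
by have : range F q by [rewrite rT]; move=> [p _ <-]; exists p.
Qed.

(** Over the translate q F(W) of a small neighbourhood the sheets are the translates x W with F x =
    q; injectivity of F on W makes them disjoint. *)
Lemma homomorphism_covering : covering_map F.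
Proof.
split; [exact: homomorphism_continuous|exact: homomorphism_surjective|move=> q].
pose W := ball (0 : 'rV[R]_4) rho.
have oW : open W by exact: ball_open.
have W0 : W 0 by exact: ballxx.
exists (lg_mul S q @` (F @` W)); split.
- exact/left_translation_open/homomorphism_open.
- by exists one; [exists 0 => //; exact: homomorphism0|exact: lg_mulr1].
exists [set mul x @` W | x in F @^-1` [set q]]; split.
- move=> _ _ [x /= xq <-] [y /= yq <-] [_ [[w Ww <-] [w' Ww' wE]]].
  have ww' : w = w'.
    apply: F_inj; rewrite ?inE//.
    by apply: (lg_mulI (S := S) (g := q)); rewrite -{1}xq -yq -!FM wE.
  have -> // : x = y.
  have := congr1 (fun z => mul z (minv w)) wE; rewrite ww' /=.
  by rewrite -!model_mulA model_mulxV !model_mulx0.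
- apply/seteqP; split=> [_ [_ [x /= xq <-] [w Ww <-]]|y [_ [w Ww <-] wE]].
    by exists (F w); [exists w|rewrite FM xq].
  exists (mul (mul y (minv w)) @` W).
    exists (mul y (minv w)) => //=.
    by rewrite FM -wE -lg_mulA -FM model_mulxV homomorphism0 lg_mulr1.
  by exists w => //; rewrite -model_mulA model_mulVx model_mulx0.
- move=> _ [x /= xq <-]; split.
  + exact: model_mul_open.
  + move=> _ _ /set_mem [w Ww <-] /set_mem [w' Ww' <-]; rewrite !FM => /lg_mulI ww'.
    by congr (mul x _); apply: F_inj; rewrite ?inE.
  + apply/seteqP; split=> [_ [_ [w Ww <-] <-]|_ [_ [w Ww <-] <-]].
      by exists (F w); [exists w|rewrite FM xq].
    by exists (mul x w); [exists w|rewrite FM xq].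
  + by move=> B oB _; exact: homomorphism_open.
Qed.

End HomomorphismCovering.

(** * The covering of an EPS space *)

Section EPSCovering.
Variable R : realType.

Lemma jacobian_chart_id n (M : manifold R n) (c : chart R n M) p : chart_dom c p ->
  jacobian (chart_fun c \o chart_inv c) (chart_fun c p) = 1%:M.
Proof.
move=> cp; rewrite -(jacobian_id (chart_fun c p)); apply/esym/near_eq_jacobian.
  have : \forall x \near chart_fun c p, [/\ chart_dom c (chart_inv c x), setT (chart_inv c x) &
    chart_fun c (chart_inv c x) = x] by apply: near_chart => //; exact: filterT.
  by apply: filterS => x [_ _ /= ->].
exact: ex_diff.
Qed.

Section Developing.
Variables (M : manifold R 4) (S : lie_group_structure M).
Variables (u : 'I_4 -> vector_field M).
Hypothesis u_inv : forall i, left_invariant S (u i).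
Hypothesis u_free : forall p, (\matrix_i u i p) \in unitmx.
Local Notation "x ** y" := (lg_mul S x y) (at level 40, left associativity).
Local Notation one := (lg_one S).
Local Notation inv := (lg_inv S).
Variables (k be : R) (x0 : 'rV[R]_4) (r : R) (psi : 'rV[R]_4 -> 'rV[R]_4).
Let c := mf_chart one.
Hypothesis k0 : k != 0.
Hypothesis spsi : smooth_on (ball x0 r) psi.
Hypothesis psi_frame : forall x, ball x0 r x ->
  local_frame u c x *m jacobian psi x = k *: twist be (psi x 0 0).
Variables (F : 'rV[R]_4 -> M) (rho : R).
Hypothesis FM : forall v w, F (model_mul be v w) = F v ** F w.
Hypothesis rho0 : 0 < rho.
Hypothesis F_cont : continuous F.
Hypothesis F_psi : forall y, ball 0 rho y ->
  [/\ chart_dom c (F y), ball x0 r (chart_fun c (F y)) & psi (chart_fun c (F y)) = y].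

(** Left translation by (F x)^-1 brings F near x into the domain of psi, where psi ((F x)^-1 F y) is
    the model translate x^-1 y. This is affine in y, so the translated psi is a smooth map of
    invertible Jacobian through which F becomes smooth, and the chain rule yields the Jacobian of
    F. *)
Lemma developing_chart x d : mf_atlas M d -> chart_dom d (F x) ->
  exists2 D : set 'rV[R]_4, open D /\ D x &
    smooth_on D (chart_fun d \o F) /\
    local_frame u d (chart_fun d (F x)) =
      (k *: twist be (x 0 0)) *m jacobian (chart_fun d \o F) x.
Proof.
move=> ad dFx; pose g := inv (F x).
have ac : mf_atlas M c by exact: mf_chart_atlas.
have c1 : chart_dom c one by exact: mf_chart_dom.
have ob s (y : 'rV[R]_4) : open (ball y s : set 'rV[R]_4) by exact: ball_open.
have sL := left_translation_smooth S g.
pose Q0 := chart_dom c `&` chart_fun c @^-1` ball x0 r.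
have oQ0 : open Q0.
  rewrite openE => p [cp pr]; apply: filterI.
    by apply: open_nbhs_nbhs; split=> //; exact: chart_dom_open.
  by apply: (chart_fun_continuous cp); exact: open_nbhs_nbhs.
pose Qg := lg_mul S g @^-1` Q0.
have oQg : open Qg by apply: open_comp => // y _; exact: sL.1.
pose D' := chart_fun d @` (chart_dom d `&` Qg).
have oD' : open D' by exact: chart_image_open.
pose m := chart_fun c \o lg_mul S g \o chart_inv d.
pose h := psi \o m.
have mD' y : D' y -> ball x0 r (m y).
  by move=> [q [dq [cq qr]] <-]; rewrite /m /= chart_funK.
have sm : smooth_on D' m.
  move=> j; apply: Ck_on_sub (sL.2 _ _ ad ac j) => _ [q [dq [cq _]] <-].
  by exists q.
have sh : smooth_on D' h by move=> j; exact: (Ck_on_comp oD' (ob r x0) mD' (spsi j) (sm j)).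
have jh y : D' y -> local_frame u d y *m jacobian h y = k *: twist be (h y 0 0).
  move=> D'y; have dm := smooth_on_differentiable sm D'y.
  have dp := smooth_on_differentiable spsi (mD' _ D'y).
  rewrite (jacobian_comp dm dp) mulmxA -psi_frame; last exact: mD'.
  congr (_ *m _); have [q [dq [cq qr]] <-] := D'y.
  have -> : m (chart_fun d q) = chart_fun c (g ** q) by rewrite /m /= chart_funK.
  by rewrite (local_frame_translate u_inv ad ac dq cq).
have tu t : k *: twist be t \in unitmx by rewrite unitmxZ ?twist_unit// unitfE.
have jhu y : D' y -> jacobian h y \in unitmx.
  by move=> /jh E; have := tu (h y 0 0); rewrite -E unitmx_mul => /andP[].
pose L := model_mul be (model_inv be x).
pose D := F @^-1` (chart_dom d `&` Qg) `&` L @^-1` ball 0 rho.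
have oD : open D.
  apply: openI.
    apply: open_comp; first by move=> y _; exact: F_cont.
    by apply: openI => //; exact: chart_dom_open.
  by apply: open_comp; [move=> y _; exact: model_mul_continuous|exact: ob].
have F0 : F 0 = one by exact: homomorphism0 FM.
have FL y : g ** F y = F (L y).
  apply: (lg_mulI (S := S) (g := F x)).
  by rewrite lg_mulVK -FM /L model_mulA model_mulxV model_mul0.
have Dx : D x.
  have Lx : L x = 0 by exact: model_mulVx.
  split; last by rewrite /= Lx; exact: ballxx.
  split=> //; rewrite /Qg /= FL Lx.
  by have [] := F_psi (ballxx 0 rho0).
have hf y : D y -> h (chart_fun d (F y)) = L y.
  move=> [[dy Qy] yr]; rewrite /h /m /= chart_funK// FL.
  by have [] := F_psi yr.
have fD y : D y -> D' ((chart_fun d \o F) y) by move=> [? _]; exists (F y).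
have sf : smooth_on D (chart_fun d \o F).
  apply: (@smooth_lift R _ 4 D D' (chart_fun d \o F) h oD oD' fD _ jhu sh).
    move=> y [[dy _] _]; apply: continuous_comp; first exact: F_cont.
    exact: chart_fun_continuous.
  move=> j; apply: (@Ck_on_congr _ _ _ _ _ L) => //.
    by move=> y; rewrite inE => /hf.
  have Tc : continuous (mulmxr (twist be (model_inv be x 0 0)) : 'rV[R]_4 -> 'rV[R]_4).
    exact: linear_rV_continuous.
  apply: Ck_on_sub (Ck_on_comp_affine (model_inv be x) Tc openT (Ck_on_id _ _)).
  by [].
exists D => //; split=> //.
have D'x := fD _ Dx.
have df := smooth_on_differentiable sf Dx.
have dh := smooth_on_differentiable sh D'x.
(* Left translation by x^-1 in the model group is affine with the linear part
   [twist be (- x 0 0)]. *)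
have E1 : jacobian (chart_fun d \o F) x *m jacobian h (chart_fun d (F x)) = twist be (- x 0 0).
  apply: (etrans (esym (jacobian_comp df dh))).
  have nD : nbhs x D by exact: open_nbhs_nbhs.
  have dL : differentiable (L : 'rV[R]_4 -> 'rV[R]_4) x.
    by have [] := affine_is_diff (model_inv be x) (twist be (model_inv be x 0 0)) x.
  have e : {near x, L =1 h \o (chart_fun d \o F)} by apply: filterS nD => y /hf.
  apply: (etrans (esym (near_eq_jacobian e dL))).
  apply: (etrans (jacobian_affine _ _ _)).
  by rewrite /model_inv mxE mul_twist row4E.
have E2 := jh _ D'x.
apply: (can_inj (mulmxK (jhu _ D'x))); apply: (etrans E2).
rewrite -mulmxA [X in _ *m X]E1 -scalemxAl -twistD subrr.
by rewrite (hf x Dx) /L model_mulVx mxE.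
Qed.

Lemma developing_smooth : smooth_map (F : euclidean_manifold R 4 -> M).
Proof.
split=> // e d -> ad j; apply: Ck_on_local => _ [x [_ dx] <-].
have [D [oD Dx] [sf _]] := developing_chart ad dx.
by exists D => //; exact: Ck_on_sub (sf j).
Qed.

(** The rows of k times [twist] form a left-invariant frame of the model group, and F carries it to
    u. *)
Lemma developing_frame x : \matrix_i u i (F x) =
  (k *: twist be (x 0 0)) *m differential (F : euclidean_manifold R 4 -> M) x.
Proof.
have [D [oD Dx] [_]] := developing_chart (mf_chart_atlas _) (mf_chart_dom (F x)).
move=> <-; rewrite local_frameE; last exact: mf_chart_dom.
by rewrite jacobian_chart_id ?mulmx1//; exact: mf_chart_dom.
Qed.

End Developing.


Lemma gram_entry n m (A : 'M[R]_(n, m)) (G : 'M[R]_m) i j :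
  (A *m G *m A^T) i j = (row i A *m G *m (row j A)^T) 0 0.
Proof.
rewrite -row_mul mxE [RHS]mxE; move: (A *m G) => B.
by apply: eq_bigr => l _; rewrite !mxE.
Qed.

(** The left-invariant frame of the model group is orthonormal for the model metric, whatever be:
    rotations of C preserve that metric. *)
Lemma twist_metric (be : R) (x : 'rV[R]_4) :
  twist be (x 0 0) *m model_metric x *m (twist be (x 0 0))^T = 1%:M.
Proof.
rewrite /model_metric /twist; move: (x 0 0) => t.
have -> : expR t = expR (t / 2) ^+ 2 by rewrite expr2 -expRD; congr expR; lra.
have -> : expR (- t) = expR (- (t / 2)) ^+ 2 by rewrite expr2 -expRD; congr expR; lra.
have := expRxMexpNx_1 (t / 2); have := cos2Dsin2 (be * t).
move: (expR (t / 2)) (expR (- (t / 2))) (cos _) (sin _) => e e' c s cs ee.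
rewrite mul_mx_diag.
have E1 (y : R) : y = (e * e') ^+ 2 -> y = 1 by rewrite ee expr1n.
have E2 (y : R) : y = (e * e') ^+ 2 * (c ^+ 2 + s ^+ 2) -> y = 1.
  by rewrite ee cs expr1n mulr1.
apply/matrixP; apply: ord4P; apply: ord4P;
  rewrite mxE sum4 !mxE /=; first [ring | by apply: E1; ring | by apply: E2; ring].
Qed.

(** Near the unit, the inverse of the coordinates psi is a local homomorphism from the model group,
    and its extension F is the covering. F carries 2a times the orthonormal frame of the model to
    the orthonormal frame u, whence k = 1 / (2a)^2. *)
Lemma EPS_covering (M : riemannian R 4) : EPS_space M ->
  exists (k : R) (F : model R -> M), [/\ 0 < k, covering_map F, smooth_map F &
    forall p, pullback_metric F p = k *: model_metric p].
Proof.
move=> [S [a [b [u [[M_conn a0 u_si u_free u_orth] u_br]]]]].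
have u_inv i : left_invariant S (u i) by have [] := u_si i.
have u_smooth i : smooth_field (u i) by have [] := u_si i.
pose one := lg_one S; pose c := mf_chart one; pose be := b / (2 * a).
have ac : mf_atlas M c by exact: mf_chart_atlas.
have c1 : chart_dom c one by exact: mf_chart_dom.
have k0 : 2 * a != 0 by rewrite mulf_neq0// pnatr_eq0.
have [||||] := @frame_development R a b (chart_fun c @` chart_dom c) (chart_fun c one)
  (fun i => local_field (u i) c) a0 (@chart_img_open _ _ _ c).
- by exists one.
- by move=> i; exact: u_smooth.
- by move=> _ [p cp <-]; exact: local_frame_unit.
- move=> _ [p cp <-] br; have [b01 b02 b03 [b12 b13 b23]] := u_br p.
  have E i j : br i j = lie_bracket (u i) (u j) p *m
      jacobian (chart_fun c \o chart_inv (mf_chart p)) (chart_fun (mf_chart p) p).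
    rewrite /br (lie_bracket_chart (u_smooth i) (u_smooth j) ac cp).
    exact: local_fieldE.
  have V i := local_fieldE (u i) cp.
  by rewrite !E !V b01 b02 b03 b12 b13 b23 !mulmxBl !mul0mx -!scalemxAl.
move=> r [psi [r0 rc spsi psi0 psi_frame]].
have ob (s : R) (y : 'rV[R]_4) : open (ball y s : set 'rV[R]_4) by exact: ball_open.
have x0r : ball (chart_fun c one) r (chart_fun c one) by exact: ballxx.
have Ju : jacobian psi (chart_fun c one) \in unitmx.
  have : (2 * a) *: twist be (psi (chart_fun c one) 0 0) \in unitmx.
    by rewrite unitmxZ ?twist_unit// unitfE.
  by rewrite -psi_frame// unitmx_mul => /andP[].
have [r' [rho [chi [[r'0 rho0] r'r psi_inj chiP chi_open]]]] := local_inverse r0 spsi Ju.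
rewrite psi0 in chiP chi_open.
have r'c := subset_trans r'r rc.
(* Products have to stay where psi takes its values in the domain of chi. *)
have [s [s0 sr' sP]] : exists s : R, [/\ 0 < s,
    ball (chart_fun c one) s `<=` (ball (chart_fun c one) r' : set 'rV[R]_4) &
    forall x, ball (chart_fun c one) s x -> ball (0 : 'rV[R]_4) rho (psi x)].
  have pc : {for chart_fun c one, continuous psi} := spsi 0%N _ x0r.
  have n : nbhs (chart_fun c one) (psi @^-1` ball (0 : 'rV[R]_4) rho).
    by apply: pc; rewrite psi0; apply: open_nbhs_nbhs; split=> //; exact: ballxx.
  have /nbhs_ballP[s /= s0 sP] := n.
  exists (Num.min s r'); rewrite lt_min s0 r'0; split=> //.
    by apply: le_ball; rewrite ge_min lexx orbT.
  by move=> x xs; apply: sP; apply: le_ball xs; rewrite ge_min lexx.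
have spsi' : smooth_on (ball (chart_fun c one) s) psi.
  by move=> j; exact: Ck_on_sub (subset_trans sr' r'r) (spsi j).
have frame' x (xs : ball (chart_fun c one) s x) := psi_frame x (r'r _ (sr' _ xs)).
have [N nN NP] := development_mul u_inv u_free s0 erefl spsi' psi0 frame'.
have spsi'' : smooth_on (ball (chart_fun c one) r') psi by move=> j; exact: Ck_on_sub (spsi j).
have frame'' x (xr : ball (chart_fun c one) r' x) := psi_frame x (r'r _ xr).
pose f y := chart_inv c (chi y).
have fE y : ball 0 rho y -> [/\ chart_dom c (f y), chart_fun c (f y) = chi y &
    {for y, continuous f}].
  move=> /chiP[cr cE cc]; have [q cq qE] := r'c _ cr.
  rewrite /f -qE chart_funK//; split=> //.
  apply: continuous_comp => //; apply: chart_inv_continuous.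
  by rewrite -qE; exists q.
have b0 : ball (0 : 'rV[R]_4) rho 0 by exact: ballxx.
have chi0 : chi 0 = chart_fun c one.
  have [cr cE _] := chiP _ b0.
  by apply: psi_inj; rewrite ?inE ?psi0//; exact: ballxx.
have f0 : f 0 = one by rewrite /f chi0 chart_funK.
have [del [del0 delr delN]] : exists del : R, [/\ 0 < del, del <= rho &
    forall y, `|y| < del -> N (f y)].
  have [_ _ fc] := fE _ b0; have nf : nbhs (0 : 'rV[R]_4) (f @^-1` N) by apply: fc; rewrite f0.
  have /nbhs_ballP[d /= d0 dP] := nf.
  exists (Num.min d rho); rewrite lt_min d0 rho0 ge_min lexx orbT; split=> // y.
  rewrite lt_min => /andP[yd _]; apply: dP.
  by rewrite -ball_normE /= sub0r normrN.
(* By [development_mul] both sides have the same image under psi, and they lie where psi is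
   injective. *)
have fM v w : `|v| < del -> `|w| < del -> f (model_mul be v w) = lg_mul S (f v) (f w).
  move=> vd wd; have br (y : 'rV[R]_4) : `|y| < del -> ball (0 : 'rV[R]_4) rho y.
    by move=> yd; rewrite -ball_normE /= sub0r normrN (lt_le_trans yd).
  have [cgh ghs] := NP _ _ (delN _ vd) (delN _ wd).
  have [cv vE _] := fE _ (br _ vd); have [_ psiv _] := chiP _ (br _ vd).
  have [cw wE _] := fE _ (br _ wd); have [_ psiw _] := chiP _ (br _ wd).
  rewrite vE wE psiv psiw => ghE.
  have yr := sP _ ghs; rewrite ghE in yr.
  have [chir chiE _] := chiP _ yr.
  rewrite -(chart_funK cgh) /f; congr (chart_inv c _); apply: psi_inj.
  - by rewrite inE.
  - by rewrite inE; exact: sr'.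
  - by rewrite ghE.
have [F [Ff FM]] := extend_homomorphism del0 fM.
have F_psi y : ball 0 del y -> [/\ chart_dom c (F y), ball (chart_fun c one) r' (chart_fun c (F y)) &
    psi (chart_fun c (F y)) = y].
  move=> yd; have yn : `|y| < del by move: yd; rewrite -ball_normE /= sub0r normrN.
  have yr : ball 0 rho y by exact: le_ball yd.
  by rewrite Ff//; have [cf -> _] := fE _ yr; have [cr cE _] := chiP _ yr.
have nB (y : 'rV[R]_4) : ball 0 del y -> `|y| < del by rewrite -ball_normE /= sub0r normrN.
have dB : ball 0 del `<=` (ball 0 rho : set 'rV[R]_4) by exact: le_ball.
have F_inj : {in (ball 0 del : set 'rV[R]_4) &, injective F}.
  move=> x y /set_mem xd /set_mem yd xy; have [_ _ <-] := F_psi _ xd.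
  by rewrite xy; have [_ _] := F_psi _ yd.
have F_cont0 : {for 0, continuous F}.
  have [_ _ fc] := fE _ b0; move=> W nW.
  have F0 : F 0 = f 0 by apply: Ff; rewrite normr0.
  have n1 : nbhs (0 : 'rV[R]_4) (ball (0 : 'rV[R]_4) del) by exact: nbhsx_ballx.
  have n2 : nbhs (0 : 'rV[R]_4) (f @^-1` W) by apply: fc; rewrite -F0.
  have n3 : nbhs (0 : 'rV[R]_4) (F @^-1` W).
    by apply: filterS (filterI n1 n2) => y [/nB yd fy]; rewrite /= Ff.
  exact: n3.
have F_open B : open B -> B `<=` ball 0 del -> open (F @` B).
  move=> oB Bd; have -> : F @` B = chart_dom c `&` chart_fun c @^-1` (chi @` B).
    apply/seteqP; split=> [_ [y By <-]|p [cp [y By yE]]].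
      have yd := Bd _ By; have [cf E _] := fE _ (dB _ yd).
      by rewrite Ff; [split=> //; exists y|exact: nB].
    exists y => //; rewrite Ff; last exact/nB/Bd.
    by rewrite /f yE chart_funK.
  have oC : open (chi @` B) by apply: chi_open => //; exact: subset_trans Bd dB.
  rewrite openE => p [cp Bp]; apply: filterI.
    by apply: open_nbhs_nbhs; split=> //; exact: chart_dom_open.
  by apply: (chart_fun_continuous cp); exact: open_nbhs_nbhs.
have F_cont := homomorphism_continuous FM F_cont0.
have sF : smooth_map (F : euclidean_manifold R 4 -> M).
  exact: (developing_smooth u_inv k0 spsi'' frame'' FM del0 F_cont F_psi).
have frameF := developing_frame u_inv k0 spsi'' frame'' FM del0 F_cont F_psi.
exists (((2 * a) ^+ 2)^-1), F; split=> //.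
- by rewrite invr_gt0 exprn_even_gt0.
- exact: (homomorphism_covering FM del0 F_inj F_cont0 F_open M_conn).
move=> x; rewrite /pullback_metric.
have := frameF x; set J := differential _ _; set T := _ *: _ => UE.
have Tu : T \in unitmx by rewrite unitmxZ ?twist_unit// unitfE.
have orth : T *m (J *m rm_metric (F x) *m J^T) *m T^T = 1%:M.
  rewrite !mulmxA -UE -mulmxA -trmx_mul -UE; apply/matrixP => i j.
  rewrite [RHS]mxE -(u_orth (F x) i j).
  have rowE' i' : row i' (\matrix_l u l (F x)) = u i' (F x) by exact: rowK.
  by rewrite gram_entry !rowE'.
have mm : T *m (((2 * a) ^+ 2)^-1 *: model_metric x) *m T^T = 1%:M.
  rewrite -scalemxAr -scalemxAl /T linearZ /= -!scalemxAl -scalemxAr.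
  rewrite !scalerA twist_metric -mulrA -expr2 mulVf ?scale1r//.
  by rewrite expf_neq0.
have := orth; rewrite -mm => /(can_inj (mulmxK _)) => H.
have Tu' : T^T \in unitmx by rewrite unitmx_tr.
exact: (can_inj (mulKmx Tu)) (H Tu').
Qed.

End EPSCovering.

(** * Topology and completeness of the model *)

Section ModelTopology.
Variable R : realType.

Lemma model_simply_connected : simply_connected R (model R).
Proof.
split=> [p q|f fc f01].
  exists (fun s : R => (p : 'rV[R]_4) + s *: ((q : 'rV[R]_4) - (p : 'rV[R]_4))); split.
  - exact/continuous_subspaceT/continuous_line.
  - by rewrite scale0r addr0.
  - by rewrite scale1r addrC subrK.
pose g : R -> 'rV[R]_4 := f \o clamp 0 1.
have gc : continuous g by exact: within_clamp_continuous.
have g_id s : 0 <= s <= 1 -> g s = f s by move=> s01; rewrite /g /= clamp_id.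
have g0 : g 0 = f 0 by rewrite g_id// lexx ler01.
have g1 : g 1 = f 0 by rewrite g_id// ?f01// lexx ler01.
exists (fun rs => g 0 + (1 - rs.1) *: (g rs.2 - g 0)); split.
- apply: continuous_subspaceT => -[r s].
  have g2 : {for (r, s), continuous (fun rs : R * R => g rs.2)}.
    by apply: (@continuous_comp _ _ _ snd g); [exact: cvg_snd|exact: gc].
  apply: cvgD; first exact: cvg_cst.
  apply: cvgZ; first by apply: cvgB; [exact: cvg_cst|exact: cvg_fst].
  apply: cvgB; last exact: cvg_cst.
  exact: g2.
- by move=> s s01; rewrite /= subr0 scale1r addrC subrK g_id.
- by move=> s _; rewrite /= subrr scale0r addr0.
- by move=> r _; rewrite /= g1 g0 subrr scaler0 addr0.
Qed.

Lemma scaled_metric_sym (k : R) x : (k *: @model_metric R x)^T = k *: model_metric x.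
Proof. by rewrite linearZ /= model_metric_sym. Qed.

Lemma scaled_metric_pos (k : R) x (v : 'rV[R]_4) : 0 < k -> v != 0 ->
  0 < (v *m (k *: model_metric x) *m v^T) 0 0.
Proof.
by move=> k0 v0; rewrite -scalemxAr -scalemxAl mxE mulr_gt0// model_metric_pos.
Qed.

Lemma scaled_metric_smooth (k : R) (c : chart R 4 (euclidean_manifold R 4)) :
  mf_atlas (euclidean_manifold R 4) c ->
  smooth_on (chart_fun c @` chart_dom c)
    (fun x => let p := chart_inv c x in
      let J := jacobian (chart_fun (mf_chart p) \o chart_inv c) x in
      J *m (k *: model_metric p) *m J^T).
Proof.
move=> ac j; have h := model_metric_smooth ac j.
apply: (@Ck_on_congr _ _ _ _ _ (fun x => let p := chart_inv c x in
      let J := jacobian (chart_fun (mf_chart p) \o chart_inv c) x in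
      k *: (J *m model_metric p *m J^T))).
- exact: chart_img_open.
- by move=> x _; rewrite /= -scalemxAr -scalemxAl.
- by apply: Ck_onZ => //; [exact: chart_img_open|exact: Ck_on_cst].
Qed.

(** A Riemannian covering has to be isometric, so the metric is scaled by the factor of the covering
    homothety. *)
Definition scaled_model (k : R) (k0 : 0 < k) : riemannian R 4 :=
  @Riemannian R 4 (euclidean_manifold R 4) (fun x => k *: model_metric x)
    (scaled_metric_sym k) (fun x v => scaled_metric_pos x k0)
    (@scaled_metric_smooth k).

(** The lift between N and the scaled model is an isometry, and the scaled model differs from the
    model by the factor k. *)
Lemma EPS_universal_covering (M : riemannian R 4) : EPS_space M ->
  (exists (N : riemannian R 4) (pi : N -> M), riemannian_universal_covering pi) /\
  (forall (N : riemannian R 4) (pi : N -> M),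
     riemannian_universal_covering pi -> homothetic N (model R)).
Proof.
move=> EM; have [k [F [k0 cF sF FE]]] := EPS_covering EM.
have uF : riemannian_universal_covering (F : scaled_model k0 -> M).
  by split=> //; exact: model_simply_connected.
split; first by exists (scaled_model k0), F.
move=> N pi uN; have [S _] := EM.
(* Coverings are onto, so N has a point over the unit. *)
have [a _] : exists a : N, pi a = lg_one S by case: uN => _ [].
have [G [dG GE]] := riemannian_covering_isometry a uN uF.
exists G; split; first exact: dG.
exists k^-1; rewrite invr_gt0; split=> // p.
rewrite -GE /pullback_metric -scalemxAr -scalemxAl scalerA mulVf ?scale1r//.
exact: lt0r_neq0.
Qed.

End ModelTopology.

(** * Lengths, distances and completeness *)

Section Completeness.
Variable R : realType.
Local Notation mu := (@lebesgue_measure R).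

Lemma continuous_integrable (f : R -> R) (a b : R) : continuous f ->
  mu.-integrable `[a, b] (EFin \o f).
Proof.
move=> fc; apply: continuous_compact_integrable; first exact: segment_compact.
exact: continuous_subspaceT.
Qed.

(** The bound is used up to the time b only; since sp is nonnegative, its integral over [0, 1] is no
    smaller. *)
Lemma variation_le_integral (F f sp : R -> R) (C : R) : 0 <= C ->
  continuous f -> continuous sp -> (forall s : R, is_derive s 1 F (f s)) ->
  (forall s, 0 <= sp s) -> forall b, 0 <= b <= 1 ->
  (forall s, 0 <= s <= b -> `|f s| <= C * sp s) ->
  `|F b - F 0| <= C * \int[mu]_(s in `[0, 1]) sp s.
Proof.
move=> C0 fc spc dF sp0 b /andP[b0 b1] fb.
have I0 : 0 <= \int[mu]_(s in `[0, 1]) sp s by apply: Rintegral_ge0 => s _.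
have [->|bn0] := eqVneq b 0; first by rewrite subrr normr0 mulr_ge0.
have {}b0 : 0 < b by rewrite lt_neqAle eq_sym bn0.
rewrite -(Rintegral_FTC2 b0 (fun x _ => fc x) (fun x _ => dF x)).
apply: (le_trans (le_normr_Rintegral _ (continuous_integrable _ _ fc))) => //.
have cC : continuous (fun s => C * sp s).
  by move=> s; apply: cvgM; [exact: cvg_cst|exact: spc].
apply: (@le_trans _ _ (\int[mu]_(s in `[0, b]) (C * sp s))).
  apply: le_Rintegral => //; try exact: continuous_integrable.
  by apply: continuous_integrable => s; apply: (cvg_norm (fc s)).
rewrite RintegralZl//; last exact: continuous_integrable.
apply: ler_wpM2l => //; rewrite -subr_ge0 Rintegral_itvB ?bnd_simp//.
- by apply: Rintegral_ge0 => s _.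
- exact: continuous_integrable.
- exact: ltW.
Qed.

Lemma expR_half_sqr (T : R) : expR (T / 2) ^+ 2 = expR T.
Proof. by rewrite expr2 -expRD -splitr. Qed.

Definition model_norm2 (x v : 'rV[R]_4) : R :=
  v 0 0 ^+ 2 + expR (- x 0 0) * v 0 1 ^+ 2 + expR (x 0 0) * v 0 2 ^+ 2
  + expR (x 0 0) * v 0 3 ^+ 2.

Lemma model_norm2E (x v : 'rV[R]_4) :
  (v *m model_metric x *m v^T) 0 0 = model_norm2 x v.
Proof.
rewrite mxE sum4 /model_metric mul_mx_diag !mxE /= /model_norm2; ring.
Qed.

(** In the strip |t| <= T each coefficient of the metric is at least e^(-T). *)
Lemma model_norm2_ge (x v : 'rV[R]_4) (T : R) : `|x 0 0| <= T ->
  v 0 0 ^+ 2 <= model_norm2 x v /\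
  forall j, v 0 j ^+ 2 <= expR T * model_norm2 x v.
Proof.
move=> xT; have := xT; rewrite ler_norml => /andP[xT1 xT2].
have T0 : 0 <= T by exact: le_trans xT.
have e1 : 1 <= expR T * expR (- x 0 0) by rewrite -expRD -expR0 ler_expR; lra.
have e2 : 1 <= expR T * expR (x 0 0) by rewrite -expRD -expR0 ler_expR; lra.
have e3 : 1 <= expR T by rewrite -expR0 ler_expR.
have := expR_ge0 (x 0 0); have := expR_ge0 (- x 0 0).
rewrite /model_norm2.
have sq j := sqr_ge0 (v 0 j).
have s0 := sq 0; have s1 := sq 1; have s2 := sq 2; have s3 := sq 3.
move: (expR T) (expR (- _)) (expR (x 0 0)) e1 e2 e3 => E E1 E2 e1 e2 e3 E10 E20.
split; first by rewrite -!addrA lerDl !addr_ge0// mulr_ge0.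
have E0 : 0 <= E by lra.
have t0 : 0 <= E1 * v 0 1 ^+ 2 by exact: mulr_ge0.
have t2 : 0 <= E2 * v 0 2 ^+ 2 by exact: mulr_ge0.
have t3 : 0 <= E2 * v 0 3 ^+ 2 by exact: mulr_ge0.
have m0 : v 0 0 ^+ 2 <= E * v 0 0 ^+ 2 by rewrite ler_peMl.
have m1 : v 0 1 ^+ 2 <= E * (E1 * v 0 1 ^+ 2) by rewrite mulrA ler_peMl.
have m2 : v 0 2 ^+ 2 <= E * (E2 * v 0 2 ^+ 2) by rewrite mulrA ler_peMl.
have m3 : v 0 3 ^+ 2 <= E * (E2 * v 0 3 ^+ 2) by rewrite mulrA ler_peMl.
have p0 : 0 <= E * v 0 0 ^+ 2 by exact: mulr_ge0.
have p1 := mulr_ge0 E0 t0; have p2 := mulr_ge0 E0 t2; have p3 := mulr_ge0 E0 t3.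
by apply: ord4P; rewrite !mulrDr; lra.
Qed.

(** In the strip |t| <= T each coefficient is at most e^T; the factor 4 counts coordinates, as the
    norm is the largest entry. *)
Lemma model_norm2_le (x v : 'rV[R]_4) (T : R) : `|x 0 0| <= T ->
  model_norm2 x v <= 4 * expR T * `|v| ^+ 2.
Proof.
move=> xT; have := xT; rewrite ler_norml => /andP[xT1 xT2].
have T0 : 0 <= T by exact: le_trans xT.
have e1 : expR (- x 0 0) <= expR T by rewrite ler_expR; lra.
have e2 : expR (x 0 0) <= expR T by rewrite ler_expR; lra.
have e3 : 1 <= expR T by rewrite -expR0 ler_expR.
have sq j : v 0 j ^+ 2 <= `|v| ^+ 2.
  rewrite -[v 0 j ^+ 2]real_normK ?num_real//.
  by rewrite lerXn2r ?nnegrE// normr_entry.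
have m E j : 0 <= E -> E <= expR T -> E * v 0 j ^+ 2 <= expR T * `|v| ^+ 2.
  by move=> E0 ET; apply: ler_pM => //; exact: sqr_ge0.
have m0 : v 0 0 ^+ 2 <= expR T * `|v| ^+ 2 by rewrite -[leLHS]mul1r; exact: m.
rewrite /model_norm2.
have m1 := m _ 1 (expR_ge0 _) e1; have m2 := m _ 2 (expR_ge0 _) e2.
have m3 := m _ 3 (expR_ge0 _) e2; lra.
Qed.

Lemma model_speedE (gam : R -> model R) s :
  speed gam s = Num.sqrt (model_norm2 (gam s) ('D_1 (gam : R -> 'rV[R]_4) s)).
Proof. by rewrite /speed -model_norm2E. Qed.

Lemma model_norm2_ge0 (x v : 'rV[R]_4) : 0 <= model_norm2 x v.
Proof. have m (E y : R) : 0 <= E -> 0 <= E * y ^+ 2 by move=> E0; rewrite mulr_ge0// sqr_ge0.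
by rewrite /model_norm2 !addr_ge0// ?sqr_ge0//; apply: m; exact: expR_ge0. Qed.

Lemma smooth_curve_model (gam : R -> model R) :
  smooth_curve gam -> smooth_on setT (gam : R -> 'rV[R]_4).
Proof. by move=> [_ h] k; exact: (h (@id_chart R 4) erefl k). Qed.

Lemma speed_continuous (gam : R -> model R) : smooth_curve gam -> continuous (speed gam).
Proof.
move=> /smooth_curve_model sg.
have oT : open [set: R] by exact: openT.
have ent j : Ck_on 0 [set: R] (fun s => (gam s : 'rV[R]_4) 0 j).
  exact: Ck_on_entry (sg 0%N).
have dent j : Ck_on 0 [set: R] (fun s => ('D_1 (gam : R -> 'rV[R]_4) s) 0 j).
  by apply: Ck_on_entry => //; exact: (sg 1%N).2.
have c : Ck_on 0 [set: R] (fun s => model_norm2 (gam s) ('D_1 (gam : R -> 'rV[R]_4) s)).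
  have sq j := Ck_onM oT (dent j) (dent j).
  have ex := Ck_on_exp oT (ent 0); have exN := Ck_on_exp oT (Ck_onN oT (ent 0)).
  have t01 := Ck_onD oT (sq 0) (Ck_onM oT exN (sq 1)).
  exact: (Ck_onD oT (Ck_onD oT t01 (Ck_onM oT ex (sq 2))) (Ck_onM oT ex (sq 3))).
move=> s; have -> : speed gam = Num.sqrt \o
    (fun s => model_norm2 (gam s) ('D_1 (gam : R -> 'rV[R]_4) s)).
  by apply/funext => r; rewrite model_speedE.
by apply: continuous_comp; [exact: c|exact: sqrt_continuous].
Qed.

Lemma curve_length_ge0 (gam : R -> model R) : 0 <= curve_length gam.
Proof. by apply: Rintegral_ge0 => s _; exact: sqrtr_ge0. Qed.

(** Since the coefficient of dt^2 is 1, length bounds the variation of t without any constant. This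
    keeps the curve in the strip |t| <= T, where the other coordinates are controlled with the
    factor e^(T/2). *)
Lemma curve_coordinates (gam : R -> model R) (T : R) : smooth_curve gam ->
  `|(gam 0 : 'rV[R]_4) 0 0| + curve_length gam <= T ->
  `|(gam 1 : 'rV[R]_4) 0 0 - (gam 0 : 'rV[R]_4) 0 0| <= curve_length gam /\
  forall j, `|(gam 1 : 'rV[R]_4) 0 j - (gam 0 : 'rV[R]_4) 0 j| <=
    expR (T / 2) * curve_length gam.
Proof.
move=> sgam lT; have sg := smooth_curve_model sgam.
have spc := speed_continuous sgam.
have dg s : differentiable (gam : R -> 'rV[R]_4) s := (sg 1%N).1 s I.
have d1 j (s : R) : is_derive s 1 (fun s => (gam s : 'rV[R]_4) 0 j)
    ('D_1 (gam : R -> 'rV[R]_4) s 0 j).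
  apply: DeriveDef; last by rewrite derive_entry.
  by apply: diff_derivable; exact: differentiable_entry.
have dc j : continuous (fun s => 'D_1 (gam : R -> 'rV[R]_4) s 0 j).
  have c1 : Ck_on 0 [set: R] ('D_1 (gam : R -> 'rV[R]_4)) by exact: (sg 1%N).2.
  by move=> s; exact: (Ck_on_entry 0 j openT c1).
have sp0 s : 0 <= speed gam s by exact: sqrtr_ge0.
have bnd (C v sp2 : R) : 0 <= C -> 0 <= sp2 -> v ^+ 2 <= C ^+ 2 * sp2 -> `|v| <= C * Num.sqrt sp2.
  move=> C0 sp20 h; rewrite -sqrtr_sqr -{1}(ger0_norm C0) -sqrtr_sqr -sqrtrM ?sqr_ge0//.
  exact: ler_wsqrtr.
have t_le b : 0 <= b <= 1 ->
    `|(gam b : 'rV[R]_4) 0 0 - (gam 0 : 'rV[R]_4) 0 0| <= curve_length gam.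
  move=> b01; rewrite -[curve_length gam]mul1r.
  apply: (@variation_le_integral (fun s => (gam s : 'rV[R]_4) 0 0) _ (speed gam) 1 ler01
    (dc 0) spc (d1 0) sp0 b b01) => s _.
  rewrite model_speedE; apply: bnd => //; first exact: model_norm2_ge0.
  by rewrite expr1n mul1r; have [] := model_norm2_ge ('D_1 (gam : R -> 'rV[R]_4) s) (lexx `|(gam s : 'rV[R]_4) 0 0|).
split; first by apply: t_le; rewrite lexx ler01.
move=> j; apply: (@variation_le_integral (fun s => (gam s : 'rV[R]_4) 0 j) _ (speed gam) _ (expR_ge0 _)
    (dc j) spc (d1 j) sp0 1) => [|s s01]; first by rewrite lexx ler01.
rewrite model_speedE; apply: bnd; [exact: expR_ge0|exact: model_norm2_ge0|].
rewrite expR_half_sqr; apply: (model_norm2_ge _ _).2.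
rewrite -[(gam s : 'rV[R]_4) 0 0](subrK ((gam 0 : 'rV[R]_4) 0 0)).
apply: le_trans (ler_normD _ _) _; apply: le_trans lT; rewrite addrC lerD2l.
exact: t_le.
Qed.

Lemma piecewise_coordinates (s : seq (R -> model R)) (p q : model R) (T : R) :
  piecewise_curve p q s ->
  `|(p : 'rV[R]_4) 0 0| + \sum_(gam <- s) curve_length gam <= T ->
  `|(q : 'rV[R]_4) 0 0 - (p : 'rV[R]_4) 0 0| <= \sum_(gam <- s) curve_length gam /\
  forall j, `|(q : 'rV[R]_4) 0 j - (p : 'rV[R]_4) 0 j| <=
    expR (T / 2) * \sum_(gam <- s) curve_length gam.
Proof.
elim: s p => [|gam s IH] p /=.
  by move=> -> _; rewrite big_nil; split=> [|j]; rewrite subrr normr0 ?mulr0.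
move=> [sg <- pq]; rewrite big_cons => lT.
have L0 : 0 <= \sum_(gam <- s) curve_length gam.
  by apply: sumr_ge0 => *; exact: curve_length_ge0.
have lT1 : `|(gam 0 : 'rV[R]_4) 0 0| + curve_length gam <= T by lra.
have [h1 h2] := curve_coordinates sg lT1.
have [|h3 h4] := IH _ pq.
  have := ler_normD ((gam 1 : 'rV[R]_4) 0 0 - (gam 0 : 'rV[R]_4) 0 0) ((gam 0 : 'rV[R]_4) 0 0).
  by rewrite subrK => h; lra.
have tri j : (q : 'rV[R]_4) 0 j - (gam 0 : 'rV[R]_4) 0 j =
  ((q : 'rV[R]_4) 0 j - (gam 1 : 'rV[R]_4) 0 j) + ((gam 1 : 'rV[R]_4) 0 j - (gam 0 : 'rV[R]_4) 0 j).
  by rewrite addrA subrK.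
split=> [|j]; rewrite tri; apply: le_trans (ler_normD _ _) _.
  by rewrite addrC lerD.
by rewrite mulrDr addrC lerD.
Qed.

Definition line (p q : 'rV[R]_4) (s : R) : model R := p + s *: (q - p).

Lemma line_smooth_on p q : smooth_on setT (line p q : R -> 'rV[R]_4).
Proof.
move=> k; rewrite /line; apply: Ck_onD; [exact: openT|exact: Ck_on_cst|].
by apply: Ck_onZ; [exact: openT|exact: Ck_on_id|exact: Ck_on_cst].
Qed.

Lemma line_smooth p q : smooth_curve (line p q).
Proof.
split; first exact: continuous_line.
by move=> c -> k; exact: Ck_on_sub (@line_smooth_on p q k).
Qed.

Lemma line_derive p q s : 'D_1 (line p q : R -> 'rV[R]_4) s = q - p.
Proof.
have d : derivable (id : 'rV[R]_4 -> 'rV[R]_4) (p + s *: (q - p)) (q - p).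
  exact: derivable_id.
by have [_] := is_derive_line d; rewrite derive_id.
Qed.

Lemma line_length (p q : 'rV[R]_4) (T : R) : `|p 0 0| <= T -> `|q 0 0| <= T ->
  curve_length (line p q) <= 2 * expR (T / 2) * `|q - p|.
Proof.
move=> pT qT; set K := _ * `|q - p|.
have -> : K = \int[mu]_(_ in `[0, 1]) K.
  by rewrite Rintegral_cst//= lebesgue_measure_itv/= lte01 oppr0 adde0 mulr1.
apply: le_Rintegral => //.
- exact/continuous_integrable/speed_continuous/line_smooth.
- by apply: continuous_integrable => s; exact: cvg_cst.
move=> s; rewrite /= in_itv/= => /andP[s0 s1].
rewrite model_speedE line_derive.
have K0 : 0 <= K by rewrite !mulr_ge0// expR_ge0.
rewrite -(ger0_norm K0) -sqrtr_sqr; apply: ler_wsqrtr.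
have -> : K ^+ 2 = 4 * expR T * `|q - p| ^+ 2.
  by rewrite /K !exprMn expR_half_sqr -natrX.
apply: model_norm2_le; rewrite !mxE.
have -> : p 0 0 + s * (q 0 0 - p 0 0) = (1 - s) * p 0 0 + s * q 0 0 by ring.
apply: le_trans (ler_normD _ _) _; rewrite !normrM (ger0_norm s0) ger0_norm ?subr_ge0//.
have h1 : (1 - s) * `|p 0 0| <= (1 - s) * T by rewrite ler_wpM2l// subr_ge0.
have h2 : s * `|q 0 0| <= s * T by rewrite ler_wpM2l.
lra.
Qed.

Definition lengths (p q : model R) : set R :=
  [set \sum_(gam <- s) curve_length gam | s in piecewise_curve p q].

Lemma line_piecewise (p q : model R) : piecewise_curve p q [:: line p q].
Proof.
split; first exact: line_smooth.
  by rewrite /line scale0r addr0.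
by rewrite /= /line scale1r addrC subrK.
Qed.

Lemma lengths_ge0 p q x : lengths p q x -> 0 <= x.
Proof. by move=> [s _ <-]; apply: sumr_ge0 => *; exact: curve_length_ge0. Qed.

Lemma lengths_has_inf p q : has_inf (lengths p q).
Proof.
split; last by exists 0 => x; exact: lengths_ge0.
by exists (\sum_(gam <- [:: line p q]) curve_length gam), [:: line p q] => //; exact: line_piecewise.
Qed.

Lemma distance_ge0 (p q : model R) : 0 <= riemannian_distance p q.
Proof.
apply: lb_le_inf; first by have [] := lengths_has_inf p q.
by move=> x; exact: lengths_ge0.
Qed.

Lemma distance_le (p q : model R) (T : R) : `|(p : 'rV[R]_4) 0 0| <= T ->
  `|(q : 'rV[R]_4) 0 0| <= T ->
  riemannian_distance p q <= 2 * expR (T / 2) * `|(q : 'rV[R]_4) - (p : 'rV[R]_4)|.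
Proof.
move=> pT qT; apply: le_trans (line_length pT qT).
apply: ge_inf; first by have [] := lengths_has_inf p q.
by exists [:: line p q]; [exact: line_piecewise|rewrite big_seq1].
Qed.

Lemma distance_ge (p q : model R) (T e : R) : `|(p : 'rV[R]_4) 0 0| + e <= T ->
  riemannian_distance p q < e ->
  `|(q : 'rV[R]_4) 0 0 - (p : 'rV[R]_4) 0 0| <= e /\
  `|(q : 'rV[R]_4) - (p : 'rV[R]_4)| <= expR (T / 2) * e.
Proof.
move=> pT de; have [x [s pq <-] se] := inf_lt (lengths_has_inf p q).1 de.
have sT : `|(p : 'rV[R]_4) 0 0| + \sum_(gam <- s) curve_length gam <= T.
  by apply: le_trans pT; rewrite lerD2l ltW.
have [h1 h2] := piecewise_coordinates pq sT.
split; first by apply: le_trans h1 _; exact: ltW.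
have e0 : 0 <= expR (T / 2) * e.
  by apply: mulr_ge0; [exact: expR_ge0|apply: le_trans (distance_ge0 p q) (ltW de)].
apply: normr_mx_le => // i j; rewrite (ord1 i) !mxE.
by apply: le_trans (h2 j) _; rewrite ler_wpM2l ?expR_ge0// ltW.
Qed.

Lemma model_complete : complete_riemannian (model R).
Proof.
move=> u uC.
have [K1 K1P] := uC 1 ltr01.
(* One unit of slack beyond the bound T - 1 for |t|, so that [distance_ge] applies with every radius
   up to 1. *)
pose T := `|(u K1 : 'rV[R]_4) 0 0| + 2.
have uT i : (K1 <= i)%N -> `|(u i : 'rV[R]_4) 0 0| <= T - 1.
  move=> K1i; have [] := @distance_ge (u K1) (u i) T 1 _ (K1P _ _ (leqnn _) K1i).
    by rewrite /T; lra.
  move=> h _; have := ler_normD ((u i : 'rV[R]_4) 0 0 - (u K1 : 'rV[R]_4) 0 0) ((u K1 : 'rV[R]_4) 0 0).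
  by rewrite subrK /T; lra.
(* In the strip, small distances give small Euclidean distances up to the factor e^(T/2), so the
   sequence is Cauchy in R^4. *)
have eC (e : R) : 0 < e -> exists K, forall i j, (K <= i)%N -> (K <= j)%N ->
    `|(u j : 'rV[R]_4) - (u i : 'rV[R]_4)| < e.
  move=> e0; pose d := Num.min 1 (e / (2 * expR (T / 2))).
  have E0 := expR_gt0 (T / 2).
  have d0 : 0 < d by rewrite /d lt_min ltr01 divr_gt0// mulr_gt0.
  have [K KP] := uC _ d0; exists (maxn K K1) => i j; rewrite !geq_max => /andP[Ki K1i] /andP[Kj _].
  have [] := @distance_ge (u i) (u j) T d _ (KP _ _ Ki Kj).
    have := uT _ K1i; have : d <= 1 by rewrite /d ge_min lexx.
    lra.
  move=> _ h; apply: (le_lt_trans h); have : d <= e / (2 * expR (T / 2)) by rewrite /d ge_min lexx orbT.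
  rewrite ler_pdivlMr ?mulr_gt0// => h'.
  have -> : expR (T / 2) * d = (d * (2 * expR (T / 2))) / 2 by field.
  lra.
have [p up] : exists p : 'rV[R]_4, (fun i => u i : 'rV[R]_4) @ \oo --> p.
  apply/cvg_ex/cauchy_cvgP/cauchy_exP => e e0; have [K KP] := eC e e0.
  exists (u K : 'rV[R]_4); exists K => // i /= Ki.
  by rewrite -ball_normE /= distrC; exact: KP.
exists p.
have pd : `|p - (u i : 'rV[R]_4)| @[i --> \oo] --> (0 : R).
  rewrite -[0 in X in _ --> X](normr0 'rV[R]_4) -(subrr p); apply: cvg_norm.
  by apply: cvgB => //; exact: cvg_cst.
(* The strip of half-width T + |p 0 0| contains both the limit and the tail of the sequence. *)
pose C := 2 * expR ((T + `|p 0 0|) / 2).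
have Cpd : C * `|p - (u i : 'rV[R]_4)| @[i --> \oo] --> (0 : R).
  by rewrite -(mulr0 C); apply: cvgM => //; exact: cvg_cst.
apply: (@squeeze_cvgr _ _ _ _ (fun=> 0) (fun i => C * `|p - (u i : 'rV[R]_4)|)) => //; last exact: cvg_cst.
exists K1 => // i /= K1i; rewrite distance_ge0 /=; apply: distance_le.
  by have := uT _ K1i; have := normr_ge0 (p 0 0); lra.
by rewrite lerDr /T addr_ge0.
Qed.

End Completeness.

(** * Isometries of the model *)

Section DerivativeRules.
Variables (R : realType) (V : normedModType R).
Implicit Types (f g : V -> R) (x v : V).

Lemma is_derive_mul f g x v df dg : is_derive x v f df -> is_derive x v g dg ->
  is_derive x v (fun y => f y * g y) (df * g x + f x * dg).
Proof.
move=> hf hg; have h := is_deriveM hf hg; apply: (is_derive_eq h).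
by rewrite /GRing.scale/= addrC [g x * _]mulrC.
Qed.

Lemma is_derive_add f g x v df dg : is_derive x v f df -> is_derive x v g dg ->
  is_derive x v (fun y => f y + g y) (df + dg).
Proof. exact: is_deriveD. Qed.

Lemma is_derive_bigsum n (f : 'I_n -> V -> R) x v (df : 'I_n -> R) :
  (forall i, is_derive x v (f i) (df i)) ->
  is_derive x v (fun y => \sum_i f i y) (\sum_i df i).
Proof.
move=> hf; have h := is_derive_sum hf.
have -> : (fun y => \sum_i f i y) = \sum_i f i by apply/funext => y; rewrite fct_sumE.
exact: h.
Qed.

Lemma is_derive_comp_real f (h : R -> R) x v df dh : differentiable f x ->
  'D_v f x = df -> is_derive (f x) 1 h dh ->
  is_derive x v (fun y => h (f y)) (dh * df).
Proof.
move=> hf <- hh; apply: DeriveDef.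
  apply: diff_derivable; apply: (differentiable_comp hf).
  by apply/derivable1_diffP; have [] := hh.
exact: derive_comp_real.
Qed.

Lemma derive_eq0_cst n (h : 'rV[R]_n -> R) :
  (forall y : 'rV[R]_n, differentiable h y) ->
  (forall (y : 'rV[R]_n) i, 'D_('e_i) h y = 0) -> forall y z, h y = h z.
Proof.
move=> dh h0 y z.
have d a : ball (0 : 'rV[R]_n) (`|y| + `|z| + 1) a -> forall b, is_derive a b h 0.
  move=> _ b; apply: DeriveDef; first exact: diff_derivable.
  by rewrite derive_row_sum// big1// => i _; rewrite h0 scaler0.
have inb (a : 'rV[R]_n) : `|a| < `|y| + `|z| + 1 -> ball (0 : 'rV[R]_n) (`|y| + `|z| + 1) a.
  by rewrite -ball_normE /= sub0r normrN.
have nx := normr_ge0 y; have ny := normr_ge0 z.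
by apply: (derive_eq0_ball_cst d); apply: inb; lra.
Qed.

Lemma is_derive_unique f x v d1 d2 : is_derive x v f d1 -> is_derive x v f d2 -> d1 = d2.
Proof. by move=> [_ <-] [_ <-]. Qed.

End DerivativeRules.

(** * Curvature identities for an isometry *)

Section ModelIsometry.
Variable R : realType.

Definition metric_coef (i : 'I_4) (t : R) : R :=
  row4 1 (expR (- t)) (expR t) (expR t) 0 i.
Definition metric_coef' (i : 'I_4) (t : R) : R :=
  row4 0 (- expR (- t)) (expR t) (expR t) 0 i.
Definition inverse_coef (i : 'I_4) (t : R) : R :=
  row4 1 (expR t) (expR (- t)) (expR (- t)) 0 i.
(** The logarithmic derivatives of the inverse metric coefficients; those of the metric are the
    opposite numbers. *)
Definition inverse_sign (i : 'I_4) : R := row4 0 1 (-1) (-1) 0 i.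

Local Notation g := metric_coef.
Local Notation g' := metric_coef'.
Local Notation w := inverse_coef.
Local Notation sg := inverse_sign.

Lemma metric_coefK i t : g i t * w i t = 1.
Proof.
move: i; apply: ord4P; rewrite /metric_coef /inverse_coef !row4E ?mulr1//.
- by rewrite mulrC expRxMexpNx_1.
- by rewrite expRxMexpNx_1.
- by rewrite expRxMexpNx_1.
Qed.

Lemma metric_coef'E i t : g' i t = - sg i * g i t.
Proof.
by move: i; apply: ord4P; rewrite /metric_coef /metric_coef' /inverse_sign !row4E; ring.
Qed.

Lemma is_derive_expN (t : R) : is_derive t 1 (fun s : R => expR (- s)) (- expR (- t)).
Proof. by apply: is_derive_eq; rewrite /GRing.scale /=; ring. Qed.

Lemma is_derive_metric_coef i (t : R) : is_derive t 1 (g i) (g' i t).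
Proof.
move: i; apply: ord4P; rewrite /metric_coef' row4E.
- rewrite (_ : g 0 = cst 1); first exact: is_derive_cst.
  by apply/funext => s; rewrite /metric_coef row4E.
- rewrite (_ : g 1 = fun s : R => expR (- s)); first exact: is_derive_expN.
  by apply/funext => s; rewrite /metric_coef row4E.
- rewrite (_ : g 2 = expR); first exact: is_derive_expR.
  by apply/funext => s; rewrite /metric_coef row4E.
- rewrite (_ : g 3 = expR); first exact: is_derive_expR.
  by apply/funext => s; rewrite /metric_coef row4E.
Qed.

Lemma is_derive_inverse_coef i (t : R) : is_derive t 1 (w i) (sg i * w i t).
Proof.
move: i; apply: ord4P; rewrite /inverse_sign row4E ?mul0r ?mul1r ?mulN1r.
- rewrite (_ : w 0 = cst 1); first exact: is_derive_cst.
  by apply/funext => s; rewrite /inverse_coef row4E.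
- rewrite (_ : w 1 = expR); first exact: is_derive_expR.
  by apply/funext => s; rewrite /inverse_coef row4E.
- rewrite (_ : w 2 = fun s : R => expR (- s)); first exact: is_derive_expN.
  by apply/funext => s; rewrite /inverse_coef row4E.
- rewrite (_ : w 3 = fun s : R => expR (- s)); first exact: is_derive_expN.
  by apply/funext => s; rewrite /inverse_coef row4E.
Qed.

Lemma derive_coord0 (x : 'rV[R]_4) (k : 'I_4) :
  'D_('e_k) (fun y : 'rV[R]_4 => y 0 0) x = (k == 0)%:R.
Proof.
rewrite -(derive_entry _ 0 0 (_ : differentiable id x)); last exact: ex_diff.
by rewrite derive_id mxE eqxx eq_sym.
Qed.

Lemma is_derive_coord0 (h : R -> R) (x : 'rV[R]_4) (k : 'I_4) dh :
  is_derive (x 0 0) 1 h dh ->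
  is_derive x 'e_k (fun y : 'rV[R]_4 => h (y 0 0)) (dh * (k == 0)%:R).
Proof.
move=> hh; apply: (is_derive_comp_real _ (derive_coord0 x k) hh).
exact: differentiable_coord.
Qed.

Lemma sum_delta (m : 'I_4) (h : 'I_4 -> R) : \sum_j (m == j)%:R * h j = h m.
Proof.
rewrite (bigD1 m)//= eqxx mul1r big1 ?addr0// => j jm.
by rewrite eq_sym (negbTE jm) mul0r.
Qed.

(* The Koszul formula and its consequences at one point, with t and T the first
   coordinates of the point and of its image, d the Jacobian and dd the second
   derivatives of the isometry. *)
Section Pointwise.
Variables (t T : R) (d : 'I_4 -> 'I_4 -> R) (dd : 'I_4 -> 'I_4 -> 'I_4 -> R).
Hypothesis ddC : forall k i l, dd k i l = dd i k l.
Hypothesis d_inv : forall j k,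
  \sum_i d i j * w i t * d i k = (j == k)%:R * w j T.
Hypothesis d_derive : forall k i j,
  \sum_l ((dd k i l * g l T + d i l * (g' l T * d k 0)) * d j l
      + d i l * g l T * dd k j l) = (i == j)%:R * (g' i t * (k == 0)%:R).

(** A k i j is the inner product of the second derivative of F along k and i with its derivative
    along j; P is the pullback of the t-derivative of the metric. *)
Let A k i j := \sum_l dd k i l * g l T * d j l.
Let P i j := \sum_l d i l * g' l T * d j l.

Let AC k i j : A k i j = A i k j.
Proof. by apply: eq_bigr => l _; rewrite ddC. Qed.

Let PC i j : P i j = P j i.
Proof. by apply: eq_bigr => l _; ring. Qed.

Let koszul_sum k i j : A k i j + A k j i =
  (k == 0)%:R * ((i == j)%:R * g' i t) - d k 0 * P i j.
Proof.
apply/eqP; rewrite eq_sym subr_eq; apply/eqP.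
rewrite mulrCA [(k == 0)%:R * _]mulrC -d_derive /A /P mulr_sumr -!big_split /=.
apply: eq_bigr => l _; ring.
Qed.

(** A is symmetric in its first two indices, so the cyclic combination of the differentiated
    isometry equations isolates it, as for the Levi-Civita connection. *)
Let koszul k i j : 2 * A k i j =
  (k == 0)%:R * ((i == j)%:R * g' i t) + (i == 0)%:R * ((k == j)%:R * g' k t) -
  (j == 0)%:R * ((k == i)%:R * g' k t) - d k 0 * P i j - d i 0 * P k j + d j 0 * P k i.
Proof.
have h1 := koszul_sum k i j; have h2 := koszul_sum i k j; have h3 := koszul_sum j k i.
rewrite (AC i k) in h2; rewrite (AC j k i) (AC j i k) in h3.
clear ddC d_inv d_derive AC PC koszul_sum; clearbody A P.
by move: (g' i t) (g' k t) (A _ _ _) (A _ _ _) (A _ _ _) h1 h2 h3 => *; lra.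
Qed.

Lemma unit_gradient : \sum_i d i 0 * w i t * d i 0 = 1.
Proof. by rewrite d_inv eqxx /inverse_coef row4E mulr1. Qed.

(** Contracting Koszul's formula with grad T isolates the component 0 of the second derivatives, by
    the inverse isometry equation. Two of the terms in P drop out because the coefficient of dt^2 is
    constant. The terms other than P k i come from the Christoffel symbols, so this reads 2 Hess T =
    P. *)
Lemma hessianE k i :
  2 * dd k i 0 = - (k == 0)%:R * sg i * d i 0 - (i == 0)%:R * sg k * d k 0
    - (k == i)%:R * d 0 0 * g' k t + P k i.
Proof.
have E1 : dd k i 0 = \sum_j A k i j * (w j t * d j 0).
  rewrite /A; under eq_bigr do rewrite mulr_suml.
  rewrite exchange_big /= [LHS](_ : _ = \sum_l dd k i l * g l T *
    ((l == 0)%:R * w l T)).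
    apply: eq_bigr => l _; rewrite -d_inv mulr_sumr; apply: eq_bigr => j _; ring.
  rewrite sum4 /= !mul0r !mulr0 !addr0 mul1r.
  by rewrite -mulrA metric_coefK mulr1.
have E2 m : \sum_j P m j * (w j t * d j 0) = 0.
  rewrite /P; under eq_bigr do rewrite mulr_suml.
  rewrite exchange_big /= [LHS](_ : _ = \sum_l d m l * g' l T *
    ((l == 0)%:R * w l T)).
    by rewrite sum4 /= !mul0r !mulr0 !addr0 /metric_coef' row4E !(mulr0, mul0r).
  apply: eq_bigr => l _; rewrite -d_inv mulr_sumr; apply: eq_bigr => j _; ring.
have E3 := unit_gradient.
rewrite E1 mulr_sumr.
have -> : \sum_j 2 * (A k i j * (w j t * d j 0)) =
    \sum_j ((k == 0)%:R * ((i == j)%:R * g' i t) +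
      (i == 0)%:R * ((k == j)%:R * g' k t) -
      (j == 0)%:R * ((k == i)%:R * g' k t)) * (w j t * d j 0)
    - d k 0 * (\sum_j P i j * (w j t * d j 0))
    - d i 0 * (\sum_j P k j * (w j t * d j 0))
    + P k i * (\sum_i d i 0 * w i t * d i 0).
  rewrite !mulr_sumr -!sumrB -big_split /=; apply: eq_bigr => j _.
  rewrite mulrA koszul; clearbody A P; ring.
rewrite !E2 E3 mulr1 !mulr0 !subr0; congr (_ + _).
have gw m : g' m t * w m t = - sg m.
  by rewrite metric_coef'E -mulrA metric_coefK mulr1.
rewrite (eq_bigr (fun j => (i == j)%:R * ((k == 0)%:R * (g' i t * w j t) * d j 0)
   + (k == j)%:R * ((i == 0)%:R * (g' k t * w j t) * d j 0)
   - (0 == j)%:R * ((k == i)%:R * g' k t * (w j t * d j 0)))); last first.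
  by move=> j _; rewrite [0 == j]eq_sym; ring.
rewrite sumrB big_split /= !sum_delta !gw /inverse_coef row4E; ring.
Qed.

(** The trace of P equals that of the t-derivative of the metric relative to the metric at the image
    point, which is -1 + 1 + 1. *)
Lemma laplacianE : 2 * \sum_i w i t * dd i i 0 = 1 - d 0 0.
Proof.
have trP : \sum_i w i t * P i i = 1.
  under eq_bigr do rewrite mulr_sumr.
  rewrite exchange_big /= [LHS](_ : _ = \sum_l g' l T * ((l == l)%:R * w l T)).
    rewrite sum4 !eqxx !mul1r !metric_coef'E !mulNr -!mulrA !metric_coefK /inverse_sign !row4E.
    lra.
  apply: eq_bigr => l _; rewrite -d_inv mulr_sumr; apply: eq_bigr => j _; ring.
have gw m : w m t * g' m t = - sg m.
  by rewrite mulrC metric_coef'E -mulrA metric_coefK mulr1.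
rewrite -{2}trP mulr_sumr [LHS](_ : _ = \sum_i (- d 0 0 * (w i t * g' i t) - (0 == i)%:R *
   (2 * sg i * w i t * d i 0) + w i t * P i i)).
  have S : \sum_i w i t * g' i t = 1.
    by rewrite sum4 !gw /inverse_sign !row4E; ring.
  by rewrite big_split sumrB /= sum_delta -mulr_sumr S /inverse_sign row4E; ring.
apply: eq_bigr => i _; rewrite mulrCA hessianE eqxx [0 == i]eq_sym /=; clearbody P; ring.
Qed.

(** Pullback by an isometry preserves the norm, and relative to the metric its t-derivative has the
    eigenvalues 0, -1, 1, 1. *)
Lemma hessian_norm : \sum_k \sum_i w k t * w i t *
  (2 * dd k i 0 + (k == 0)%:R * sg i * d i 0 + (i == 0)%:R * sg k * d k 0
    + (k == i)%:R * d 0 0 * g' k t) ^+ 2 = 3.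
Proof.
rewrite [LHS](_ : _ = \sum_k \sum_i w k t * w i t * (P k i * P k i)); last first.
  by apply: eq_bigr => k _; apply: eq_bigr => i _; rewrite hessianE; ring.
rewrite [LHS](_ : _ = \sum_l \sum_m g' l T * g' m T *
    ((\sum_k d k l * w k t * d k m) * (\sum_i d i l * w i t * d i m))).
  rewrite [LHS](_ : _ = \sum_l (g' l T * w l T) ^+ 2); last first.
    apply: eq_bigr => l _; rewrite [LHS](_ : _ = \sum_m (l == m)%:R *
      (g' l T * g' m T * w l T * w l T)).
      by rewrite sum_delta; ring.
    by apply: eq_bigr => m _; rewrite !d_inv; case: (l == m) => /=; ring.
  rewrite sum4 !metric_coef'E -!mulrA !metric_coefK /inverse_sign !row4E; ring.
pose X k i l m := w k t * w i t * (d k l * g' l T * d i l) * (d k m * g' m T * d i m).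
rewrite [LHS](_ : _ = \sum_k \sum_i \sum_l \sum_m X k i l m); last first.
  apply: eq_bigr => k _; apply: eq_bigr => i _.
  have -> : P k i * P k i = \sum_l \sum_m (d k l * g' l T * d i l) * (d k m * g' m T * d i m).
    by rewrite /P mulr_suml; apply: eq_bigr => l _; rewrite mulr_sumr.
  rewrite mulr_sumr; apply: eq_bigr => l _; rewrite mulr_sumr; apply: eq_bigr => m _.
  by rewrite /X mulrA.
rewrite [RHS](_ : _ = \sum_l \sum_m \sum_k \sum_i X k i l m); last first.
  apply: eq_bigr => l _; apply: eq_bigr => m _; rewrite mulr_suml mulr_sumr.
  apply: eq_bigr => k _; rewrite !mulr_sumr; apply: eq_bigr => i _; rewrite /X; ring.
under eq_bigr do rewrite exchange_big; rewrite exchange_big; apply: eq_bigr => l _.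
by under eq_bigr do rewrite exchange_big; rewrite exchange_big.
Qed.

End Pointwise.

(* Bochner's formula for a function of unit gradient, at one point: tau, H and K
   are its first derivatives, its second derivatives, and the third derivatives
   in which the first two indices coincide. *)
Lemma bochner (t : R) (tau : 'I_4 -> R) (H K : 'I_4 -> 'I_4 -> R) :
  (forall k i, H k i = H i k) ->
  \sum_i tau i * w i t * tau i = 1 ->
  \sum_i (2 * (w i t * tau i * H 0 i) + sg i * w i t * tau i ^+ 2) = 0 ->
  (forall k, \sum_i (2 * w i t * H k i ^+ 2 + 2 * (w i t * tau i * K k i) +
     (k == 0)%:R * (4 * (sg i * w i t * tau i * H k i) + sg i ^+ 2 * w i t * tau i ^+ 2)) = 0) ->
  (forall i, \sum_k 2 * ((i == 0)%:R * sg k * w k t * H k k + w k t * K k i) = - H i 0) ->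
  \sum_k \sum_i w k t * w i t *
    (2 * H k i + (k == 0)%:R * sg i * tau i + (i == 0)%:R * sg k * tau k
      + (k == i)%:R * tau 0 * g' k t) ^+ 2 = 3 ->
  [/\ tau 1 = 0, tau 2 = 0 & tau 3 = 0].
Proof.
move=> HC G E1 E2 L HN.
(* The t-derivative of the metric enters only through the products g' w = - sg, so the identity
   becomes polynomial in w and sg. *)
have {}HN : \sum_k \sum_i (w k t * w i t *
    (2 * H k i + (k == 0)%:R * sg i * tau i + (i == 0)%:R * sg k * tau k) ^+ 2
    - (k == i)%:R * (2 * w k t * sg k * tau 0 *
      (2 * H k i + (k == 0)%:R * sg i * tau i + (i == 0)%:R * sg k * tau k)
      - sg k ^+ 2 * tau 0 ^+ 2)) = 3.
  rewrite -HN; apply: eq_bigr => k _; apply: eq_bigr => i _.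
  have gw m : g' m t * w m t = - sg m.
    by rewrite metric_coef'E -mulrA metric_coefK mulr1.
  have [<-|] := eqVneq k i; last by move=> _ /=; ring.
  have -> : w k t * w k t * (2 * H k k + (k == 0)%:R * sg k * tau k + (k == 0)%:R * sg k * tau k +
      true%:R * tau 0 * g' k t) ^+ 2 =
    (w k t * (2 * H k k + (k == 0)%:R * sg k * tau k + (k == 0)%:R * sg k * tau k) +
      tau 0 * (g' k t * w k t)) ^+ 2 by rewrite /=; ring.
  rewrite gw /=; ring.
have w0 i : 0 < w i t.
  by move: i; apply: ord4P; rewrite /inverse_coef row4E ?ltr01 ?expR_gt0.
(* The left-hand side is Ric + 3/4 g on grad T: the other eigenvalues of Ric exceed -3/4 by 1, 1/2
   and 1/2. *)
have key : w 1 t * tau 1 ^+ 2 + 2^-1 * (w 2 t * tau 2 ^+ 2) + 2^-1 * (w 3 t * tau 3 ^+ 2) = 0.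
  pose e2 k := \sum_i (2 * w i t * H k i ^+ 2 + 2 * (w i t * tau i * K k i) +
       (k == 0)%:R * (4 * (sg i * w i t * tau i * H k i) + sg i ^+ 2 * w i t * tau i ^+ 2)).
  pose l i := \sum_k 2 * ((i == 0)%:R * sg k * w k t * H k k + w k t * K k i).
  set hn := (X in X = 3) in HN; set g1 := (X in X = 1) in G; set e1 := (X in X = 0) in E1.
  (* Bochner's formula solved for the curvature term: hn / 4 is |Hess T|^2, the terms in e2 and e1
     add up to half the Laplacian of |dT|^2, and half of l i + H i 0 is the derivative of the
     Laplacian of T. *)
  have -> : w 1 t * tau 1 ^+ 2 + 2^-1 * (w 2 t * tau 2 ^+ 2) + 2^-1 * (w 3 t * tau 3 ^+ 2) =
      3 / 4 * g1 - hn / 4 + (\sum_k w k t * e2 k) / 2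
      - (\sum_i w i t * tau i * (l i + H i 0)) / 2 + e1 / 4.
    rewrite /hn /g1 /e1 /e2 /l !sum4 /= (HC 1 0) (HC 2 0) (HC 3 0) (HC 2 1) (HC 3 1) (HC 3 2).
    rewrite /inverse_sign !row4E (_ : w 0 t = 1); last by rewrite /inverse_coef row4E.
    by field.
  rewrite HN G E1 big1; last by move=> k _; rewrite /e2 E2 mulr0.
  by rewrite big1; [lra|move=> i _; rewrite /l L addNr mulr0].
have sq0 i : 0 <= w i t * tau i ^+ 2 by rewrite mulr_ge0 ?sqr_ge0// ltW.
have s1 := sq0 1; have s2 := sq0 2; have s3 := sq0 3.
have z i : w i t * tau i ^+ 2 = 0 -> tau i = 0.
  by move=> /eqP; rewrite mulf_eq0 (gt_eqF (w0 i)) sqrf_eq0 /= => /eqP.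
by split; apply: z; lra.
Qed.

(** * Rigidity of isometries *)

Variable F : 'rV[R]_4 -> 'rV[R]_4.
Hypothesis sF : smooth_on setT F.
Hypothesis isoF : forall x,
  jacobian F x *m model_metric (F x) *m (jacobian F x)^T = model_metric x.

Let f j : 'rV[R]_4 -> R := fun x => F x 0 j.
Let d i j : 'rV[R]_4 -> R := 'D_('e_i) (f j).
Let dd k i j : 'rV[R]_4 -> R := 'D_('e_k) (d i j).

Let smooth_d i j : smooth_on setT (d i j).
Proof. by move=> k; exact: (Ck_on_entry 0 j openT (sF k.+1)).2. Qed.

Let smooth_dd k i j : smooth_on setT (dd k i j).
Proof. by move=> n; exact: (smooth_d i j n.+1).2. Qed.

Let jacE x i j : jacobian F x i j = d i j x.
Proof. by rewrite jacobian_entry//; exact: (sF 1%N).1. Qed.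

Let ddC k i j : dd k i j = dd i k j.
Proof.
apply/funext => x; apply: (@schwarz _ _ _ setT) => //; first exact: openT.
exact: (Ck_on_entry 0 j openT (sF 2%N)).
Qed.

Let is_derive_d k i j x : is_derive x 'e_k (d i j) (dd k i j x).
Proof. by apply: DeriveDef => //; apply: diff_derivable; exact: (smooth_d i j 1%N).1. Qed.

Let is_derive_dd l k i j x : is_derive x 'e_l (dd k i j) ('D_('e_l) (dd k i j) x).
Proof. by apply: DeriveDef => //; apply: diff_derivable; exact: (smooth_dd k i j 1%N).1. Qed.

Let iso_entry x i j :
  \sum_l d i l x * g l (f 0 x) * d j l x = (i == j)%:R * g i (x 0 0).
Proof.
have := congr1 (fun A : 'M[R]_4 => A i j) (isoF x).
rewrite /model_metric mul_mx_diag [RHS]mxE mxE mulr_natl.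
move=> h; apply: etrans h; apply: eq_bigr => l _.
by rewrite [X in _ = X * _]mxE [X in _ = _ * X]mxE !jacE /metric_coef.
Qed.

(** The isometry equation exhibits two mutually inverse matrices, which may be multiplied in the
    other order. *)
Let iso_inv x j k :
  \sum_i d i j x * w i (x 0 0) * d i k x = (j == k)%:R * w j (f 0 x).
Proof.
pose D t := diag_mx (\row_i w i t) : 'M[R]_4.
have DG (y : 'rV[R]_4) : D (y 0 0) *m model_metric y = 1%:M.
  rewrite /D /model_metric mulmx_diag; apply/matrixP => a b; rewrite !mxE.
  have [->|//] := eqVneq a b; rewrite !mulr1n.
  by have := metric_coefK b (y 0 0); rewrite /metric_coef mxE mulrC.
have : D (x 0 0) *m (jacobian F x *m model_metric (F x) *m (jacobian F x)^T) = 1%:M.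
  by rewrite isoF DG.
rewrite mulmxA => /mulmx1C E.
have {}E : (jacobian F x)^T *m D (x 0 0) *m jacobian F x = D (F x 0 0).
  have := congr1 (mulmxr (D (F x 0 0))) E; rewrite /= mul1mx => <-.
  by rewrite -!mulmxA (mulmx1C (DG (F x))) mulmx1.
have := congr1 (fun A : 'M[R]_4 => A j k) E.
rewrite /D mul_mx_diag [RHS]mxE mxE [X in _ = X *+ _]mxE mulr_natl => h.
apply: etrans h; apply: eq_bigr => l _.
by rewrite [X in _ = X * _]mxE [X in _ = X * _ * _]mxE [X in _ = _ * X * _]mxE !jacE.
Qed.

Let iso_derive x k i j :
  \sum_l ((dd k i l x * g l (f 0 x) + d i l x * (g' l (f 0 x) * d k 0 x)) * d j l x
      + d i l x * g l (f 0 x) * dd k j l x) =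
  (i == j)%:R * (g' i (x 0 0) * (k == 0)%:R).
Proof.
have h1 : is_derive x 'e_k (fun y => \sum_l d i l y * g l (f 0 y) * d j l y)
    (\sum_l ((dd k i l x * g l (f 0 x) + d i l x * (g' l (f 0 x) * d k 0 x)) * d j l x
      + d i l x * g l (f 0 x) * dd k j l x)).
  apply: is_derive_bigsum => l; apply: is_derive_mul; last exact: is_derive_d.
  apply: is_derive_mul; first exact: is_derive_d.
  apply: is_derive_comp_real => //; last exact: is_derive_metric_coef.
  exact: (Ck_on_entry 0 0 openT (sF 1%N)).1.
have hc : is_derive x 'e_k (fun _ : 'rV[R]_4 => (i == j)%:R : R) 0 by exact: is_derive_cst.
have h2 := is_derive_mul hc (is_derive_coord0 k (is_derive_metric_coef i (x 0 0))).
have E : (fun y => \sum_l d i l y * g l (f 0 y) * d j l y) =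
    (fun y : 'rV[R]_4 => (i == j)%:R * g i (y 0 0)).
  by apply/funext => y; exact: iso_entry.
rewrite E in h1; apply: (etrans (is_derive_unique h1 h2)).
by rewrite mul0r add0r.
Qed.

Let gradient_first_derivative (x : 'rV[R]_4) k :
  \sum_i (2 * (w i (x 0 0) * d i 0 x * dd k i 0 x)
    + (k == 0)%:R * (sg i * w i (x 0 0) * d i 0 x ^+ 2)) = 0.
Proof.
have h1 : is_derive x 'e_k (fun y => \sum_i d i 0 y * w i (y 0 0) * d i 0 y)
    (\sum_i ((dd k i 0 x * w i (x 0 0) + d i 0 x * (sg i * w i (x 0 0) * (k == 0)%:R)) * d i 0 x
      + d i 0 x * w i (x 0 0) * dd k i 0 x)).
  apply: is_derive_bigsum => l; apply: is_derive_mul; last exact: is_derive_d.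
  apply: is_derive_mul; first exact: is_derive_d.
  exact: (is_derive_coord0 k (is_derive_inverse_coef l (x 0 0))).
have h2 : is_derive x 'e_k (fun y : 'rV[R]_4 => 1 : R) 0 by exact: is_derive_cst.
have E : (fun y => \sum_i d i 0 y * w i (y 0 0) * d i 0 y) = (fun y : 'rV[R]_4 => 1 : R).
  by apply/funext => y; apply: unit_gradient (F y 0 0) (fun i j => d i j y) _ => j k'; exact: iso_inv.
rewrite E in h1; apply: etrans (is_derive_unique h1 h2).
by apply: eq_bigr => i _; move: (d _ _ _) (dd _ _ _ _) => a b; ring.
Qed.

Let gradient_second_derivative (x : 'rV[R]_4) k :
  \sum_i (2 * w i (x 0 0) * dd k i 0 x ^+ 2 + 2 * (w i (x 0 0) * d i 0 x * 'D_('e_k) (dd k i 0) x) +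
     (k == 0)%:R * (4 * (sg i * w i (x 0 0) * d i 0 x * dd k i 0 x)
       + sg i ^+ 2 * w i (x 0 0) * d i 0 x ^+ 2)) = 0.
Proof.
have dw i := is_derive_coord0 k (is_derive_inverse_coef i (x 0 0)).
have hc (a : R) : is_derive x 'e_k (fun _ : 'rV[R]_4 => a : R) 0 by exact: is_derive_cst.
have h1 : is_derive x 'e_k (fun y => \sum_i (2 * (w i (y 0 0) * d i 0 y * dd k i 0 y)
    + (k == 0)%:R * (sg i * w i (y 0 0) * (d i 0 y * d i 0 y))))
    (\sum_i ((0 * (w i (x 0 0) * d i 0 x * dd k i 0 x)
     + 2 * ((sg i * w i (x 0 0) * (k == 0)%:R * d i 0 x + w i (x 0 0) * dd k i 0 x) * dd k i 0 x
     + w i (x 0 0) * d i 0 x * 'D_('e_k) (dd k i 0) x))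
     + (0 * (sg i * w i (x 0 0) * (d i 0 x * d i 0 x)) + (k == 0)%:R *
     ((0 * w i (x 0 0) + sg i * (sg i * w i (x 0 0) * (k == 0)%:R)) * (d i 0 x * d i 0 x)
     + sg i * w i (x 0 0) * (dd k i 0 x * d i 0 x + d i 0 x * dd k i 0 x))))).
  apply: is_derive_bigsum => i; apply: is_derive_add.
    apply: (is_derive_mul (hc 2)); apply: is_derive_mul; last exact: is_derive_dd.
    by apply: is_derive_mul (dw i) _; exact: is_derive_d.
  apply: (is_derive_mul (hc _)); apply: is_derive_mul.
    exact: is_derive_mul (hc (sg i)) (dw i).
  by apply: is_derive_mul; exact: is_derive_d.
have E : (fun y : 'rV[R]_4 => \sum_i (2 * (w i (y 0 0) * d i 0 y * dd k i 0 y)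
    + (k == 0)%:R * (sg i * w i (y 0 0) * (d i 0 y * d i 0 y)))) = (fun y : 'rV[R]_4 => 0 : R).
  by apply/funext => y; exact: gradient_first_derivative.
rewrite E in h1; apply: etrans (is_derive_unique h1 (hc 0)).
apply: eq_bigr => i _; case: (k == 0) => /=;
  by move: ('D_('e_k) (dd k i 0) x) (d i 0 x) (dd k i 0 x) => a b c; ring.
Qed.

Let laplacian_derivative (x : 'rV[R]_4) i :
  \sum_k 2 * ((i == 0)%:R * sg k * w k (x 0 0) * dd k k 0 x
    + w k (x 0 0) * 'D_('e_k) (dd k i 0) x) = - dd i 0 0 x.
Proof.
have dw k := is_derive_coord0 i (is_derive_inverse_coef k (x 0 0)).
have hc (a : R) : is_derive x 'e_i (fun _ : 'rV[R]_4 => a : R) 0 by exact: is_derive_cst.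
have h1 : is_derive x 'e_i (fun y => 2 * \sum_k w k (y 0 0) * dd k k 0 y)
    (0 * (\sum_k w k (x 0 0) * dd k k 0 x) + 2 * \sum_k
      (sg k * w k (x 0 0) * (i == 0)%:R * dd k k 0 x + w k (x 0 0) * 'D_('e_i) (dd k k 0) x)).
  apply: (is_derive_mul (hc 2)); apply: is_derive_bigsum => k.
  by apply: is_derive_mul (dw k) _; exact: is_derive_dd.
have h2 : is_derive x 'e_i (fun y => 1 + -1 * d 0 0 y) (0 + (0 * d 0 0 x + -1 * dd i 0 0 x)).
  apply: (is_derive_add (hc 1)); apply: (is_derive_mul (hc (-1))); exact: is_derive_d.
have E : (fun y : 'rV[R]_4 => 2 * \sum_k w k (y 0 0) * dd k k 0 y) = (fun y => 1 + -1 * d 0 0 y).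
  apply/funext => y; rewrite mulN1r.
  apply: (@laplacianE (y 0 0) (F y 0 0) (fun i j => d i j y) (fun k i j => dd k i j y)).
  - by move=> k i' l; rewrite ddC.
  - by move=> j k; exact: iso_inv.
  - by move=> k i' j; exact: iso_derive.
rewrite E in h1; have := is_derive_unique h1 h2.
rewrite !mul0r !add0r mulN1r => <-; rewrite mulr_sumr; apply: eq_bigr => k _.
have alg (n s w0 h a b : R) : a = b ->
    2 * (n * s * w0 * h + w0 * a) = 2 * (s * w0 * n * h + w0 * b) by move=> ->; ring.
(* Third derivatives commute as well, which brings the derivative of H k k along i into the form
   used in Bochner's formula. *)
apply: alg; rewrite (ddC k i); apply/esym; apply: (@schwarz _ _ _ setT) => //.
  exact: openT.
exact: (smooth_d k 0 2%N).
Qed.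

Let time_gradient (x : 'rV[R]_4) : [/\ d 1 0 x = 0, d 2 0 x = 0 & d 3 0 x = 0].
Proof.
apply: (@bochner (x 0 0) (fun i => d i 0 x) (fun k i => dd k i 0 x)
  (fun k i => 'D_('e_k) (dd k i 0) x)).
- by move=> k i; rewrite ddC.
- by apply: unit_gradient (F x 0 0) (fun i j => d i j x) _ => j k'; exact: iso_inv.
- have := gradient_first_derivative x 0; apply: etrans; apply: eq_bigr => i _.
  by rewrite eqxx mul1r.
- exact: gradient_second_derivative.
- exact: laplacian_derivative.
- apply: (@hessian_norm (x 0 0) (F x 0 0) (fun i j => d i j x) (fun k i j => dd k i j x)).
  + by move=> k i l; rewrite ddC.
  + by move=> j k; exact: iso_inv.
  + by move=> k i j; exact: iso_derive.
Qed.

Let time_hessian (x : 'rV[R]_4) k i : i != 0 -> dd k i 0 x = 0.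
Proof.
move=> i0; have E : d i 0 = cst 0.
  by apply/funext => y; have [t1 t2 t3] := time_gradient y;
    exact: (@ord4_neq0 (fun i => d i 0 y = 0) t1 t2 t3 i i0).
by rewrite /dd E derive_cst.
Qed.

(** With the other components zero, |dT| = 1 leaves d 0 0 equal to 1 or -1 with vanishing
    t-derivative; the formula for the Laplacian excludes -1. The metric thus determines the
    direction of t. *)
Let time_derivative (x : 'rV[R]_4) : d 0 0 x = 1.
Proof.
have [t1 t2 t3] := time_gradient x.
have g0 := gradient_first_derivative x 0.
have u0 : \sum_i d i 0 x * w i (x 0 0) * d i 0 x = 1.
  by apply: unit_gradient (F x 0 0) (fun i j => d i j x) _ => j k'; exact: iso_inv.
have L : 2 * \sum_k w k (x 0 0) * dd k k 0 x = 1 - d 0 0 x.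
  apply: (@laplacianE (x 0 0) (F x 0 0) (fun i j => d i j x) (fun k i j => dd k i j x)).
  - by move=> k i' l; rewrite ddC.
  - by move=> j k; exact: iso_inv.
  - by move=> k i' j; exact: iso_derive.
have w0 : w 0 (x 0 0) = 1 by rewrite /inverse_coef row4E.
have th i : i != 0 -> dd i i 0 x = 0 by exact: time_hessian.
move: g0 u0 L; rewrite !sum4 t1 t2 t3 eqxx (th 1)// (th 2)// (th 3)// w0 /inverse_sign !row4E.
move: (d 0 0 x) (dd 0 0 0 x) => a b; rewrite !(mulr0, mul0r, addr0, mul1r, mulr1).
move=> ab aa L; have a0 : a != 0 by apply: contra_eq_neq aa => ->; rewrite mul0r eq_sym oner_eq0.
have b0 : b = 0.
  apply/eqP; have : a * b == 0 by apply/eqP; rewrite expr0n /= in ab; lra.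
  by rewrite mulf_eq0 (negbTE a0).
by rewrite b0 in L; lra.
Qed.

Let time_column (x : 'rV[R]_4) i : d i 0 x = (i == 0)%:R.
Proof.
have [t1 t2 t3] := time_gradient x; have [->|i0] := eqVneq i 0; first exact: time_derivative.
exact: (@ord4_neq0 (fun i => d i 0 x = 0) t1 t2 t3 i i0).
Qed.

Let diff_f j x : differentiable (f j) x.
Proof. exact: (Ck_on_entry 0 j openT (sF 1%N)).1. Qed.

Let tau := F 0 0 0.

Let time_translation (x : 'rV[R]_4) : F x 0 0 = x 0 0 + tau.
Proof.
have c0 (y : 'rV[R]_4) : differentiable (fun z : 'rV[R]_4 => z 0 0) y.
  exact: differentiable_coord.
have h y : is_derive y (0 : 'rV[R]_4) (f 0) 0.
  by apply: DeriveDef; [exact: diff_derivable|rewrite deriveE//; exact: linear0].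
have := @derive_eq0_cst _ 4 (fun y => f 0 y + -1 * (y 0 0)) _ _ x 0.
rewrite !mulN1r mxE oppr0 addr0 => E; rewrite (_ : tau = f 0 0)// -E.
- by rewrite addrC subrK.
- move=> y; apply: differentiableD; first exact: diff_f.
  by apply: differentiableM => //; exact: differentiable_cst.
- move=> y i.
  have di := is_derive_d.
  have h1 : is_derive y 'e_i (f 0) (d i 0 y).
    by apply: DeriveDef => //; apply: diff_derivable; exact: diff_f.
  have h2 : is_derive y 'e_i (fun z : 'rV[R]_4 => z 0 0) ((i == 0)%:R).
    by apply: DeriveDef; [exact: diff_derivable|exact: derive_coord0].
  have hc : is_derive y 'e_i (fun _ : 'rV[R]_4 => -1 : R) 0 by exact: is_derive_cst.
  have [_ ->] := is_derive_add h1 (is_derive_mul hc h2).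
  rewrite time_column.
  by rewrite mul0r add0r mulN1r subrr.
Qed.

(** The entry (0, 0) of the isometry equation reads 1 = 1 plus squares with positive weights. *)
Let time_row (x : 'rV[R]_4) l : d 0 l x = (l == 0)%:R.
Proof.
have := iso_entry x 0 0; rewrite sum4 time_derivative /metric_coef !row4E eqxx !mul1r.
have sq (a e : R) : 0 < e -> 0 <= a * e * a /\ (a * e * a = 0 -> a = 0).
  move=> e0; have -> : a * e * a = e * a ^+ 2 by ring.
  split; first by rewrite mulr_ge0 ?sqr_ge0// ltW.
  by move=> /eqP; rewrite mulf_eq0 (gt_eqF e0) sqrf_eq0 /= => /eqP.
have [p1 z1] := sq (d 0 1 x) _ (expR_gt0 (- f 0 x)).
have [p2 z2] := sq (d 0 2 x) _ (expR_gt0 (f 0 x)).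
have [p3 z3] := sq (d 0 3 x) _ (expR_gt0 (f 0 x)).
move: (d 0 1 x * _ * _) (d 0 2 x * _ * _) (d 0 3 x * _ * _) p1 p2 p3 z1 z2 z3 => q1 q2 q3 p1 p2 p3 z1 z2 z3 E.
move: l; apply: ord4P; first exact: time_derivative.
- by rewrite z1//; lra.
- by rewrite z2//; lra.
- by rewrite z3//; lra.
Qed.

Let time_dd (x : 'rV[R]_4) i l : dd 0 i l x = 0.
Proof.
rewrite ddC /dd (_ : d 0 l = cst ((l == 0)%:R)) ?derive_cst//.
by apply/funext => y; exact: time_row.
Qed.

(** As row 0 of the Jacobian is constant, the t-derivative of the isometry equation retains only the
    derivative of the coefficients. *)
Let metric_derivative (x : 'rV[R]_4) i j :
  \sum_l d i l x * g' l (f 0 x) * d j l x = (i == j)%:R * g' i (x 0 0).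
Proof.
have := iso_derive x 0 i j; rewrite eqxx mulr1 => <-; apply: eq_bigr => l _.
by rewrite !time_dd time_row eqxx mul0r mulr0 mulr1 add0r addr0.
Qed.

(** Apart from dt^2, the coefficients g - g' single out d/dxi and g + g' the plane of eta and zeta;
    subtracting and adding the two equations separates these directions. *)
Let blocks (x : 'rV[R]_4) i j :
  d i 1 x * d j 1 x * expR (- tau) = (i == j)%:R * (i == 1)%:R /\
  (d i 2 x * d j 2 x + d i 3 x * d j 3 x) * expR tau =
    (i == j)%:R * ((i == 2)%:R + (i == 3)%:R).
Proof.
have := metric_derivative x i j; have := iso_entry x i j.
rewrite !sum4 !time_column /metric_coef /metric_coef' !row4E.
have -> : f 0 x = x 0 0 + tau by exact: time_translation.
rewrite opprD !expRD.
have := expRxMexpNx_1 (x 0 0); have := expR_gt0 (x 0 0).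
move: (expR (x 0 0)) (expR (- x 0 0)) (expR tau) (expR (- tau)) => e e' s s' e0 ee'.
move: (d i 1 x) (d i 2 x) (d i 3 x) (d j 1 x) (d j 2 x) (d j 3 x) => a1 a2 a3 b1 b2 b3.
move=> h1 h2.
have -> : a1 * b1 * s' = e / 2 * ((i == j)%:R * row4 1 e' e e 0 i -
    (i == j)%:R * row4 0 (- e') e e 0 i - (i == 0)%:R * (j == 0)%:R).
  rewrite -h1 -h2.
  transitivity (e * e' * (a1 * b1 * s')); last by field.
  by rewrite ee' mul1r.
have -> : (a2 * b2 + a3 * b3) * s = e' / 2 * ((i == j)%:R * row4 1 e' e e 0 i +
    (i == j)%:R * row4 0 (- e') e e 0 i - (i == 0)%:R * (j == 0)%:R).
  rewrite -h1 -h2.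
  transitivity (e * e' * ((a2 * b2 + a3 * b3) * s)); last by field.
  by rewrite ee' mul1r.
clear h1 h2; move: i j; apply: ord4P; apply: ord4P; rewrite !row4E /=; split; lra.
Qed.

Let constant_metric (x : 'rV[R]_4) i j :
  \sum_l d i l x * g l tau * d j l x = (i == j)%:R.
Proof.
have [b1 b2] := blocks x i j.
rewrite sum4 !time_column /metric_coef !row4E.
move: (d i 1 x) (d i 2 x) (d i 3 x) (d j 1 x) (d j 2 x) (d j 3 x) b1 b2.
move: (expR tau) (expR (- tau)) => s s' a1 a2 a3 c1 c2 c3 b1 b2.
transitivity ((i == 0)%:R * (j == 0)%:R + a1 * c1 * s' + (a2 * c2 + a3 * c3) * s).
  by ring.
rewrite b1 b2; move: i j {b1 b2}; apply: ord4P; apply: ord4P => /=; ring.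
Qed.

(** Koszul's argument for a constant metric: A is symmetric in its first two indices and
    antisymmetric in its last two, hence zero. *)
Let jacobian_constant (x : 'rV[R]_4) k i l : dd k i l x = 0.
Proof.
pose A k i j := \sum_l dd k i l x * g l tau * d j l x.
have AC k' i' j' : A k' i' j' = A i' k' j' by apply: eq_bigr => l' _; rewrite ddC.
have AS k' i' j' : A k' i' j' + A k' j' i' = 0.
  have h1 : is_derive x 'e_k' (fun y => \sum_l d i' l y * g l tau * d j' l y)
    (\sum_l ((dd k' i' l x * g l tau + d i' l x * 0) * d j' l x + d i' l x * g l tau * dd k' j' l x)).
    apply: is_derive_bigsum => l'; apply: is_derive_mul; last exact: is_derive_d.
    have hc : is_derive x 'e_k' (fun _ : 'rV[R]_4 => g l' tau : R) 0 by exact: is_derive_cst.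
    by apply: is_derive_mul hc; exact: is_derive_d.
  have h2 : is_derive x 'e_k' (fun y : 'rV[R]_4 => (i' == j')%:R : R) 0 by exact: is_derive_cst.
  have E : (fun y => \sum_l d i' l y * g l tau * d j' l y) = (fun y : 'rV[R]_4 => (i' == j')%:R : R).
    by apply/funext => y; exact: constant_metric.
  rewrite E in h1; apply: etrans (is_derive_unique h1 h2).
  rewrite /A -big_split; apply: eq_bigr => l' _ /=.
  by move: (dd _ _ _ _) (dd _ _ _ _) (d _ _ _) (d _ _ _) => a b c e; ring.
have A0 j : A k i j = 0.
  have h1 := AS k i j; have h2 := AS i k j; have h3 := AS j k i.
  rewrite (AC i k) in h2; rewrite (AC j k i) (AC j i k) in h3.
  by move: (A k i j) (A k j i) (A i j k) h1 h2 h3 => a b c *; lra.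
(* The vanishing sums are the vector of second derivatives multiplied by an invertible matrix. *)
pose J : 'M[R]_4 := \matrix_(a, b) d a b x.
pose G : 'M[R]_4 := diag_mx (\row_a g a tau).
have JG : J *m (G *m J^T) = 1%:M.
  apply/matrixP => a b; rewrite mulmxA mul_mx_diag mxE [RHS]mxE -(constant_metric x).
  by apply: eq_bigr => c _; rewrite !mxE.
pose v : 'rV[R]_4 := \row_a dd k i a x.
have v0 : v *m (G *m J^T) = 0.
  apply/rowP => b; rewrite mulmxA mul_mx_diag mxE [RHS]mxE; apply: (etrans _ (A0 b)).
  by apply: eq_bigr => c _; rewrite !mxE.
have : v = 0 by rewrite -[v]mulmx1 -(mulmx1C JG) mulmxA v0 mul0mx.
by move=> /rowP/(_ l); rewrite !mxE.
Qed.

Let affine_coordinate (x : 'rV[R]_4) l : F x 0 l = F 0 0 l + \sum_i d i l 0 * x 0 i.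
Proof.
have dC i y : d i l y = d i l 0.
  apply: derive_eq0_cst => [z|z k]; first exact: (smooth_d i l 1%N).1.
  exact: jacobian_constant.
pose h (y : 'rV[R]_4) : R := \sum_i d i l 0 * y 0 i.
have dh y k : is_derive y 'e_k h (d k l 0).
  have -> : d k l 0 = \sum_i (0 * y 0 i + d i l 0 * (k == i)%:R).
    rewrite (eq_bigr (fun i => (k == i)%:R * d i l 0)); first by rewrite sum_delta.
    by move=> i _; rewrite mul0r add0r mulrC.
  apply: is_derive_bigsum => i.
  have hc : is_derive y 'e_k (fun _ : 'rV[R]_4 => d i l 0 : R) 0 by exact: is_derive_cst.
  apply: (is_derive_mul hc); apply: DeriveDef; first exact/diff_derivable/differentiable_coord.
  rewrite -(derive_entry _ 0 i (_ : differentiable id y)); last exact: ex_diff.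
  by rewrite derive_id mxE eqxx eq_sym.
have hd y : differentiable h y.
  have -> : h = \sum_i (fun z : 'rV[R]_4 => d i l 0 * z 0 i).
    by apply/funext => z; rewrite fct_sumE.
  apply: differentiable_sum => i; apply: differentiableM; first exact: differentiable_cst.
  exact: differentiable_coord.
have := @derive_eq0_cst _ 4 (fun y => f l y + -1 * h y) _ _ x 0.
have h0 : h 0 = 0 by rewrite /h big1// => i _; rewrite mxE mulr0.
rewrite h0 mulr0 addr0 => E; rewrite -[RHS]/(f l 0 + h x) -E.
- by rewrite mulN1r subrK.
- move=> y; apply: differentiableD; first exact: diff_f.
  by apply: differentiableM => //; exact: differentiable_cst.
- move=> y i.
  have h1 : is_derive y 'e_i (f l) (d i l y).
    by apply: DeriveDef => //; apply: diff_derivable; exact: diff_f.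
  have hc : is_derive y 'e_i (fun _ : 'rV[R]_4 => -1 : R) 0 by exact: is_derive_cst.
  have [_ ->] := is_derive_add h1 (is_derive_mul hc (dh y i)).
  by rewrite dC mul0r add0r mulN1r subrr.
Qed.

(** By [blocks] at the origin the linear part is block diagonal: 1 on t, a number of absolute value
    e^c on xi, and e^(-c) times an orthogonal matrix on the plane. *)
Lemma isometry_form : exists c p q1 q2 eps kap a b : R,
  [/\ eps ^+ 2 = 1, kap ^+ 2 = 1, a ^+ 2 + b ^+ 2 = 1 &
   forall x : 'rV[R]_4, F x = row4 (x 0 0 + 2 * c) (eps * expR c * x 0 1 + p)
     (expR (- c) * (a * x 0 2 - kap * b * x 0 3) + q1)
     (expR (- c) * (b * x 0 2 + kap * a * x 0 3) + q2)].
Proof.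
pose c := tau / 2.
have ec : expR tau = expR c ^+ 2 by rewrite expR_half_sqr.
have ec' : expR (- tau) = expR (- c) ^+ 2.
  by rewrite -(expR_half_sqr (- tau)) /c mulNr.
have cc := expRxMexpNx_1 c.
have sq0 (y z s : R) : s != 0 -> (y * y + z * z) * s = 0 -> y = 0 /\ z = 0.
  move=> s0 /eqP; rewrite mulf_eq0 (negbTE s0) orbF => /eqP E.
  have y2 : 0 <= y * y by exact: sqr_ge0.
  have z2 : 0 <= z * z by exact: sqr_ge0.
  by split; apply/eqP; rewrite -[_ == 0]orbb -mulf_eq0; apply/eqP; lra.
have e1 : expR tau != 0 by rewrite gt_eqF ?expR_gt0.
have e2 : expR (- tau) != 0 by rewrite gt_eqF ?expR_gt0.
have B i j := blocks 0 i j.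
have [b11 z1] := B 1 1; have [b22 c22] := B 2 2; have [b33 c33] := B 3 3.
have [_ c23] := B 2 3; have [_ z0] := B 0 0; have [y0 _] := B 0 0.
rewrite /= !(mul0r, mulr0, mul1r, addr0, add0r) in b11 z1 b22 c22 b33 c33 c23 z0 y0.
have [d12 d13] := sq0 _ _ _ e1 z1.
have [d02 d03] := sq0 _ _ _ e1 z0.
have sq1 (y : R) : y * y * expR (- tau) = 0 -> y = 0.
  by move=> h; have [] := sq0 y 0 _ e2 _; rewrite ?mulr0 ?addr0.
have d21 := sq1 _ b22; have d31 := sq1 _ b33; have d01 := sq1 _ y0.
have T (x : 'rV[R]_4) : F x 0 0 = x 0 0 + 2 * c by rewrite time_translation mulrC divfK ?pnatr_eq0.
have A1 (x : 'rV[R]_4) : F x 0 1 = F 0 0 1 +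
    (d 0 1 0 * x 0 0 + d 1 1 0 * x 0 1 + d 2 1 0 * x 0 2 + d 3 1 0 * x 0 3).
  by rewrite affine_coordinate sum4.
have A2 (x : 'rV[R]_4) : F x 0 2 = F 0 0 2 +
    (d 0 2 0 * x 0 0 + d 1 2 0 * x 0 1 + d 2 2 0 * x 0 2 + d 3 2 0 * x 0 3).
  by rewrite affine_coordinate sum4.
have A3 (x : 'rV[R]_4) : F x 0 3 = F 0 0 3 +
    (d 0 3 0 * x 0 0 + d 1 3 0 * x 0 1 + d 2 3 0 * x 0 2 + d 3 3 0 * x 0 3).
  by rewrite affine_coordinate sum4.
move: b11 c22 c33 c23 A1 A2 A3 d12 d13 d02 d03 d21 d31 d01; rewrite ec ec'.
move: (d 0 1 0) (d 0 2 0) (d 0 3 0) (d 1 1 0) (d 1 2 0) (d 1 3 0)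
  (d 2 1 0) (d 2 2 0) (d 2 3 0) (d 3 1 0) (d 3 2 0) (d 3 3 0)
  => d01 d02 d03 d11 d12 d13 d21 d22 d23 d31 d32 d33 b11 c22 c33 c23.
move=> + + + d12z d13z d02z d03z d21z d31z d01z.
rewrite {}d12z {}d13z {}d02z {}d03z {}d21z {}d31z {}d01z => A1 A2 A3.
move: T b11 c22 c33 c23 cc; move: (F 0 0 1) (F 0 0 2) (F 0 0 3) A1 A2 A3.
move=> p q1 q2 A1 A2 A3 T; move EE1 : (expR c) => E; move EE2 : (expR (- c)) => E'.
move=> b11 c22 c33 c23 EE.
(* The determinant of the orthogonal matrix of the plane; it determines the image of the second unit
   vector from that of the first. *)
pose kap := (d22 * d33 - d23 * d32) * E ^+ 2.
have k1 : - kap * d23 = d32.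
  transitivity (d32 * ((d22 * d22 + d23 * d23) * E ^+ 2)
    - d22 * ((d22 * d32 + d23 * d33) * E ^+ 2)); first by rewrite /kap; ring.
  by rewrite c22 c23; ring.
have k2 : kap * d22 = d33.
  transitivity (d33 * ((d22 * d22 + d23 * d23) * E ^+ 2)
    - d23 * ((d22 * d32 + d23 * d33) * E ^+ 2)); first by rewrite /kap; ring.
  by rewrite c22 c23; ring.
exists c, p, q1, q2, (d11 * E'), kap, (d22 * E), (d23 * E); split.
- by apply: (etrans _ b11); ring.
- transitivity (((d22 * d22 + d23 * d23) * E ^+ 2) * ((d32 * d32 + d33 * d33) * E ^+ 2)
    - ((d22 * d32 + d23 * d33) * E ^+ 2) ^+ 2); first by rewrite /kap; ring.
  by rewrite c22 c33 c23; ring.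
- by apply: (etrans _ c22); ring.
- move=> x; rewrite EE1 EE2 [LHS]row4_eta T A1 A2 A3 !mul0r !addr0 !add0r.
  congr (row4 _ _ _ _).
  + transitivity (p + d11 * (E * E') * x 0 1); [by rewrite EE mulr1|ring].
  + transitivity (q1 + (E * E') * (d22 * x 0 2 + - kap * d23 * x 0 3)); last by ring.
    by rewrite EE mul1r k1.
  + transitivity (q2 + (E * E') * (d23 * x 0 2 + kap * d22 * x 0 3)); last by ring.
    by rewrite EE mul1r k2.
Qed.

End ModelIsometry.

(** * The parametrized group of affine isometries *)

Section IsometryMaps.
Variable R : realType.
Implicit Types (x s y : 'rV[R]_4).

(* The isometry with parameters x = (c, p, q1, q2) and s = (eps, kap, a, b) maps
   (t, xi, z) to (t + 2c, eps e^c xi + p, e^(-c) A z + q), where A is the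
   orthogonal matrix [[a, - kap b], [b, kap a]]. *)
Definition isom_map x s y : 'rV[R]_4 := row4 (y 0 0 + 2 * x 0 0)
  (s 0 0 * expR (x 0 0) * y 0 1 + x 0 1)
  (expR (- x 0 0) * (s 0 2 * y 0 2 - s 0 1 * s 0 3 * y 0 3) + x 0 2)
  (expR (- x 0 0) * (s 0 3 * y 0 2 + s 0 1 * s 0 2 * y 0 3) + x 0 3).

(** An element of O(1) x O(2): the second sign is the determinant of the plane matrix, and the unit
    vector is its first column. *)
Definition is_sign s : Prop :=
  [/\ s 0 0 ^+ 2 = 1, s 0 1 ^+ 2 = 1 & s 0 2 ^+ 2 + s 0 3 ^+ 2 = 1].

Definition trans_mul x s x' : 'rV[R]_4 := row4 (x 0 0 + x' 0 0)
  (s 0 0 * expR (x 0 0) * x' 0 1 + x 0 1)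
  (expR (- x 0 0) * (s 0 2 * x' 0 2 - s 0 1 * s 0 3 * x' 0 3) + x 0 2)
  (expR (- x 0 0) * (s 0 3 * x' 0 2 + s 0 1 * s 0 2 * x' 0 3) + x 0 3).

Definition sign_mul s s' : 'rV[R]_4 := row4 (s 0 0 * s' 0 0) (s 0 1 * s' 0 1)
  (s 0 2 * s' 0 2 - s 0 1 * s 0 3 * s' 0 3) (s 0 3 * s' 0 2 + s 0 1 * s 0 2 * s' 0 3).

Definition trans_inv x s : 'rV[R]_4 := row4 (- x 0 0)
  (- (s 0 0 * expR (- x 0 0) * x 0 1))
  (- (expR (x 0 0) * (s 0 2 * x 0 2 + s 0 3 * x 0 3)))
  (- (expR (x 0 0) * (s 0 1 * (s 0 2 * x 0 3 - s 0 3 * x 0 2)))).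

Definition sign_inv s : 'rV[R]_4 := row4 (s 0 0) (s 0 1) (s 0 2) (- (s 0 1 * s 0 3)).

Definition sign_one : 'rV[R]_4 := row4 1 1 1 0.

Lemma sign_one_sign : is_sign sign_one.
Proof. by split; rewrite !row4E; ring. Qed.

Lemma sign_mul_sign s s' : is_sign s -> is_sign s' -> is_sign (sign_mul s s').
Proof.
move=> [h0 h1 h2] [h0' h1' h2']; split; rewrite !row4E ?exprMn ?h0 ?h0' ?h1 ?h1' ?mulr1//.
transitivity ((s 0 2 ^+ 2 + s 0 3 ^+ 2) * s' 0 2 ^+ 2
  + s 0 1 ^+ 2 * (s 0 2 ^+ 2 + s 0 3 ^+ 2) * s' 0 3 ^+ 2); first by ring.
by rewrite h1 h2 !mul1r.
Qed.

Lemma sign_inv_sign s : is_sign s -> is_sign (sign_inv s).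
Proof. by move=> [h0 h1 h2]; split; rewrite !row4E// sqrrN exprMn h1 mul1r. Qed.

Lemma sign_cases (k : R) : k ^+ 2 = 1 -> k = 1 \/ k = -1.
Proof. by move=> /eqP; rewrite sqrf_eq1 => /orP[/eqP|/eqP]; [left|right]. Qed.

Lemma isom_map_mul x s x' s' y : is_sign s ->
  isom_map (trans_mul x s x') (sign_mul s s') y = isom_map x s (isom_map x' s' y).
Proof.
move=> [_ h1 _]; rewrite /isom_map /trans_mul /sign_mul !row4E opprD !expRD.
by case: (sign_cases h1) => ->; congr (row4 _ _ _ _); ring.
Qed.

Lemma isom_map_one y : isom_map 0 sign_one y = y.
Proof.
rewrite /isom_map !row4E !mxE oppr0 expR0 [RHS]row4_eta.
by congr (row4 _ _ _ _); ring.
Qed.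

Lemma isom_map_inv x s y : is_sign s ->
  isom_map (trans_inv x s) (sign_inv s) (isom_map x s y) = y.
Proof.
move=> [h0 h1 h2]; rewrite /isom_map /trans_inv /sign_inv !row4E opprK [RHS]row4_eta.
have := expRxMexpNx_1 (x 0 0); move: (expR (x 0 0)) (expR (- x 0 0)) => e e' ee.
congr (row4 _ _ _ _).
- ring.
- transitivity (s 0 0 ^+ 2 * (e * e') * y 0 1); first by ring.
  by rewrite h0 ee; ring.
- transitivity ((s 0 2 ^+ 2 + s 0 3 ^+ 2) * (e * e') * y 0 2).
    by case: (sign_cases h1) => ->; ring.
  by rewrite h2 ee; ring.
- transitivity (s 0 1 ^+ 2 * (s 0 2 ^+ 2 + s 0 3 ^+ 2) * (e * e') * y 0 3).
    by case: (sign_cases h1) => ->; ring.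
  by rewrite h1 h2 ee; ring.
Qed.

(** The images of the origin and of the unit vectors of xi, eta and zeta determine all parameters;
    kap is recovered from kap a and kap b because a^2 + b^2 = 1. *)
Lemma isom_map_inj x s x' s' : is_sign s -> is_sign s' ->
  isom_map x s =1 isom_map x' s' -> x = x' /\ s = s'.
Proof.
move=> [_ _ h2] [_ _ h2'] E.
have E0 := E 0; have E1 := E (row4 0 1 0 0); have E2 := E (row4 0 0 1 0).
have E3 := E (row4 0 0 0 1).
have cmp (u v : 'rV[R]_4) j : u = v -> u 0 j = v 0 j by move=> ->.
have a0 := cmp _ _ 0 E0; have a1 := cmp _ _ 1 E0.
have a2 := cmp _ _ 2 E0; have a3 := cmp _ _ 3 E0.
have b1 := cmp _ _ 1 E1; have b2 := cmp _ _ 2 E2; have b3 := cmp _ _ 3 E2.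
have c2 := cmp _ _ 2 E3; have c3 := cmp _ _ 3 E3.
rewrite /isom_map !row4E ?mxE in a0 a1 a2 a3 b1 b2 b3 c2 c3.
have x0 : x 0 0 = x' 0 0 by lra.
move: a1 a2 a3 b1 b2 b3 c2 c3; rewrite x0 !(mulr0, mulr1, oppr0, subr0, sub0r, addr0, add0r).
move=> a1 a2 a3; rewrite a1 a2 a3 => /addIr b1 /addIr b2 /addIr b3 /addIr c2 /addIr c3.
have e0 : expR (x' 0 0) != 0 by rewrite gt_eqF ?expR_gt0.
have e0' : expR (- x' 0 0) != 0 by rewrite gt_eqF ?expR_gt0.
have s0 := mulIf e0 b1; have s2 := mulfI e0' b2; have s3 := mulfI e0' b3.
have {}c2 := oppr_inj (mulfI e0' c2); have {}c3 := mulfI e0' c3.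
have s1 : s 0 1 = s' 0 1.
  transitivity (s 0 1 * (s 0 2 ^+ 2 + s 0 3 ^+ 2)); first by rewrite h2 mulr1.
  transitivity (s' 0 1 * (s' 0 2 ^+ 2 + s' 0 3 ^+ 2)); last by rewrite h2' mulr1.
  rewrite s2 s3 in c2 c3 *; rewrite !mulrDr !expr2 !mulrA.
  by rewrite c2 c3.
by split; apply/rowP; apply: ord4P.
Qed.

Lemma isom_map_invr x s y : is_sign s ->
  isom_map x s (isom_map (trans_inv x s) (sign_inv s) y) = y.
Proof.
move=> gs; have gs' := sign_inv_sign gs.
have inj : injective (isom_map (trans_inv x s) (sign_inv s)).
  by apply: can_inj => z; exact: isom_map_inv.
by apply: inj; rewrite isom_map_inv.
Qed.

Definition isom_lin x s : 'M[R]_4 := rows4 (row4 1 0 0 0)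
  (row4 0 (s 0 0 * expR (x 0 0)) 0 0)
  (row4 0 0 (expR (- x 0 0) * s 0 2) (expR (- x 0 0) * s 0 3))
  (row4 0 0 (- (expR (- x 0 0) * (s 0 1 * s 0 3))) (expR (- x 0 0) * (s 0 1 * s 0 2))).

Lemma isom_mapE x s :
  isom_map x s = (fun y => row4 (2 * x 0 0) (x 0 1) (x 0 2) (x 0 3) + y *m isom_lin x s).
Proof.
apply/funext => y; apply/rowP; apply: ord4P;
  rewrite [RHS]mxE /isom_map !row4E [X in _ = _ + X]mxE sum4 /isom_lin !rows4E !row4E; ring.
Qed.

Lemma isom_map_metric x s y : is_sign s ->
  isom_lin x s *m model_metric (isom_map x s y) *m (isom_lin x s)^T = model_metric y.
Proof.
move=> [h0 h1 h2]; rewrite /model_metric mul_mx_diag /isom_map row4E /isom_lin.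
have -> : - (y 0 0 + 2 * x 0 0) = - y 0 0 + (- x 0 0 + - x 0 0) by ring.
have -> : y 0 0 + 2 * x 0 0 = y 0 0 + (x 0 0 + x 0 0) by ring.
rewrite !expRD; have := expRxMexpNx_1 (x 0 0).
move: (expR (x 0 0)) (expR (- x 0 0)) (expR (y 0 0)) (expR (- y 0 0)) => e e' E E' ee.
have R1 z : z = s 0 0 ^+ 2 * (e * e') ^+ 2 * E' -> z = E'.
  by rewrite h0 ee expr1n !mul1r.
have R2 z : z = (s 0 2 ^+ 2 + s 0 3 ^+ 2) * (e * e') ^+ 2 * E -> z = E.
  by rewrite h2 ee expr1n !mul1r.
apply/matrixP; case: (sign_cases h1) => ->; apply: ord4P; apply: ord4P;
  rewrite mxE sum4 !mxE /= ?mulr1n; first [ring | by apply: R1; ring | by apply: R2; ring].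
Qed.

End IsometryMaps.

Section ModelIsometries.
Variable R : realType.
Implicit Types (x s y : 'rV[R]_4).

Lemma isom_map_smooth x s : smooth_map (isom_map x s : model R -> model R).
Proof.
have Tc : continuous (mulmxr (isom_lin x s) : 'rV[R]_4 -> 'rV[R]_4).
  exact: linear_rV_continuous.
split.
  move=> y; rewrite isom_mapE; apply: differentiable_continuous.
  by have [] := affine_is_diff (row4 (2 * x 0 0) (x 0 1) (x 0 2) (x 0 3)) (isom_lin x s) y.
move=> c d -> -> k.
have := Ck_on_comp_affine (row4 (2 * x 0 0) (x 0 1) (x 0 2) (x 0 3)) Tc openT (Ck_on_id k _).
rewrite -[X in Ck_on _ _ X]isom_mapE; exact: Ck_on_sub.
Qed.

Lemma isom_map_isometry x s : is_sign s -> isometries (model R) (isom_map x s).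
Proof.
move=> gs; split.
  exists (isom_map (trans_inv x s) (sign_inv s)); split.
  - by move=> y; exact: isom_map_inv.
  - by move=> y; exact: isom_map_invr.
  - exact: isom_map_smooth.
  - exact: isom_map_smooth.
move=> y; rewrite /pullback_metric.
have -> : differential (isom_map x s : model R -> model R) y = isom_lin x s.
  by rewrite /differential isom_mapE; exact: jacobian_affine.
exact: isom_map_metric.
Qed.

Lemma isometries_modelP (F : model R -> model R) :
  isometries (model R) F <-> exists x s, is_sign s /\ F = isom_map x s.
Proof.
split=> [[[G [_ _ sF _]] iF]|[x [s [gs ->]]]]; last exact: isom_map_isometry.
have sF' : smooth_on setT (F : 'rV[R]_4 -> 'rV[R]_4).
  move=> k; apply: Ck_on_sub (sF.2 (@id_chart R 4) (@id_chart R 4) erefl erefl k).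
  by move=> y _; exists y.
have [c [p [q1 [q2 [eps [kap [a [b [e1 k1 ab FE]]]]]]]]] := isometry_form sF' iF.
exists (row4 c p q1 q2), (row4 eps kap a b); split; first by split; rewrite !row4E.
by apply/funext => y; rewrite FE /isom_map !row4E.
Qed.

Lemma model_transitive (x y : model R) :
  exists2 F, isometries (model R) F & F x = y.
Proof.
pose c := ((y : 'rV[R]_4) 0 0 - (x : 'rV[R]_4) 0 0) / 2.
exists (isom_map (row4 c ((y : 'rV[R]_4) 0 1 - expR c * (x : 'rV[R]_4) 0 1)
  ((y : 'rV[R]_4) 0 2 - expR (- c) * (x : 'rV[R]_4) 0 2)
  ((y : 'rV[R]_4) 0 3 - expR (- c) * (x : 'rV[R]_4) 0 3)) (sign_one R)).
  exact/isom_map_isometry/sign_one_sign.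
rewrite /isom_map !row4E [RHS]row4_eta; congr (row4 _ _ _ _); [|ring..].
by rewrite /c mulrC divfK ?pnatr_eq0// addrC subrK.
Qed.

Lemma model_groupP (F : model R -> model R) :
  model_group R F <-> exists x s, [/\ is_sign s, s 0 0 = 1, s 0 1 = 1 & F = isom_map x s].
Proof.
split.
  move=> [c [p [[a b] [[q1 q2] [w1 ->]]]]].
  exists (row4 c p q1 q2), (row4 1 1 a b); rewrite !row4E; split=> //.
    split; rewrite !row4E ?expr1n//.
    have := w1; rewrite normc_def => /eqP; rewrite eq_complex /= eqxx andbT => /eqP h.
    by have := congr1 (fun z => z ^+ 2) h; rewrite sqr_sqrtr ?expr1n// addr_ge0 ?sqr_ge0.
  apply/funext => y; rewrite /model_map /isom_map !row4E /=.
  by congr (row4 _ _ _ _); ring.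
move=> [x [s [[_ _ h2] s0 s1 ->]]].
exists (x 0 0), (x 0 1), (s 0 2 +i* s 0 3)%C, (x 0 2 +i* x 0 3)%C; split.
  by rewrite normc_def /= h2 sqrtr1.
apply/funext => y; rewrite /model_map /isom_map s0 s1 /=.
by congr (row4 _ _ _ _); ring.
Qed.

End ModelIsometries.

(** * The isometry group as a Lie group *)

Section IsometryGroupTopology.
Variable R : realType.

Definition isometry_params : set 'rV[R]_(4 + 4) := [set l | is_sign (rsubmx l)].

(* The carrier of the isometry group: pairs (x, s) as in [isom_map], with the
   topology induced by R^8. *)
Definition isometry_space : topologicalType := set_type isometry_params.
Local Notation L := isometry_space.
Implicit Types (l : L) (x s : 'rV[R]_4).

Definition trans_part l : 'rV[R]_4 := lsubmx (set_val l).
Definition sign_part l : 'rV[R]_4 := rsubmx (set_val l).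
Local Notation tp := trans_part.
Local Notation sp := sign_part.

Lemma isometry_params_row x s : is_sign s -> row_mx x s \in isometry_params.
Proof. by move=> gs; rewrite inE /isometry_params /= row_mxKr. Qed.

Definition make_isometry x s (gs : is_sign s) : L :=
  exist _ (row_mx x s) (isometry_params_row x gs).

Lemma sign_partP l : is_sign (sp l).
Proof. by have /set_mem := valP l. Qed.

Lemma make_tp x s (gs : is_sign s) : tp (make_isometry x gs) = x.
Proof. by rewrite /trans_part set_valE /= row_mxKl. Qed.

Lemma make_sp x s (gs : is_sign s) : sp (make_isometry x gs) = s.
Proof. by rewrite /sign_part set_valE /= row_mxKr. Qed.

Lemma isometry_space_ext l l' : tp l = tp l' -> sp l = sp l' -> l = l'.
Proof.
move=> h1 h2; apply: val_inj; rewrite -!set_valE.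
by rewrite -[LHS]hsubmxK -[RHS]hsubmxK [lsubmx _]h1 [rsubmx _]h2.
Qed.

Lemma mx_continuous (T : topologicalType) m n (f : T -> 'M[R]_(m, n)) (t0 : T) :
  (forall i j, {for t0, continuous (fun t => f t i j)}) -> {for t0, continuous f}.
Proof.
move=> fc W [P /= nP PW].
have h : \forall t \near t0, forall ij, P ij.1 ij.2 (f t ij.1 ij.2).
  by apply: near_forall_fin => -[i j]; exact: fc (nP i j).
by apply: filterS h => t Pt; apply: PW => i j; exact: (Pt (i, j)).
Qed.

Lemma tp_continuous j : continuous (fun l => tp l 0 j).
Proof.
have -> : (fun l => tp l 0 j) = (fun z : 'rV[R]_(4 + 4) => z 0 (lshift 4 j)) \o set_val.
  by apply/funext => l; rewrite /trans_part mxE.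
move=> l; apply: continuous_comp; first exact: initial_continuous.
exact: coord_continuous.
Qed.

Lemma sp_continuous j : continuous (fun l => sp l 0 j).
Proof.
have -> : (fun l => sp l 0 j) = (fun z : 'rV[R]_(4 + 4) => z 0 (rshift 4 j)) \o set_val.
  by apply/funext => l; rewrite /sign_part mxE.
move=> l; apply: continuous_comp; first exact: initial_continuous.
exact: coord_continuous.
Qed.

Lemma isometry_space_continuous (T : topologicalType) (f : T -> L) (t0 : T) :
  (forall j, {for t0, continuous (fun t => tp (f t) 0 j)}) ->
  (forall j, {for t0, continuous (fun t => sp (f t) 0 j)}) -> {for t0, continuous f}.
Proof.
move=> tc sc.
have vc : {for t0, continuous (fun t => set_val (f t))}.
  apply: mx_continuous => i j; rewrite (ord1 i).
  case: (split_ordP j) => k ->.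
    have -> : (fun t => set_val (f t) 0 (lshift 4 k)) = (fun t => tp (f t) 0 k).
      by apply/funext => t; rewrite /trans_part mxE.
    exact: tc.
  have -> : (fun t => set_val (f t) 0 (rshift 4 k)) = (fun t => sp (f t) 0 k).
    by apply/funext => t; rewrite /sign_part mxE.
  exact: sc.
move=> W [/= U [[B oB <-]] /= Bfx UW].
have n : nbhs t0 ((fun t => set_val (f t)) @^-1` B) by apply: vc; exact: open_nbhs_nbhs.
by apply: filterS n => t Bt; exact: UW.
Qed.

Section ScalarContinuity.
Variable T : topologicalType.
Implicit Types (f g : T -> R).

Lemma scalar_addc f g t : {for t, continuous f} -> {for t, continuous g} ->
  {for t, continuous (fun r => f r + g r)}.
Proof. by move=> fc gc; exact: cvgD fc gc. Qed.

Lemma scalar_oppc f t : {for t, continuous f} -> {for t, continuous (fun r => - f r)}.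
Proof. by move=> fc; exact: cvgN fc. Qed.

Lemma scalar_mulc f g t : {for t, continuous f} -> {for t, continuous g} ->
  {for t, continuous (fun r => f r * g r)}.
Proof. by move=> fc gc; exact: cvgM fc gc. Qed.

Lemma scalar_invc f t : {for t, continuous f} -> f t != 0 ->
  {for t, continuous (fun r => (f r)^-1)}.
Proof. by move=> fc f0; exact: cvgV f0 fc. Qed.

Lemma scalar_expc f t : {for t, continuous f} -> {for t, continuous (fun r => expR (f r))}.
Proof. by move=> fc; apply: continuous_comp fc _; exact: continuous_expR. Qed.

Lemma scalar_cstc (a : R) t : {for t, continuous (fun _ : T => a)}.
Proof. exact: cst_continuous. Qed.

Lemma row4_continuous (f g h k : T -> R) t j : {for t, continuous f} ->
  {for t, continuous g} -> {for t, continuous h} -> {for t, continuous k} ->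
  {for t, continuous (fun r => row4 (f r) (g r) (h r) (k r) 0 j)}.
Proof.
move=> fc gc hc kc; move: j; apply: ord4P.
- by rewrite (_ : (fun r => _) = f)//; apply/funext => r; rewrite row4E.
- by rewrite (_ : (fun r => _) = g)//; apply/funext => r; rewrite row4E.
- by rewrite (_ : (fun r => _) = h)//; apply/funext => r; rewrite row4E.
- by rewrite (_ : (fun r => _) = k)//; apply/funext => r; rewrite row4E.
Qed.

End ScalarContinuity.

Lemma isometry_space_hausdorff : hausdorff_space L.
Proof.
move=> l l' cl; apply/val_inj/(@norm_hausdorff _ 'rV[R]_(4 + 4)) => A B nA nB.
have vc : continuous (set_val : L -> 'rV[R]_(4 + 4)) by exact: initial_continuous.
have [z [Az Bz]] := cl _ _ (vc l _ nA) (vc l' _ nB).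
by exists (set_val z).
Qed.

Lemma isometry_space_second_countable : @second_countable L.
Proof.
have [B cB [oB bB]] := @rV_second_countable R (4 + 4).
exists [set set_val @^-1` U | U in B]; first exact: (sub_countable (card_image_le _ _) cB).
split=> [_ [U BU <-]|l W [/= U [[N oN <-]] /= Nl UW]].
  by exists U => //; exact: oB.
have [V [/= BV Vl] VN] := bB (set_val l) N (open_nbhs_nbhs (conj oN Nl)).
exists (set_val @^-1` V); first by split=> //; exists V.
by move=> z Vz; apply: UW; exact: VN.
Qed.

Definition isometry_map l : 'rV[R]_4 -> 'rV[R]_4 := isom_map (tp l) (sp l).

Definition isometry_mul l l' : L := make_isometry (trans_mul (tp l) (sp l) (tp l'))
  (sign_mul_sign (sign_partP l) (sign_partP l')).

Definition isometry_one : L := make_isometry 0 (sign_one_sign R).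

Definition isometry_inv l : L :=
  make_isometry (trans_inv (tp l) (sp l)) (sign_inv_sign (sign_partP l)).

Lemma isometry_map_inj : injective isometry_map.
Proof.
move=> l l' E; have [h1 h2] := @isom_map_inj R (tp l) (sp l) (tp l') (sp l')
  (sign_partP l) (sign_partP l') (fun y => congr1 (fun f => f y) E).
exact: isometry_space_ext.
Qed.

Lemma isometry_map_mul l l' : isometry_map (isometry_mul l l') = isometry_map l \o isometry_map l'.
Proof.
apply/funext => y; rewrite /isometry_map make_tp make_sp isom_map_mul//.
exact: sign_partP.
Qed.

Lemma isometry_map_one : isometry_map isometry_one = id.
Proof. by apply/funext => y; rewrite /isometry_map make_tp make_sp isom_map_one. Qed.

Lemma isometry_map_inv l : isometry_map (isometry_inv l) \o isometry_map l = id.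
Proof.
apply/funext => y; rewrite /isometry_map make_tp make_sp /= isom_map_inv//.
exact: sign_partP.
Qed.

Lemma isometry_mulA : associative isometry_mul.
Proof. by move=> l l' l''; apply: isometry_map_inj; rewrite !isometry_map_mul. Qed.

Lemma isometry_mul1 : left_id isometry_one isometry_mul.
Proof. by move=> l; apply: isometry_map_inj; rewrite isometry_map_mul isometry_map_one. Qed.

Lemma isometry_mulV : left_inverse isometry_one isometry_inv isometry_mul.
Proof.
by move=> l; apply: isometry_map_inj; rewrite isometry_map_mul isometry_map_inv isometry_map_one.
Qed.

(* The rotation angle phi between l0 and l is recorded as theta = tan (phi / 2). *)
Definition angle_cos l0 s : R := sp l0 0 2 * s 0 2 + sp l0 0 3 * s 0 3.
Definition angle_coord l0 s : R :=
  (sp l0 0 2 * s 0 3 - sp l0 0 3 * s 0 2) / (1 + angle_cos l0 s).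

Definition half_angle_cos (th : R) : R := (1 - th ^+ 2) / (1 + th ^+ 2).
Definition half_angle_sin (th : R) : R := 2 * th / (1 + th ^+ 2).

Definition angle_sign l0 (th : R) : 'rV[R]_4 := row4 (sp l0 0 0) (sp l0 0 1)
  (sp l0 0 2 * half_angle_cos th - sp l0 0 3 * half_angle_sin th)
  (sp l0 0 3 * half_angle_cos th + sp l0 0 2 * half_angle_sin th).

Lemma one_add_sqr_gt0 (th : R) : 0 < 1 + th ^+ 2.
Proof. by rewrite ltr_wpDr ?ltr01// sqr_ge0. Qed.

Lemma one_add_sqr_neq0 (th : R) : 1 + th ^+ 2 != 0.
Proof. by rewrite gt_eqF ?one_add_sqr_gt0. Qed.

Lemma half_angle_norm (th : R) : half_angle_cos th ^+ 2 + half_angle_sin th ^+ 2 = 1.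
Proof. by rewrite /half_angle_cos /half_angle_sin; field; exact: one_add_sqr_neq0. Qed.

Lemma angle_sign_sign l0 th : is_sign (angle_sign l0 th).
Proof.
have [h0 h1 h2] := sign_partP l0; split; rewrite !row4E//.
transitivity ((sp l0 0 2 ^+ 2 + sp l0 0 3 ^+ 2) *
  (half_angle_cos th ^+ 2 + half_angle_sin th ^+ 2)); first by ring.
by rewrite half_angle_norm h2 mulr1.
Qed.

(** Both signs agree with those of l0, being 1 or -1 with positive products, and the relative
    rotation is not the half-turn, where tan (phi / 2) is infinite. *)
Definition chart_domain l0 : set L := [set l | [/\ 0 < sp l0 0 0 * sp l 0 0,
  0 < sp l0 0 1 * sp l 0 1 & 0 < 1 + angle_cos l0 (sp l)]].

Definition chart_map l0 l : 'rV[R]_(4 + 1) :=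
  row_mx (tp l) (const_mx (angle_coord l0 (sp l)) : 'rV[R]_1).

Definition chart_param l0 (y : 'rV[R]_(4 + 1)) : L :=
  make_isometry (lsubmx y) (angle_sign_sign l0 (rsubmx y 0 0)).

Lemma angle_cos_sign l0 th : angle_cos l0 (angle_sign l0 th) = half_angle_cos th.
Proof.
have [_ _ h] := sign_partP l0; rewrite /angle_cos /angle_sign !row4E.
transitivity ((sp l0 0 2 ^+ 2 + sp l0 0 3 ^+ 2) * half_angle_cos th); first by ring.
by rewrite h mul1r.
Qed.

Lemma one_add_half_angle_cos th : 1 + half_angle_cos th = 2 / (1 + th ^+ 2).
Proof. by rewrite /half_angle_cos; field; exact: one_add_sqr_neq0. Qed.

Lemma angle_coord_sign l0 th : angle_coord l0 (angle_sign l0 th) = th.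
Proof.
have [_ _ h] := sign_partP l0; rewrite /angle_coord angle_cos_sign one_add_half_angle_cos.
rewrite /angle_sign !row4E.
transitivity ((sp l0 0 2 ^+ 2 + sp l0 0 3 ^+ 2) * half_angle_sin th / (2 / (1 + th ^+ 2))).
  by congr (_ / _); ring.
rewrite h mul1r /half_angle_sin; field; exact: one_add_sqr_neq0.
Qed.

Lemma chart_param_domain l0 y : chart_domain l0 (chart_param l0 y).
Proof.
have [h0 h1 _] := sign_partP l0; rewrite /chart_domain /= make_sp angle_cos_sign.
rewrite one_add_half_angle_cos /angle_sign !row4E -!expr2 h0 h1; split=> //.
by rewrite divr_gt0// one_add_sqr_gt0.
Qed.

Lemma chart_paramK l0 y : chart_map l0 (chart_param l0 y) = y.
Proof.
rewrite /chart_map make_tp make_sp angle_coord_sign.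
rewrite -[RHS]hsubmxK; congr row_mx; apply/rowP => j.
by rewrite (ord1 j) mxE.
Qed.

Lemma sign_eq (e e' : R) : e ^+ 2 = 1 -> e' ^+ 2 = 1 -> 0 < e * e' -> e = e'.
Proof. by move=> /sign_cases[] -> /sign_cases[] -> => //; lra. Qed.

Lemma chart_mapK l0 l : chart_domain l0 l -> chart_param l0 (chart_map l0 l) = l.
Proof.
move=> [d0 d1 d2]; have [h0 h1 h2] := sign_partP l0; have [h0' h1' h2'] := sign_partP l.
apply: isometry_space_ext.
  by rewrite make_tp /chart_map row_mxKl.
rewrite make_sp /chart_map row_mxKr mxE /angle_sign.
have nz : 1 + angle_cos l0 (sp l) != 0 by rewrite gt_eqF.
have d2' : 0 < (1 + angle_cos l0 (sp l)) ^+ 2 by rewrite exprn_gt0.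
pose si := sp l0 0 2 * sp l 0 3 - sp l0 0 3 * sp l 0 2.
have CS : angle_cos l0 (sp l) ^+ 2 + si ^+ 2 = 1.
  transitivity ((sp l0 0 2 ^+ 2 + sp l0 0 3 ^+ 2) * (sp l 0 2 ^+ 2 + sp l 0 3 ^+ 2)).
    by rewrite /si /angle_cos; ring.
  by rewrite h2 h2' mulr1.
(* This is |1 + e^(i phi)|^2 = 2 (1 + cos phi). *)
have E : (1 + angle_cos l0 (sp l)) ^+ 2 + si ^+ 2 = 2 * (1 + angle_cos l0 (sp l)).
  by transitivity (1 + 2 * angle_cos l0 (sp l) + (angle_cos l0 (sp l) ^+ 2 + si ^+ 2));
    [ring|rewrite CS; ring].
have Ecos : half_angle_cos (angle_coord l0 (sp l)) = angle_cos l0 (sp l).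
  rewrite /half_angle_cos /angle_coord -/si.
  transitivity (((1 + angle_cos l0 (sp l)) ^+ 2 - si ^+ 2) /
    ((1 + angle_cos l0 (sp l)) ^+ 2 + si ^+ 2)).
    field; rewrite nz /= E mulf_neq0// pnatr_eq0//.
  rewrite E (_ : _ - si ^+ 2 = 2 * (1 + angle_cos l0 (sp l)) * angle_cos l0 (sp l)).
    by field.
  transitivity (1 + 2 * angle_cos l0 (sp l) + 2 * angle_cos l0 (sp l) ^+ 2
    - (angle_cos l0 (sp l) ^+ 2 + si ^+ 2)); first by ring.
  by rewrite CS; ring.
have Esin : half_angle_sin (angle_coord l0 (sp l)) = si.
  rewrite /half_angle_sin /angle_coord -/si.
  transitivity (2 * (1 + angle_cos l0 (sp l)) * si /
    ((1 + angle_cos l0 (sp l)) ^+ 2 + si ^+ 2)).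
    by field; rewrite nz /= E mulf_neq0// pnatr_eq0//.
  by rewrite E; field.
rewrite Ecos Esin (sign_eq h0 h0' d0) (sign_eq h1 h1' d1) [RHS]row4_eta.
congr (row4 _ _ _ _).
  transitivity ((sp l0 0 2 ^+ 2 + sp l0 0 3 ^+ 2) * sp l 0 2); last by rewrite h2 mul1r.
  by rewrite /angle_cos /si; ring.
transitivity ((sp l0 0 2 ^+ 2 + sp l0 0 3 ^+ 2) * sp l 0 3); last by rewrite h2 mul1r.
by rewrite /angle_cos /si; ring.
Qed.

End IsometryGroupTopology.

Section ScalarClass.
Variable R : realType.
Local Notation L := (isometry_space R).
Local Notation tp := (@trans_part R).
Local Notation sp := (@sign_part R).

(* Continuity at a point and smoothness on an open set are treated at once, as
   classes of scalar functions closed under the same operations. *)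
Record scalar_class (T : Type) (D : set T) (C : (T -> R) -> Prop) : Prop := ScalarClass {
  class_cst : forall a : R, C (fun=> a);
  class_add : forall f g : T -> R, C f -> C g -> C (fun v => f v + g v);
  class_opp : forall f : T -> R, C f -> C (fun v => - f v);
  class_mul : forall f g : T -> R, C f -> C g -> C (fun v => f v * g v);
  class_exp : forall f : T -> R, C f -> C (fun v => expR (f v));
  class_inv : forall f : T -> R, (forall v, D v -> f v != 0) -> C f ->
    C (fun v => (f v)^-1) }.

Lemma continuous_class (T : topologicalType) (t : T) :
  scalar_class [set t] (fun f => {for t, continuous f}).
Proof.
split.
- by move=> a; exact: scalar_cstc.
- by move=> f g; exact: scalar_addc.
- by move=> f; exact: scalar_oppc.
- by move=> f g; exact: scalar_mulc.
- by move=> f; exact: scalar_expc.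
- by move=> f f0 fc; apply: scalar_invc => //; exact: f0.
Qed.

Lemma Ck_class (V : normedModType R) k (D : set V) : open D ->
  scalar_class D (fun f => Ck_on k D f).
Proof.
move=> oD; split.
- by move=> a; exact: Ck_on_cst.
- by move=> f g; exact: Ck_onD.
- by move=> f; exact: Ck_onN.
- by move=> f g; exact: Ck_onM.
- by move=> f; exact: Ck_on_exp.
- by move=> f f0; exact: Ck_onV.
Qed.

Section Closure.
Variables (T : Type) (D : set T) (C : (T -> R) -> Prop).
Hypothesis cC : scalar_class D C.

Let Ccst := class_cst cC.
Let Cadd := class_add cC.
Let Copp := class_opp cC.
Let Cmul := class_mul cC.
Let Cexp := class_exp cC.

Let Csqr (f : T -> R) : C f -> C (fun v => f v ^+ 2).
Proof. by move=> cf; exact: Cmul. Qed.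

Lemma class_row4 (f g h k : T -> R) j : C f -> C g -> C h -> C k ->
  C (fun v => row4 (f v) (g v) (h v) (k v) 0 j).
Proof.
move=> cf cg ch ck; move: j; apply: ord4P.
- by rewrite (_ : (fun v => _) = f)//; apply/funext => v; rewrite row4E.
- by rewrite (_ : (fun v => _) = g)//; apply/funext => v; rewrite row4E.
- by rewrite (_ : (fun v => _) = h)//; apply/funext => v; rewrite row4E.
- by rewrite (_ : (fun v => _) = k)//; apply/funext => v; rewrite row4E.
Qed.

Definition class_isometry (h : T -> L) : Prop :=
  (forall j, C (fun v => tp (h v) 0 j)) /\ (forall j, C (fun v => sp (h v) 0 j)).

Lemma class_isometry_mul (h h' : T -> L) : class_isometry h -> class_isometry h' ->
  class_isometry (fun v => isometry_mul (h v) (h' v)).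
Proof.
move=> [c1 c2] [c1' c2']; split=> j.
  under [fun v => _]funext do rewrite make_tp.
  by apply: class_row4; do ?[exact: c1|exact: c2|exact: c1'|exact: c2'
    |apply: Cadd|apply: Cmul|apply: Copp|apply: Cexp].
under [fun v => _]funext do rewrite make_sp.
by apply: class_row4; do ?[exact: c1|exact: c2|exact: c1'|exact: c2'
  |apply: Cadd|apply: Cmul|apply: Copp|apply: Cexp].
Qed.

Lemma class_isometry_inv (h : T -> L) : class_isometry h ->
  class_isometry (fun v => isometry_inv (h v)).
Proof.
move=> [c1 c2]; split=> j.
  under [fun v => _]funext do rewrite make_tp.
  by apply: class_row4; do ?[exact: c1|exact: c2
    |apply: Cadd|apply: Cmul|apply: Copp|apply: Cexp].
under [fun v => _]funext do rewrite make_sp.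
by apply: class_row4; do ?[exact: c1|exact: c2
  |apply: Cadd|apply: Cmul|apply: Copp|apply: Cexp].
Qed.

Lemma class_isometry_map (h : T -> L) (g : T -> 'rV[R]_4) : class_isometry h ->
  (forall j, C (fun v => g v 0 j)) -> forall j, C (fun v => isometry_map (h v) (g v) 0 j).
Proof.
move=> [c1 c2] cg j; apply: class_row4;
  by do ?[exact: c1|exact: c2|exact: cg|exact: Ccst
    |apply: Cadd|apply: Cmul|apply: Copp|apply: Cexp].
Qed.

Lemma class_chart_param l0 (g : T -> 'rV[R]_(4 + 1)) :
  (forall j, C (fun v => g v 0 j)) -> class_isometry (fun v => chart_param l0 (g v)).
Proof.
move=> cg; split=> j.
  rewrite (_ : (fun v => _) = (fun v => g v 0 (lshift 1 j)))//.
  by apply/funext => v; rewrite make_tp mxE.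
have cth : C (fun v => rsubmx (g v) 0 0).
  rewrite (_ : (fun v => _) = (fun v => g v 0 (rshift 4 0)))//.
  by apply/funext => v; rewrite mxE.
have cV : C (fun v => (1 + rsubmx (g v) 0 0 ^+ 2)^-1).
  apply: (class_inv cC) => [v _|]; first exact: one_add_sqr_neq0.
  by apply: Cadd => //; exact: Csqr.
under [fun v => _]funext do rewrite make_sp.
have cco : C (fun v => half_angle_cos (rsubmx (g v) 0 0)).
  by apply: Cmul => //; apply: Cadd => //; apply: Copp; exact: Csqr.
have csi : C (fun v => half_angle_sin (rsubmx (g v) 0 0)).
  by apply: Cmul => //; exact: Cmul.
apply: class_row4; do ?[exact: Ccst]; apply: Cadd; do ?[apply: Copp]; exact: Cmul.
Qed.

Lemma class_chart_map l0 (h : T -> L) : class_isometry h ->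
  (forall v, D v -> chart_domain l0 (h v)) ->
  forall j, C (fun v => chart_map l0 (h v) 0 j).
Proof.
move=> [c1 c2] hD j; case: (split_ordP j) => i ->.
  by under [fun v => _]funext do rewrite row_mxEl; exact: c1.
under [fun v => _]funext do rewrite row_mxEr mxE.
have cc : C (fun v => 1 + angle_cos l0 (sp (h v))).
  by apply: Cadd => //; apply: Cadd; apply: Cmul.
apply: Cmul; last first.
  by apply: (class_inv cC) cc => v /hD[_ _ h0]; rewrite gt_eqF.
by apply: Cadd; [|apply: Copp]; apply: Cmul.
Qed.

End Closure.

Lemma id_class (l : L) : class_isometry (fun f => {for l, continuous f}) id.
Proof. by split=> j; [exact: tp_continuous|exact: sp_continuous]. Qed.

Lemma class_continuous (T : topologicalType) (t : T) (h : T -> L) :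
  class_isometry (fun f => {for t, continuous f}) h -> {for t, continuous h}.
Proof. by move=> [h1 h2]; exact: isometry_space_continuous. Qed.

Lemma chart_domain_open (l0 : L) : open (chart_domain l0).
Proof.
have pos (f : L -> R) : continuous f -> open [set l | 0 < f l].
  by move=> fc; apply: (@open_comp _ _ f [set r | 0 < r]) => //; exact: open_gt.
have cst (a : R) j (l : L) : {for l, continuous (fun l => a * sp l 0 j)}.
  by apply: scalar_mulc; [exact: scalar_cstc|exact: sp_continuous].
have -> : chart_domain l0 = [set l | 0 < sp l0 0 0 * sp l 0 0] `&`
    [set l | 0 < sp l0 0 1 * sp l 0 1] `&` [set l | 0 < 1 + angle_cos l0 (sp l)].
  by apply/seteqP; split=> [l [? ? ?]|l [[? ?] ?]].
apply: openI; first by apply: openI; apply: pos => l; exact: cst.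
apply: pos => l.
have h : {for l, continuous (fun l => 1 + angle_cos l0 (sp l))}.
  apply: scalar_addc; first exact: scalar_cstc.
  by apply: scalar_addc; exact: cst.
exact: h.
Qed.

Lemma chart_map_continuous (l0 l : L) : chart_domain l0 l ->
  {for l, continuous (chart_map l0)}.
Proof.
move=> dl; apply: mx_continuous => i j; rewrite (ord1 i).
have dl' v : [set l] v -> chart_domain l0 v by move=> ->.
exact: (class_chart_map (continuous_class l) (id_class l) dl' j).
Qed.

Lemma chart_param_continuous (l0 : L) : continuous (chart_param l0).
Proof.
move=> y; apply: class_continuous.
apply: (class_chart_param (continuous_class y) l0) => j; exact: coord_continuous.
Qed.

Lemma chart_map_image (l0 : L) : chart_map l0 @` chart_domain l0 = setT.
Proof.
apply/seteqP; split=> // y _; exists (chart_param l0 y).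
  exact: chart_param_domain.
exact: chart_paramK.
Qed.

Lemma chart_map_image_open (l0 : L) : open (chart_map l0 @` chart_domain l0).
Proof. by rewrite chart_map_image; exact: openT. Qed.

Definition isometry_chart (l0 : L) : chart R (4 + 1) L :=
  @Chart R (4 + 1) L (chart_domain l0) (chart_map l0) (chart_param l0)
    (@chart_domain_open l0) (@chart_map_image_open l0) (@chart_mapK R l0)
    (@chart_map_continuous l0) (fun y _ => @chart_param_continuous l0 y).

Lemma chart_domain_id (l : L) : chart_domain l l.
Proof.
have [h0 h1 h2] := sign_partP l; rewrite /chart_domain /= /angle_cos -!expr2 h0 h1 h2.
by rewrite !ltr01; split=> //; lra.
Qed.

Lemma chart_composite_smooth (V : normedModType R) (D : set V) (h : V -> L) l0 : open D ->
  (forall k, class_isometry (fun f => Ck_on k D f) h) ->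
  (forall v, D v -> chart_domain l0 (h v)) -> smooth_on D (fun v => chart_map l0 (h v)).
Proof.
move=> oD ch hD k; apply: Ck_on_mx => // i j; rewrite (ord1 i).
exact: (class_chart_map (Ck_class k oD) (ch k) hD).
Qed.

Lemma isometry_transition (c d : chart R (4 + 1) L) :
  range isometry_chart c -> range isometry_chart d ->
  smooth_on (chart_fun c @` (chart_dom c `&` chart_dom d)) (chart_fun d \o chart_inv c).
Proof.
move=> [l1 _ <-] [l2 _ <-]; set D := _ @` _.
have oD : open D by apply: chart_image_open; exact: chart_domain_open.
apply: (@chart_composite_smooth _ D (chart_param l1)) => //.
  move=> k; apply: (class_chart_param (Ck_class k oD)) => j; exact: Ck_on_coord.
by move=> _ [l [d1 d2] <-]; rewrite /= chart_mapK.
Qed.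

Definition isometry_manifold : manifold R (4 + 1) :=
  @Manifold R (4 + 1) L (@isometry_space_hausdorff R) (@isometry_space_second_countable R)
    (range isometry_chart) isometry_chart (fun l => ex_intro2 _ _ l I erefl)
    chart_domain_id isometry_transition.

Lemma isometry_mul_continuous : continuous (fun pq : L * L => isometry_mul pq.1 pq.2).
Proof.
move=> [l l']; apply: class_continuous.
apply: (class_isometry_mul (continuous_class (l, l'))); split=> j.
- by apply: (@continuous_comp _ _ _ fst (fun l => tp l 0 j)); [exact: cvg_fst|exact: tp_continuous].
- by apply: (@continuous_comp _ _ _ fst (fun l => sp l 0 j)); [exact: cvg_fst|exact: sp_continuous].
- by apply: (@continuous_comp _ _ _ snd (fun l => tp l 0 j)); [exact: cvg_snd|exact: tp_continuous].
- by apply: (@continuous_comp _ _ _ snd (fun l => sp l 0 j)); [exact: cvg_snd|exact: sp_continuous].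
Qed.

Lemma isometry_mul_smooth (c d e : chart R (4 + 1) isometry_manifold) :
  mf_atlas isometry_manifold c -> mf_atlas isometry_manifold d ->
  mf_atlas isometry_manifold e ->
  smooth_on
    [set xy | exists p q, [/\ chart_dom c p, chart_dom d q,
       chart_dom e (isometry_mul p q) & xy = (chart_fun c p, chart_fun d q)]]
    (fun xy : 'rV[R]_(4 + 1) * 'rV[R]_(4 + 1) =>
       chart_fun e (isometry_mul (chart_inv c xy.1) (chart_inv d xy.2))).
Proof.
move=> ac ad ae.
have oD := @product_chart_open R (4 + 1) isometry_manifold (@isometry_mul R) c d e
  isometry_mul_continuous.
move: ac ad ae oD => [l1 _ <-] [l2 _ <-] [l3 _ <-]; set D := (X in open X) => oD.
apply: (@chart_composite_smooth _ D (fun xy : 'rV[R]_(4 + 1) * 'rV[R]_(4 + 1) =>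
  isometry_mul (chart_param l1 xy.1) (chart_param l2 xy.2))) => //; last first.
  by move=> _ [p [q [d1 d2 d3 ->]]] /=; rewrite !chart_mapK.
move=> k; apply: (class_isometry_mul (Ck_class k oD));
  apply: (class_chart_param (Ck_class k oD)) => j.
  have h := Ck_on_linear_comp (L := fst) _ oD (Ck_on_id k D).
  by apply: Ck_on_entry => //; apply: h => x; exact: cvg_fst.
have h := Ck_on_linear_comp (L := snd) _ oD (Ck_on_id k D).
by apply: Ck_on_entry => //; apply: h => x; exact: cvg_snd.
Qed.

Lemma isometry_inv_smooth :
  smooth_map (@isometry_inv R : isometry_manifold -> isometry_manifold).
Proof.
have ic : continuous (@isometry_inv R).
  move=> l; apply: class_continuous.
  exact: (class_isometry_inv (continuous_class l) (id_class l)).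
split=> // c d [l1 _ <-] [l2 _ <-]; set D := _ @` _.
have oD : open D.
  apply: chart_image_open; apply: open_comp; first by move=> l _; exact: ic.
  exact: chart_domain_open.
apply: (@chart_composite_smooth _ D (fun y => isometry_inv (chart_param l1 y))) => //.
  move=> k; apply: (class_isometry_inv (Ck_class k oD)).
  by apply: (class_chart_param (Ck_class k oD)) => j; exact: Ck_on_coord.
by move=> _ [l [d1 d2] <-]; rewrite /= chart_mapK.
Qed.

Definition isometry_lie_group : lie_group_structure isometry_manifold :=
  @LieGroupStructure R (4 + 1) isometry_manifold (@isometry_mul R) (isometry_one R)
    (@isometry_inv R) (@isometry_mulA R) (@isometry_mul1 R) (@isometry_mulV R)
    isometry_mul_continuous isometry_mul_smooth isometry_inv_smooth.

End ScalarClass.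

(** * The compact-open topology and the identity component *)

Section IsometryGroup.
Variable R : realType.
Local Notation L := (isometry_space R).
Local Notation tp := (@trans_part R).
Local Notation sp := (@sign_part R).
Local Notation maps := {compact-open, model R -> model R}.

(** The singleton of y is compact, so conditions on the value at y are open. *)
Lemma evaluation_continuous (T U : topologicalType) (y : T) :
  continuous (fun F : {compact-open, T -> U} => F y).
Proof.
move=> F W nW.
have oW : open W^° by exact: open_interior.
have o := @compact_open_open T U [set y] W^° (@compact_set1 _ y) oW.
have n : nbhs F ([set g : T -> U | g @` [set y] `<=` W^°] : set {compact-open, T -> U}).
  by apply: open_nbhs_nbhs; split=> // _ [_ -> <-]; exact: nW.
apply: (@filterS _ _ (nbhs_filter (F : {compact-open, T -> U})) _ _ _ n) => g gW.
exact: (interior_subset (gW _ (ex_intro2 _ _ y erefl erefl))).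
Qed.

(* The parameters of an isometry are read off from its values at the origin and
   at the unit vectors. *)
Definition isom_trans (F : maps) : 'rV[R]_4 :=
  let u := (F 0 : 'rV[R]_4) in row4 (u 0 0 / 2) (u 0 1) (u 0 2) (u 0 3).

(** The second entry is the determinant of the rescaled linear part on the plane of eta and zeta. *)
Definition isom_sign (F : maps) : 'rV[R]_4 :=
  let u := (F 0 : 'rV[R]_4) in let c := u 0 0 / 2 in
  let e1 := (F (row4 0 1 0 0) : 'rV[R]_4) in
  let e2 := (F (row4 0 0 1 0) : 'rV[R]_4) in
  let e3 := (F (row4 0 0 0 1) : 'rV[R]_4) in
  let a := expR c * (e2 0 2 - u 0 2) in let b := expR c * (e2 0 3 - u 0 3) in
  row4 (expR (- c) * (e1 0 1 - u 0 1))
    (a * (expR c * (e3 0 3 - u 0 3)) - b * (expR c * (e3 0 2 - u 0 2))) a b.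

Lemma row0E n k : (0 : 'rV[R]_n) 0 k = 0.
Proof. by rewrite mxE. Qed.

Lemma isom_transK (l : L) : isom_trans (isometry_map l) = tp l.
Proof.
rewrite /isom_trans /isometry_map /isom_map [RHS]row4_eta !row4E !row0E.
by congr (row4 _ _ _ _); field.
Qed.

Lemma isom_signK (l : L) : isom_sign (isometry_map l) = sp l.
Proof.
have [h0 h1 h2] := sign_partP l.
rewrite /isom_sign /isometry_map /isom_map [RHS]row4_eta !row4E !row0E.
have -> : (0 + 2 * tp l 0 0) / 2 = tp l 0 0 by field.
have := expRxMexpNx_1 (tp l 0 0); move: (expR (tp l 0 0)) (expR (- tp l 0 0)) => e e' ee.
congr (row4 _ _ _ _).
- transitivity (e * e' * sp l 0 0); [ring|by rewrite ee mul1r].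
- transitivity ((e * e') ^+ 2 * sp l 0 1 * (sp l 0 2 ^+ 2 + sp l 0 3 ^+ 2)); first by ring.
  by rewrite ee h2; ring.
- transitivity (e * e' * sp l 0 2); [ring|by rewrite ee mul1r].
- transitivity (e * e' * sp l 0 3); [ring|by rewrite ee mul1r].
Qed.

Lemma coordinate_continuous (y : model R) j (F : maps) :
  {for F, continuous (fun G : maps => (G y : 'rV[R]_4) 0 j)}.
Proof.
apply: (@continuous_comp _ _ _ (fun G : maps => G y) (fun z : 'rV[R]_4 => z 0 j)).
  exact: evaluation_continuous.
exact: coord_continuous.
Qed.

Lemma isom_trans_continuous j (F : maps) : {for F, continuous (fun G => isom_trans G 0 j)}.
Proof.
rewrite /isom_trans; apply: row4_continuous; do ?[exact: coordinate_continuous].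
by apply: scalar_mulc; [exact: coordinate_continuous|exact: scalar_cstc].
Qed.

Lemma isom_sign_continuous j (F : maps) : {for F, continuous (fun G => isom_sign G 0 j)}.
Proof.
have cd (y : model R) k := scalar_addc (@coordinate_continuous y k F)
  (scalar_oppc (@coordinate_continuous 0 k F)).
have hc : {for F, continuous (fun _ : maps => 2^-1 : R)} by exact: scalar_cstc.
have c := scalar_mulc (@coordinate_continuous 0 0 F) hc.
have ec := scalar_expc c.
have a := scalar_mulc ec (cd (row4 0 0 1 0) 2); have b := scalar_mulc ec (cd (row4 0 0 1 0) 3).
have k2 := scalar_mulc ec (cd (row4 0 0 0 1) 2); have k3 := scalar_mulc ec (cd (row4 0 0 0 1) 3).
apply: row4_continuous; [|exact: scalar_addc (scalar_mulc a k3) (scalar_oppc (scalar_mulc b k2))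
  |exact: a|exact: b].
exact: scalar_mulc (scalar_expc (scalar_oppc c)) (cd (row4 0 1 0 0) 1).
Qed.

Lemma isometry_map_isometries : range (@isometry_map R) = isometries (model R).
Proof.
apply/seteqP; split=> [_ [l _ <-]|F /isometries_modelP[x [s [gs ->]]]].
  exact/isom_map_isometry/sign_partP.
by exists (make_isometry x gs) => //; rewrite /isometry_map make_tp make_sp.
Qed.

Lemma joint_map_continuous (T : topologicalType) (h : T -> L) (t : T) (g : T -> 'rV[R]_4) :
  {for t, continuous h} -> {for t, continuous g} ->
  {for t, continuous (fun v => isometry_map (h v) (g v))}.
Proof.
move=> hc gc; apply: mx_continuous => i j; rewrite (ord1 i).
apply: (class_isometry_map (continuous_class R t)) => [|k].
  split=> k.
    exact: (continuous_comp hc (@tp_continuous R k (h t))).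
  exact: (continuous_comp hc (@sp_continuous R k (h t))).
exact: (continuous_comp gc (@coord_continuous _ _ _ 0 k (g t))).
Qed.

(** Joint continuity in the parameters and the point becomes continuity into the compact-open
    topology by currying. *)
Lemma isometry_map_continuous : continuous (@isometry_map R : L -> maps).
Proof.
pose f (z : L * model R) : model R := isometry_map z.1 z.2.
have fc : continuous f.
  by move=> z; apply: joint_map_continuous; [exact: cvg_fst|exact: cvg_snd].
exact: (continuous_curry_fun fc).
Qed.

(** The parameters extend, by evaluation at four points, to a continuous map on the whole function
    space; an open set of parameters is cut out by pulling back along it. *)
Lemma isometry_open (A : set L) : open A <->
  exists2 N : set maps, open N & A = @isometry_map R @^-1` N.
Proof.
split=> [[B oB <-]|[N oN ->]]; last first.
  by move/continuousP: isometry_map_continuous; exact.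
pose D (F : maps) : 'rV[R]_(4 + 4) := row_mx (isom_trans F) (isom_sign F).
have Dc : continuous D.
  move=> F; apply: mx_continuous => i j; rewrite (ord1 i).
  case: (split_ordP j) => k ->.
    rewrite (_ : (fun G => D G 0 _) = (fun G => isom_trans G 0 k)).
      exact: isom_trans_continuous.
    by apply/funext => G; rewrite /D row_mxEl.
  rewrite (_ : (fun G => D G 0 _) = (fun G => isom_sign G 0 k)).
    exact: isom_sign_continuous.
  by apply/funext => G; rewrite /D row_mxEr.
exists (D @^-1` B); first by apply: open_comp => // F _; exact: Dc.
apply/seteqP; split=> l /=; rewrite /D isom_transK isom_signK hsubmxK //.
Qed.

Lemma model_isometry_group_dim : isometry_group_dim (model R) 5.
Proof.
exists (isometry_manifold R), (isometry_lie_group R), (@isometry_map R); split.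
- exact: isometry_map_inj.
- exact: isometry_map_isometries.
- exact: isometry_map_mul.
- exact: isometry_open.
Qed.

Lemma circle_angle (a b : R) : a ^+ 2 + b ^+ 2 = 1 -> exists th, cos th = a /\ sin th = b.
Proof.
move=> ab.
have a1 : -1 <= a <= 1.
  rewrite -ler_norml -(@expr_le1 _ 2)// real_normK ?num_real//.
  by have := sqr_ge0 b; lra.
have bE : Num.sqrt (1 - a ^+ 2) = `|b|.
  by rewrite -sqrtr_sqr; congr Num.sqrt; lra.
have [b0|b0] := leP 0 b.
  by exists (acos a); rewrite acosK// sin_acos// bE ger0_norm.
exists (- acos a); rewrite cosN sinN acosK// sin_acos// bE ltr0_norm//.
by rewrite opprK.
Qed.

(** Scaling the translation parameters and the angle joins a member of the group to the identity.
    Conversely, eps and kap are continuous on the function space and have square 1 on isometries, so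
    on a connected set of isometries containing the identity they cannot leave the value 1. *)
Lemma model_identity_component : isometry_identity_component (model R) = model_group R.
Proof.
apply/seteqP; split=> F; last first.
  move=> /model_groupP[x [s [[_ _ h2] s0 s1 ->]]].
  have [th [cth sth]] := circle_angle h2.
  have gs (r : R) : is_sign (row4 1 1 (cos (r * th)) (sin (r * th))).
    by split; rewrite !row4E ?expr1n// cos2Dsin2.
  pose h (r : R) : L := make_isometry (r *: x) (gs r).
  have hc : continuous h.
    move=> r; apply: class_continuous.
    have cid : {for r, continuous (fun r : R => r)} by exact: cvg_id.
    have ct (a : R) : {for r, continuous (fun r : R => r * a)}.
      by apply: scalar_mulc => //; exact: scalar_cstc.
    split=> j.
      rewrite (_ : (fun v => _) = (fun v => v * x 0 j)) //.
      by apply/funext => v; rewrite make_tp mxE.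
    rewrite (_ : (fun v => _) = (fun v => row4 1 1 (cos (v * th)) (sin (v * th)) 0 j)).
      apply: row4_continuous; do ?[exact: scalar_cstc].
        exact: (continuous_comp (ct th) (@continuous_cos _ _)).
      exact: (continuous_comp (ct th) (@continuous_sin _ _)).
    by apply/funext => v; rewrite make_sp.
  have Hc : continuous ((@isometry_map R : L -> maps) \o h).
    by move=> r; apply: continuous_comp; [exact: hc|exact: isometry_map_continuous].
  exists (((@isometry_map R : L -> maps) \o h) @` setT).
    split.
    - exists 0 => //; rewrite /= /h /isometry_map make_tp make_sp scale0r mul0r cos0 sin0.
      by apply/funext => y; exact: isom_map_one.
    - by move=> _ [r _ <-]; rewrite -isometry_map_isometries; exists (h r).
    - apply: connected_continuous_connected; last exact: continuous_subspaceT.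
      by apply/connected_intervalP.
  exists 1 => //; rewrite /= /h /isometry_map make_tp make_sp scale1r mul1r cth sth.
  by rewrite [s in RHS]row4_eta s0 s1.
move=> [B [Bid BI Bc] BF].
(* The image of B under f is an interval; between 1 and -1 it would contain 0, whose square is not
   1. *)
have sgn (f : maps -> R) : continuous f -> f id = 1 ->
    (forall G, isometries (model R) G -> f G ^+ 2 = 1) -> f F = 1.
  move=> fc f1 f2; have [//|fN] := sign_cases (f2 F (BI F BF)).
  have /connected_intervalP iv : connected (f @` B).
    by apply: connected_continuous_connected => //; exact: continuous_subspaceT.
  have [G BG G0] : (f @` B) 0.
    apply: (iv (-1) 1); [by exists F|by exists (id : maps)|].
    by rewrite lerN10 ler01.
  have := f2 G (BI G BG); rewrite G0 expr0n /= => /eqP.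
  by rewrite eq_sym oner_eq0.
have sE G : isometries (model R) G -> is_sign (isom_sign G) .
  rewrite -isometry_map_isometries => -[l _ <-]; rewrite isom_signK.
  exact: sign_partP.
have sid : isom_sign (id : maps) = sign_one R.
  by rewrite -(isometry_map_one R) isom_signK make_sp.
have s0 : isom_sign F 0 0 = 1.
  apply: (sgn (fun F => isom_sign F 0 0)).
  - by move=> G; exact: isom_sign_continuous.
  - by rewrite sid row4E.
  - by move=> G /sE[].
have s1 : isom_sign F 0 1 = 1.
  apply: (sgn (fun F => isom_sign F 0 1)).
  - by move=> G; exact: isom_sign_continuous.
  - by rewrite sid row4E.
  - by move=> G /sE[].
have : isometries (model R) F by exact: BI.
rewrite -isometry_map_isometries => -[l _ lF]; rewrite -lF isom_signK in s0 s1.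
apply/model_groupP; exists (tp l), (sp l); split=> //; exact: sign_partP.
Qed.

End IsometryGroup.

Theorem theorem4p1 (R : realType) :
  [/\ simply_connected R (model R),
      complete_riemannian (model R) &
      forall M : riemannian R 4, EPS_space M ->
        (exists (N : riemannian R 4) (pi : N -> M),
           riemannian_universal_covering pi) /\
        (forall (N : riemannian R 4) (pi : N -> M),
           riemannian_universal_covering pi -> homothetic N (model R))] /\
  [/\ isometry_group_dim (model R) 5,
      (forall x y : model R, exists2 F, isometries (model R) F & F x = y) &
      isometry_identity_component (model R) = model_group R].
Proof.
split; split.
- exact: model_simply_connected.
- exact: model_complete.
- by move=> M; exact: EPS_universal_covering.
- exact: model_isometry_group_dim.
- exact: model_transitive.
- exact: model_identity_component.
Qed.
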